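(* For all partitions $\kappa\subset\lambda$, the binomial coefficients satisfy the inversion identities $$\sum_{\kappa\subset\mu\subset\lambda}\genfrac[]{0pt}{}{\mu}{\kappa}_{q,t,s}\genfrac\{\}{0pt}{}{\lambda}{\mu}_{q,t,s}=\delta_{\lambda\kappa}$$ and $$\sum_{\kappa\subset\mu\subset\lambda}\genfrac\{\}{0pt}{}{\mu}{\kappa}_{q,t,s}\genfrac[]{0pt}{}{\lambda}{\mu}_{q,t,s}=\delta_{\lambda\kappa}.$$
   Context: Let $\mathbb F=\mathbb Q(q,t)$; $s$ is an indeterminate. For a partition $\lambda$: $\lambda'$ is the conjugate; $(i,j)\in\lambda$ means $1\le i$, $1\le j\le\lambda_i$; $\mu\subset\lambda$ means $\mu_i\le\lambda_i$ for all $i$. $m^n$ is the partition with $n$ parts equal to $m$; for $\lambda\subset m^n$, $m^n-\lambda$ is the partition with $(m^n-\lambda)_i=m-\lambda_{n+1-i}$, $1\le i\le n$. Put $C^0_\lambda(x;q,t)=\prod_{(i,j)\in\lambda}(1-q^{j-1}t^{1-i}x)$, $C^-_\lambda(x;q,t)=\prod_{(i,j)\in\lambda}(1-q^{\lambda_i-j}t^{\lambda'_j-i}x)$, and $$\langle P_\lambda,P_\lambda\rangle''_n=\frac{C^0_\lambda(t^n;q,t)C^-_\lambda(q;q,t)}{C^0_\lambda(qt^{n-1};q,t)C^-_\lambda(t;q,t)}.$$ Interpolation polynomials: $m_\lambda(x)$ is the orbit sum of $\prod_ix_i^{\lambda_i}$ under the group $BC_n$ of permutations of $x_1,\dots,x_n$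 and inversions $x_i\mapsto x_i^{-1}$. Dominance: $\mu\le\lambda$ iff $\mu_1+\dots+\mu_k\le\lambda_1+\dots+\lambda_k$ for all $k\ge1$ (the sizes may differ). For $\lambda$ with at most $n$ parts, $\bar P^{*(n)}_\lambda(x_1,\dots,x_n;q,t,s)$ is the unique $BC_n$-symmetric Laurent polynomial with coefficients in $\mathbb F(s)$ of the form $m_\lambda+\sum_{\mu<\lambda}c_{\lambda\mu}m_\mu$ whose value $\bar P^{*(n)}_\lambda(\mu;q,t,s)$ at $x_i=q^{\mu_i}t^{n-i}s$ ($1\le i\le n$) is $0$ for all partitions $\mu<\lambda$ with at most $n$ parts (it is then $0$ whenever $\lambda\not\subset\mu$, and nonzero for $\mu=\lambda$). Generalized binomial coefficients: with $m,n$ chosen so that $\lambda,\mu\subset m^n$ (the results do not depend on the choice; the independence of the second on $n$ is itself obtained in the paper as a consequence of this theorem, so the identities may be read with any fixed $m,n$ such that $\lambda\subset m^n$), $$\genfrac[]{0pt}{}{\lambda}{\mu}_{q,t,s}=\frac{\bar P^{*(n)}_\mu(\lambda;q,t,t^{1-n}s)}{\bar P^{*(n)}_\mu(\mu;q,t,t^{1-n}s)},$$ $$\genfrac\{\}{0pt}{}{\lambda}{\mu}_{q,t,s}=\frac{\langle P_\mu,P_\mu\rangle''_n\,\bar P^{*(n)}_\lambda(\lambda;q,t,t^{1-n}s)\,\bar P^{*(n)}_{m^n-\lambda}(m^n-\mu;q,t,q^{-m}/s)}{\langle P_\lambda,P_\lambda\rangle''_n\,\bar P^{*(n)}_\mu(\mu;q,t,t^{1-n}s)\,\bar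 P^{*(n)}_{m^n-\mu}(m^n-\mu;q,t,q^{-m}/s)}.$$ *)

(* Defs.v *)
From HB Require Import structures.
From mathcomp Require Import all_boot all_order all_fingroup all_algebra.
From mathcomp Require Import fraction finmap monalg.
From Stdlib Require Import ClassicalEpsilon.

Set Implicit Arguments.
Unset Strict Implicit.
Unset Printing Implicit Defensive.

Import GRing.Theory.

Local Open Scope ring_scope.

(* Rows, columns, parts and variables are numbered from 0: row i, column j and
   variable x_i of the usual formulas are row i.-1, column j.-1 and x_(i.-1)
   here. *)

(* Partitions with at most n parts, padded with zeros to length n. *)

Definition decreasing n (l : {ffun 'I_n -> nat}) : bool :=
  [forall i : 'I_n, forall j : 'I_n, (i <= j)%N ==> (l j <= l i)%N].

Record part (n : nat) := Part {
  part_fun :> {ffun 'I_n -> nat};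
  part_decreasing : decreasing part_fun
}.

HB.instance Definition _ n := [isSub for @part_fun n].
HB.instance Definition _ n := [Choice of part n by <:].

Section Partitions.
Variable n : nat.
Implicit Types mu la : part n.

Definition included mu la : bool := [forall i : 'I_n, (mu i <= la i)%N].

(* Partial sums of order k > n repeat the one of order n. *)
Definition dominated mu la : bool :=
  [forall k : 'I_n.+1,
    (\sum_(i < n | i < k) mu i <= \sum_(i < n | i < k) la i)%N].

Definition strictly_dominated mu la : bool := dominated mu la && (mu != la).

Definition conj_part la (j : nat) : nat := #|[set i : 'I_n | (j < la i)%N]|.

Lemma rect_decreasing (m : nat) : decreasing [ffun _ : 'I_n => m].
Proof. by apply/forallP=> i; apply/forallP=> j; rewrite !ffunE leqnn implybT. Qed.

(* m^n *)
Definition rect (m : nat) : part n := Part (rect_decreasing m).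

Lemma complement_decreasing (m : nat) la :
  decreasing [ffun i : 'I_n => (m - la (rev_ord i))%N].
Proof.
apply/forallP=> i; apply/forallP=> j; apply/implyP=> le_ij; rewrite !ffunE.
apply: leq_sub2l.
have /forallP /(_ (rev_ord j)) /forallP /(_ (rev_ord i)) := part_decreasing la.
by move/implyP; apply; rewrite /= leq_sub2l.
Qed.

(* m^n - la; the subtraction truncates nothing when la is included in m^n. *)
Definition complement (m : nat) la : part n := Part (complement_decreasing m la).

(* The partitions included in m^n, each listed once. *)
Definition parts_in_rect (m : nat) : seq (part n) :=
  pmap insub [seq [ffun i => val (u i)] | u : {ffun 'I_n -> 'I_m.+1}].

Lemma mem_parts_in_rect (m : nat) mu :
  (mu \in parts_in_rect m) = included mu (rect m).
Proof.
rewrite mem_pmap_sub; apply/mapP/forallP => [[u _ /ffunP mu_u] i | le_mu].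
  by rewrite mu_u !ffunE -ltnS ltn_ord.
exists [ffun i => inord (mu i)]; first by rewrite mem_enum.
apply/ffunP=> i; rewrite !ffunE /= inordK // ltnS.
by have := le_mu i; rewrite ffunE.
Qed.

Lemma parts_in_rect_uniq (m : nat) : uniq (parts_in_rect m).
Proof.
apply: pmap_sub_uniq; rewrite map_inj_uniq ?enum_uniq // => u v /ffunP eq_uv.
by apply/ffunP=> i; have := eq_uv i; rewrite !ffunE => /val_inj.
Qed.

End Partitions.

(* Laurent polynomials in n variables: finitely supported functions from
   exponent vectors in Z^n to K. *)

Notation laurent K n := {malg K[{ffun 'I_n -> int}]}.

Section Laurent.
Variables (K : fieldType) (n : nat).

Definition laurent_eval (f : laurent K n) (x : 'I_n -> K) : K :=
  \sum_(k <- msupp f) f@_k * \prod_(i < n) x i ^ k i.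

(* Action on exponent vectors of the element of BC_n given by a permutation
   and a choice of the variables to invert. *)
Definition bc_act (w : 'S_n * {ffun 'I_n -> bool}) (k : {ffun 'I_n -> int}) :
    {ffun 'I_n -> int} :=
  [ffun i => (-1) ^+ w.2 i * k (w.1 i)].

Definition bc_symmetric (f : laurent K n) : Prop :=
  forall w k, f@_(bc_act w k) = f@_k.

Definition bc_orbit (k : {ffun 'I_n -> int}) : seq {ffun 'I_n -> int} :=
  undup [seq bc_act w k | w : 'S_n * {ffun 'I_n -> bool}].

Definition monomial_sym (la : part n) : laurent K n :=
  \sum_(k <- bc_orbit [ffun i => (la i)%:Z]) << k >>.

End Laurent.

Section Interpolation.
Variables (K : fieldType) (q t : K).

Definition node n (mu : part n) (s : K) (i : 'I_n) : K :=
  q ^+ mu i * t ^+ (n - i.+1)%N * s.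

Definition is_interpolation n (la : part n) (s : K) (f : laurent K n) : Prop :=
  [/\ bc_symmetric f,
      exists (r : seq (part n)) (c : part n -> K),
        all (fun mu => strictly_dominated mu la) r /\
        f = monomial_sym K la + \sum_(mu <- r) c mu *: monomial_sym K mu
    & forall mu : part n, strictly_dominated mu la ->
        laurent_eval f (node mu s) = 0].

(* The interpolation polynomial with parameter s, "the" solution of the
   conditions above.  When K = F(s) and the parameter is u * s or u / s with u
   a nonzero element of F, sending s to the parameter is an automorphism of
   F(s) over F, so this is the polynomial of parameter s in which the parameter
   has been substituted for s. *)
Definition interpolation n (la : part n) (s : K) : laurent K n :=
  epsilon (inhabits 0) (is_interpolation la s).

(* The value at mu of the interpolation polynomial of index la. *)
Definition interp_at n (la mu : part n) (s : K) : K :=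
  laurent_eval (interpolation la s) (node mu s).

Definition C0 n (la : part n) (x : K) : K :=
  \prod_(i < n) \prod_(j < la i) (1 - q ^+ j * t ^- i * x).

(* j.+1 <= la i and i.+1 <= conj_part la j for every box (i, j). *)
Definition Cminus n (la : part n) (x : K) : K :=
  \prod_(i < n) \prod_(j < la i)
    (1 - q ^+ (la i - j.+1)%N * t ^+ (conj_part la j - i.+1)%N * x).

(* <P_la, P_la>''_n *)
Definition norm2 n (la : part n) : K :=
  (C0 la (t ^+ n) * Cminus la q) /
  (C0 la (q * t ^ (n%:Z - 1)) * Cminus la t).

(* [la, mu]_{q,t,s} *)
Definition sqbinom n (s : K) (la mu : part n) : K :=
  interp_at mu la (t ^ (1 - n%:Z) * s) / interp_at mu mu (t ^ (1 - n%:Z) * s).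

(* {la, mu}_{q,t,s}, computed in the rectangle m^n *)
Definition curlybinom n (m : nat) (s : K) (la mu : part n) : K :=
  (norm2 mu * interp_at la la (t ^ (1 - n%:Z) * s)
     * interp_at (complement m la) (complement m mu) (q ^- m / s)) /
  (norm2 la * interp_at mu mu (t ^ (1 - n%:Z) * s)
     * interp_at (complement m mu) (complement m mu) (q ^- m / s)).

End Interpolation.

(* F = Q(q,t), as the fraction field of Q[q][t], and F(s). *)

Definition Fqt : fieldType := {fraction {poly {poly rat}}}.

Definition Fqts : fieldType := {fraction {poly Fqt}}.

Definition qF : Fqts := tofrac ((tofrac ('X%:P : {poly {poly rat}}) : Fqt)%:P).
Definition tF : Fqts := tofrac ((tofrac ('X : {poly {poly rat}}) : Fqt)%:P).
Definition sF : Fqts := tofrac 'X.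

(* Main.v *)
Require Import Defs.
From mathcomp Require Import all_boot all_order all_fingroup all_algebra all_field.
From mathcomp Require Import fraction finmap monalg zify ring.
From Stdlib Require Import ClassicalEpsilon FunctionalExtensionality.

Set Implicit Arguments.
Unset Strict Implicit.
Unset Printing Implicit Defensive.

Import Order.TTheory GRing.Theory Num.Theory.

Local Open Scope ring_scope.

(** The binomial coefficients of the two kinds are the entries of two matrices
    indexed by the partitions in the rectangle and triangular for inclusion, and
    the two identities are the two ways of multiplying these matrices.  So the
    second identity follows from the first ([triangular_inverse]), and for
    [ka != la] the first says that the sum over all [mu] in the rectangle of
    [w(mu) P_ka(mu) P_(la^c)(mu^c)] is zero, where [P] stands for interpolation
    polynomials, [^c] for the complement in the rectangle, and [w(mu)] is the norm
    of [P_mu] divided by [P_mu(mu) P_(mu^c)(mu^c)] ([biorthogonal]).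

    This biorthogonality comes from a difference operator depending on a free
    parameter [b],
      [(D f)(x) = \sum_e Phi(x^e) f(p x^e)],
    where [p^2 = q] and [x^e] runs over the points obtained from [x] by inverting
    some coordinates ([shift_op]).  It has three properties.

    - [D] preserves symmetric Laurent polynomials, because its product with the
      Weyl denominator is alternating ([alternating_div]).  It is triangular for
      dominance, with an explicit eigenvalue [E_la(b)] ([shift_op_lead]).

    - At the node of [mu] with parameter [r], the function [Phi(x^e)] vanishes
      unless [p x^e] is, up to inversions, the node with parameter [p r] of a
      partition [nu] with [mu / nu] a vertical strip ([kernel_support]).  Hence [D]
      maps the interpolation polynomial of [la] with parameter [p r] to [E_la(b)]
      times the one with parameter [r] ([interp_at_shift]).  A [b] that annihilates
      [E_la(b)] gives the vanishing of [P_la(mu)] unless [la] is included in [mu]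
      ([interp_at_eq0]).

    - The weights are in detailed balance: conjugated by them, the matrix of [D] is
      up to a constant the transpose of the matrix of the same operator at the
      complementary nodes, with [p / b] in the place of [b] ([strip_balance]).

    Therefore [E_ka(b)] times the sum is the sum in which the operator is applied to
    [P_(la^c)] instead of [P_ka], and it is zero for a [b] that annihilates the
    eigenvalue of [la^c] but not that of [ka].

    The detailed balance is checked factor by factor on product formulas for the
    diagonal values ([interp_at_diag]) and for the norms ([norm2E]), which are
    proved by removing zero parts and full columns from the partition.

    The only property of [q], [t] and [s] that matters is their multiplicative
    independence, which is enough for the existence and uniqueness of interpolation
    polynomials ([interpolation_surjective], [interpolation_unique]).  These are thus
    compatible with field extensions ([interp_at_rmorph]), and a square root of [q]
    may be adjoined. *)

(** * Laurent polynomial functions *)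

Section LaurentFunctions.
Variable K : fieldType.

Definition nonzero n (x : 'I_n -> K) := forall i, x i != 0.

Definition mono n (x : 'I_n -> K) (k : {ffun 'I_n -> int}) : K :=
  \prod_(i < n) x i ^ k i.

(** Laurent polynomials are handled as functions, so that composing them with maps
    of points and dividing by nonvanishing factors need no algebra of coefficients. *)
Definition laurent_fun n (F : ('I_n -> K) -> K) := exists r : seq (K * {ffun 'I_n -> int}),
  forall x, nonzero x -> F x = \sum_(u <- r) u.1 * mono x u.2.

Lemma monoD n (x : 'I_n -> K) (k l : {ffun 'I_n -> int}) : nonzero x ->
  mono x [ffun i => k i + l i] = mono x k * mono x l.
Proof.
move=> nzx; rewrite /mono -big_split /=; apply: eq_bigr => i _.
by rewrite ffunE expfzDr.
Qed.

Lemma laurent_ext n (F G : ('I_n -> K) -> K) :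
  (forall x, nonzero x -> F x = G x) -> laurent_fun F -> laurent_fun G.
Proof. by move=> FG [r Fr]; exists r => x nzx; rewrite -FG // Fr. Qed.

Lemma laurent_const n c : laurent_fun (fun _ : 'I_n -> K => c).
Proof.
exists [:: (c, [ffun=> 0])] => x _; rewrite big_seq1 /= /mono big1 ?mulr1 //.
by move=> i _; rewrite ffunE expr0z.
Qed.

Lemma laurent_add n (F G : ('I_n -> K) -> K) :
  laurent_fun F -> laurent_fun G -> laurent_fun (fun x => F x + G x).
Proof.
move=> [r Fr] [s Gs]; exists (r ++ s) => x nzx.
by rewrite big_cat /= Fr // Gs.
Qed.

Lemma laurent_mul n (F G : ('I_n -> K) -> K) :
  laurent_fun F -> laurent_fun G -> laurent_fun (fun x => F x * G x).
Proof.
move=> [r Fr] [s Gs].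
exists (allpairs (fun u v : K * {ffun 'I_n -> int} =>
  (u.1 * v.1, [ffun i => u.2 i + v.2 i] : {ffun 'I_n -> int})) r s) => x nzx.
rewrite big_allpairs_dep /= Fr // Gs // mulr_suml; apply: eq_bigr => u _.
rewrite mulr_sumr; apply: eq_bigr => v _ /=.
by rewrite monoD // mulrACA.
Qed.

Lemma laurent_opp n (F : ('I_n -> K) -> K) :
  laurent_fun F -> laurent_fun (fun x => - F x).
Proof.
move=> LF; apply: (laurent_ext _ (laurent_mul (laurent_const n (-1)) LF)) => x _.
by rewrite mulN1r.
Qed.

Lemma laurent_sum n I (r : seq I) (P : pred I) (F : I -> ('I_n -> K) -> K) :
  (forall i, P i -> laurent_fun (F i)) ->
  laurent_fun (fun x => \sum_(i <- r | P i) F i x).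
Proof.
move=> LF; elim: r => [|i r IHr].
  by apply: (laurent_ext _ (laurent_const n 0)) => x _; rewrite big_nil.
case Pi: (P i); last by apply: laurent_ext IHr => x _; rewrite big_cons Pi.
apply: (laurent_ext _ (laurent_add (LF i Pi) IHr)) => x _.
by rewrite big_cons Pi.
Qed.

Lemma laurent_prod n I (r : seq I) (P : pred I) (F : I -> ('I_n -> K) -> K) :
  (forall i, P i -> laurent_fun (F i)) ->
  laurent_fun (fun x => \prod_(i <- r | P i) F i x).
Proof.
move=> LF; elim: r => [|i r IHr].
  by apply: (laurent_ext _ (laurent_const n 1)) => x _; rewrite big_nil.
case Pi: (P i); last by apply: laurent_ext IHr => x _; rewrite big_cons Pi.
apply: (laurent_ext _ (laurent_mul (LF i Pi) IHr)) => x _.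
by rewrite big_cons Pi.
Qed.

Lemma laurent_exp n (F : ('I_n -> K) -> K) m :
  laurent_fun F -> laurent_fun (fun x => F x ^+ m).
Proof.
move=> LF; elim: m => [|m IHm].
  by apply: (laurent_ext _ (laurent_const n 1)) => x _; rewrite expr0.
by apply: (laurent_ext _ (laurent_mul LF IHm)) => x _; rewrite exprS.
Qed.

Lemma laurent_coordz n (i : 'I_n) (m : int) : laurent_fun (fun x => x i ^ m).
Proof.
exists [:: (1, [ffun j => if j == i then m else 0])] => x _.
rewrite big_seq1 mul1r /= /mono (bigD1 i) //= ffunE eqxx big1 ?mulr1 //.
by move=> j /negPf ji; rewrite ffunE ji expr0z.
Qed.

Lemma laurent_coord n (i : 'I_n) : laurent_fun (fun x => x i).
Proof. by apply: laurent_ext (laurent_coordz i 1) => x _; rewrite expr1z. Qed.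

Lemma laurent_coordV n (i : 'I_n) : laurent_fun (fun x => (x i)^-1).
Proof. by apply: laurent_ext (laurent_coordz i (-1)) => x _; rewrite exprN1. Qed.

Lemma laurent_comp m n (S : ('I_n -> K) -> 'I_m -> K) (F : ('I_m -> K) -> K) :
  (forall x, nonzero x -> nonzero (S x)) ->
  (forall i (k : int), laurent_fun (fun x => S x i ^ k)) ->
  laurent_fun F -> laurent_fun (fun x => F (S x)).
Proof.
move=> nzS LS [r Fr].
have L1 : laurent_fun (fun x : 'I_n -> K => \sum_(u <- r) u.1 * mono (S x) u.2).
  apply: laurent_sum => u _; apply: laurent_mul; first exact: laurent_const.
  by apply: laurent_prod => i _; apply: LS.
by apply: laurent_ext L1 => x nzx; rewrite Fr //; apply: nzS.
Qed.

(** ** The hyperoctahedral group acting on points *)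

Definition flip n (e : {ffun 'I_n -> bool}) (x : 'I_n -> K) : 'I_n -> K :=
  fun i => if e i then (x i)^-1 else x i.

Definition permute n (s : 'S_n) (x : 'I_n -> K) : 'I_n -> K := fun i => x (s i).

Lemma nonzero_flip n e (x : 'I_n -> K) : nonzero x -> nonzero (flip e x).
Proof. by move=> nzx i; rewrite /flip; case: ifP; rewrite ?invr_eq0. Qed.

Lemma nonzero_permute n s (x : 'I_n -> K) : nonzero x -> nonzero (permute s x).
Proof. by move=> nzx i; apply: nzx. Qed.

Lemma laurent_flip n e (F : ('I_n -> K) -> K) :
  laurent_fun F -> laurent_fun (fun x => F (flip e x)).
Proof.
apply: laurent_comp => [x|i k]; first exact: nonzero_flip.
rewrite /flip; case: (e i); last exact: laurent_coordz.
by apply: laurent_ext (laurent_coordz i (- k)) => x _; rewrite exprz_inv.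
Qed.

Lemma laurent_scale n (c : 'I_n -> K) (F : ('I_n -> K) -> K) : nonzero c ->
  laurent_fun F -> laurent_fun (fun x => F (fun i => c i * x i)).
Proof.
move=> nzc; apply: laurent_comp => [x nzx i|i k]; first by rewrite mulf_neq0.
apply: laurent_ext (laurent_mul (laurent_const n (c i ^ k)) (laurent_coordz i k)).
by move=> x _; rewrite expfzMl.
Qed.

Definition symmetric_fun n (F : ('I_n -> K) -> K) :=
  (forall s x, nonzero x -> F (permute s x) = F x) /\
  (forall e x, nonzero x -> F (flip e x) = F x).

(** The inverse of the permutation appears so that [mono_bc_act] holds. *)
Definition hyper_act n (w : 'S_n * {ffun 'I_n -> bool}) (x : 'I_n -> K) : 'I_n -> K :=
  flip [ffun j => w.2 (w.1^-1 j)%g] (permute w.1^-1%g x).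

Lemma mono_bc_act n w (x : 'I_n -> K) k :
  mono x (bc_act w k) = mono (hyper_act w x) k.
Proof.
rewrite /mono (reindex_inj (@perm_inj _ w.1^-1%g)) /=; apply: eq_bigr => j _.
rewrite /bc_act /hyper_act /flip /permute !ffunE permKV.
by case: (w.2 _); rewrite ?mul1r // expr1 mulN1r exprz_inv.
Qed.

Lemma symmetric_hyper_act n (F : ('I_n -> K) -> K) w x :
  symmetric_fun F -> nonzero x -> F (hyper_act w x) = F x.
Proof.
case=> Fp Ff nzx; rewrite /hyper_act Ff ?Fp //; exact: nonzero_permute.
Qed.

Lemma nonzero_hyper_act n w (x : 'I_n -> K) : nonzero x -> nonzero (hyper_act w x).
Proof. by move=> nzx; apply/nonzero_flip/nonzero_permute. Qed.

(** ** Orbit sums *)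

Definition exponent n (la : part n) : {ffun 'I_n -> int} := [ffun i => (la i)%:Z].

Definition orbit_sum n (la : part n) (x : 'I_n -> K) : K :=
  \sum_(k <- bc_orbit (exponent la)) mono x k.

End LaurentFunctions.

Section Orbits.
Variable n : nat.
Implicit Types (k : {ffun 'I_n -> int}) (w : 'S_n * {ffun 'I_n -> bool}).

Definition hyper_mul w w' : 'S_n * {ffun 'I_n -> bool} :=
  ((w.1 * w'.1)%g, [ffun i => w.2 i (+) w'.2 (w.1 i)]).

Lemma bc_act_comp w w' k : bc_act w (bc_act w' k) = bc_act (hyper_mul w w') k.
Proof.
apply/ffunP => i; rewrite !ffunE /= permM mulrA; congr (_ * _).
by rewrite -signr_addb.
Qed.

Definition hyper_inv w : 'S_n * {ffun 'I_n -> bool} :=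
  (w.1^-1%g, [ffun i => w.2 (w.1^-1%g i)]).

Lemma hyper_mulV w k : bc_act w (bc_act (hyper_inv w) k) = k.
Proof.
apply/ffunP => i; rewrite !ffunE /= permK mulrA.
by case: (w.2 i); rewrite ?mul1r // expr1 mulN1r mulNr mul1r opprK.
Qed.

Lemma hyper_mulV' w k : bc_act (hyper_inv w) (bc_act w k) = k.
Proof.
apply/ffunP => i; rewrite !ffunE /= permKV mulrA.
by case: (w.2 _); rewrite ?mul1r // expr1 mulN1r mulNr mul1r opprK.
Qed.

Lemma bc_act_inj w : injective (bc_act w).
Proof. exact: can_inj (hyper_mulV' w). Qed.

Lemma mem_bc_orbit k l : reflect (exists w, l = bc_act w k) (l \in bc_orbit k).
Proof.
rewrite mem_undup; apply: (iffP mapP) => [[w _ ->]|[w ->]]; first by exists w.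
by exists w; rewrite // mem_enum.
Qed.

Lemma bc_orbit_uniq k : uniq (bc_orbit k).
Proof. exact: undup_uniq. Qed.

Lemma bc_orbit_act k l w : (bc_act w l \in bc_orbit k) = (l \in bc_orbit k).
Proof.
apply/mem_bc_orbit/mem_bc_orbit => [[w' e]|[w' ->]].
  by exists (hyper_mul (hyper_inv w) w'); rewrite -bc_act_comp -e hyper_mulV'.
by exists (hyper_mul w w'); rewrite bc_act_comp.
Qed.

Lemma perm_bc_orbit k w : perm_eq [seq bc_act w l | l <- bc_orbit k] (bc_orbit k).
Proof.
apply: uniq_perm; rewrite ?bc_orbit_uniq // ?(map_inj_uniq (@bc_act_inj w)) ?bc_orbit_uniq //.
move=> l; rewrite -(hyper_mulV w l) (mem_map (@bc_act_inj w)) bc_orbit_act.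
by rewrite hyper_mulV.
Qed.

Lemma hyper_mul_bij w : bijective (fun w' => hyper_mul w' w).
Proof.
apply: injF_bij => [] [s e] [s' e'] [/mulIg <- /ffunP ee]; congr pair.
by apply/ffunP => i; have := ee i; rewrite !ffunE /= => /addIb.
Qed.

End Orbits.

Section OrbitSums.
Variable K : fieldType.
Hypothesis char0 : [pchar K] =i pred0.

Lemma natr_neq0 m : (0 < m)%N -> m%:R != 0 :> K.
Proof. by move=> m_gt0; rewrite ((pcharf0P K).1 char0) -lt0n. Qed.

Lemma hyper_act_permute n s (x : 'I_n -> K) :
  hyper_act (s^-1%g, [ffun=> false]) x = permute s x.
Proof.
by apply: functional_extensionality => i; rewrite /hyper_act /flip !ffunE /= invgK.
Qed.

Lemma hyper_act_flip n e (x : 'I_n -> K) : hyper_act (1%g, e) x = flip e x.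
Proof.
apply: functional_extensionality => i.
by rewrite /hyper_act /flip /permute !ffunE /= invg1 !perm1.
Qed.

Lemma orbit_sum_hyper_act n (la : part n) w (x : 'I_n -> K) :
  orbit_sum la (hyper_act w x) = orbit_sum la x.
Proof.
rewrite /orbit_sum -[RHS](perm_big _ (perm_bc_orbit (exponent la) w)) big_map.
by apply: eq_bigr => k _; rewrite mono_bc_act.
Qed.

Lemma orbit_sum_symmetric n (la : part n) : symmetric_fun (@orbit_sum K n la).
Proof.
by split=> [s|e] x _; rewrite -?hyper_act_permute -?hyper_act_flip orbit_sum_hyper_act.
Qed.

Lemma orbit_sum_laurent n (la : part n) : laurent_fun (@orbit_sum K n la).
Proof.
exists [seq (1, k) | k <- bc_orbit (exponent la)] => x _.
by rewrite big_map; apply: eq_bigr => k _; rewrite mul1r.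
Qed.

(** Sort the absolute values and record the signs. *)
Lemma bc_act_exponent n (k : {ffun 'I_n -> int}) :
  exists w (la : part n), k = bc_act w (exponent la).
Proof.
pose t := [tuple `|k i|%N | i < n].
have /tuple_permP [p ep] : perm_eq t (sort_tuple geq t) by rewrite perm_sym perm_sort.
have dec : decreasing [ffun i : 'I_n => tnth (sort_tuple geq t) i].
  apply/forallP => i; apply/forallP => j; apply/implyP => ij; rewrite !ffunE.
  have S : sorted geq (sort_tuple geq t) by apply: sort_sorted => a b; exact: leq_total.
  rewrite !(tnth_nth 0%N).
  apply: (sorted_leq_nth (fun a b c h1 h2 => leq_trans h2 h1) (leqnn) 0%N S) => //;
  by rewrite inE size_tuple ltn_ord.
exists (p, [ffun i => (k i < 0)%R]), (Part dec); apply/ffunP => i.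
rewrite !ffunE /=.
have -> : tnth (sort_tuple geq t) (p i) = `|k i|%N.
  have := congr1 (fun s => nth 0%N s i) ep.
  by rewrite -!tnth_nth !tnth_mktuple.
by rewrite abszE; case: ltrP => [/ltr0_norm ->|/ger0_norm ->];
  rewrite ?mul1r // expr1 mulN1r opprK.
Qed.

Lemma bc_orbit_size_gt0 n (k : {ffun 'I_n -> int}) : (0 < size (bc_orbit k))%N.
Proof.
suff : bc_act (1%g, [ffun=> false]) k \in bc_orbit k by case: bc_orbit.
by apply/mem_bc_orbit; eexists.
Qed.

Lemma hyper_group_gt0 n : (0 < #|{: 'S_n * {ffun 'I_n -> bool}}|)%N.
Proof. by apply/card_gt0P; exists (1%g, [ffun=> false]). Qed.

(** The sum over the group repeats every monomial of the orbit equally often; the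
    multiplicity is found by summing an orbit sum over the group in two ways. *)
Lemma sum_hyper_mono n (k : {ffun 'I_n -> int}) : exists (c : K) (la : part n),
  forall x, \sum_w mono (hyper_act w x) k = c * orbit_sum la x.
Proof.
have [w0 [la k_la]] := bc_act_exponent k.
pose N := #|{: 'S_n * {ffun 'I_n -> bool}}|; pose m := size (bc_orbit (exponent la)).
exists (N%:R / m%:R), la => x.
pose A := \sum_w mono x (bc_act w (exponent la)).
have orbA l : l \in bc_orbit (exponent la) -> \sum_w mono (hyper_act w x) l = A.
  case/mem_bc_orbit => w1 ->; rewrite /A [RHS](reindex _ (onW_bij _ (hyper_mul_bij w1))) /=.
  by apply: eq_bigr => w _; rewrite -bc_act_comp -mono_bc_act.
rewrite k_la orbA; last by apply/mem_bc_orbit; exists w0.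
have e : N%:R * orbit_sum la x = m%:R * A.
  transitivity (\sum_(w : 'S_n * {ffun 'I_n -> bool}) orbit_sum la (hyper_act w x)).
    under eq_bigr => w _ do rewrite orbit_sum_hyper_act.
    by rewrite sumr_const mulr_natl.
  rewrite exchange_big /= big_seq.
  under eq_bigr => l lo do rewrite orbA //.
  by rewrite -big_seq big_const_seq count_predT iter_addr_0 mulr_natl.
have m_neq0 : m%:R != 0 :> K by apply/natr_neq0/bc_orbit_size_gt0.
by rewrite mulrAC e mulrC mulKf.
Qed.

(** ** Spans of orbit sums *)

Definition in_span n (P : pred (part n)) (F : ('I_n -> K) -> K) :=
  exists r : seq (K * part n), all (fun u => P u.2) r /\
    forall x, nonzero x -> F x = \sum_(u <- r) u.1 * orbit_sum u.2 x.

Lemma span_ext n (P : pred (part n)) F G :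
  (forall x, nonzero x -> F x = G x) -> in_span P F -> in_span P G.
Proof. by move=> FG [r [Pr Fr]]; exists r; split=> // x nzx; rewrite -FG // Fr. Qed.

Lemma sub_span n (P Q : pred (part n)) F :
  (forall la, P la -> Q la) -> in_span P F -> in_span Q F.
Proof.
move=> PQ [r [Pr Fr]]; exists r; split=> //.
by apply: sub_all Pr => u; apply: PQ.
Qed.

Lemma span0 n (P : pred (part n)) : in_span P (fun=> 0).
Proof. by exists [::]; split=> // x _; rewrite big_nil. Qed.

Lemma span_orbit_sum n (P : pred (part n)) la : P la -> in_span P (orbit_sum la).
Proof.
move=> Pla; exists [:: (1, la)]; split=> [|x _]; first by rewrite /= Pla.
by rewrite big_seq1 mul1r.
Qed.

Lemma span_add n (P : pred (part n)) F G :
  in_span P F -> in_span P G -> in_span P (fun x => F x + G x).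
Proof.
move=> [r [Pr Fr]] [s [Ps Gs]]; exists (r ++ s); split=> [|x nzx].
  by rewrite all_cat Pr.
by rewrite big_cat /= Fr // Gs.
Qed.

Lemma span_scale n (P : pred (part n)) c F :
  in_span P F -> in_span P (fun x => c * F x).
Proof.
move=> [r [Pr Fr]]; exists [seq (c * u.1, u.2) | u <- r]; split=> [|x nzx].
  by rewrite all_map.
rewrite big_map Fr // mulr_sumr; apply: eq_bigr => u _ /=; by rewrite mulrA.
Qed.

Lemma span_sub n (P : pred (part n)) F G :
  in_span P F -> in_span P G -> in_span P (fun x => F x - G x).
Proof.
move=> PF PG; apply: span_ext (span_add PF (span_scale (-1) PG)) => x _.
by rewrite mulN1r.
Qed.

Lemma span_sum n (P : pred (part n)) I (r : seq I) (Q : pred I) F :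
  (forall i, Q i -> in_span P (F i)) -> in_span P (fun x => \sum_(i <- r | Q i) F i x).
Proof.
move=> PF; elim: r => [|i r IHr].
  by apply: span_ext (span0 P) => x _; rewrite big_nil.
case Qi: (Q i); last by apply: span_ext IHr => x _; rewrite big_cons Qi.
by apply: span_ext (span_add (PF i Qi) IHr) => x _; rewrite big_cons Qi.
Qed.

Lemma span_laurent n (P : pred (part n)) F : in_span P F -> laurent_fun F.
Proof.
move=> [r [_ Fr]].
apply: (@laurent_ext _ _ (fun x => \sum_(u <- r) u.1 * orbit_sum u.2 x)).
  by move=> x nzx; rewrite Fr.
apply: laurent_sum => u _; apply: laurent_mul; first exact: laurent_const.
exact: orbit_sum_laurent.
Qed.

Lemma span_symmetric n (P : pred (part n)) F : in_span P F -> symmetric_fun F.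
Proof.
move=> [r [_ Fr]]; split=> [s|e] x nzx; rewrite !Fr //;
  try exact: nonzero_permute; try exact: nonzero_flip;
  by apply: eq_bigr => u _; rewrite ?(orbit_sum_symmetric _).1 ?(orbit_sum_symmetric _).2.
Qed.

Lemma average_span n (F : ('I_n -> K) -> K) : laurent_fun F ->
  in_span predT (fun x => \sum_w F (hyper_act w x)).
Proof.
move=> [r Fr].
apply: (@span_ext _ _ (fun x => \sum_(u <- r) u.1 * \sum_w mono (hyper_act w x) u.2)).
  move=> x nzx; under [LHS]eq_bigr => u _ do rewrite mulr_sumr.
  rewrite exchange_big /=; apply: eq_bigr => w _; rewrite Fr //.
  exact: nonzero_hyper_act.
apply: span_sum => u _; apply: span_scale.
have [c [la sum_k]] := sum_hyper_mono u.2.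
apply: (@span_ext _ _ (fun x => c * orbit_sum la x)); first by move=> x _.
by apply: span_scale; apply: span_orbit_sum.
Qed.

(** Averaging over the group, whose order is invertible in characteristic zero,
    does not change a symmetric function. *)
Lemma symmetric_span n (F : ('I_n -> K) -> K) :
  laurent_fun F -> symmetric_fun F -> in_span predT F.
Proof.
move=> LF SF; pose N := #|{: 'S_n * {ffun 'I_n -> bool}}|.
apply: span_ext (span_scale N%:R^-1 (average_span LF)) => x nzx.
under eq_bigr => w _ do rewrite symmetric_hyper_act //.
rewrite sumr_const -(mulr_natl (F x)) mulKf //.
exact/natr_neq0/hyper_group_gt0.
Qed.

End OrbitSums.

(** * Division of alternating functions by the Weyl denominator *)

Section Alternating.
Variable K : fieldType.

Definition invsum (u : K) := u + u^-1.

Definition pair_prod n (g : 'I_n -> 'I_n -> K) : K :=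
  \prod_(i < n) \prod_(j < n | (i < j)%N) g i j.

Lemma eq_pair_prod n (g h : 'I_n -> 'I_n -> K) :
  (forall i j : 'I_n, (i < j)%N -> g i j = h i j) -> pair_prod g = pair_prod h.
Proof. by move=> gh; apply: eq_bigr => i _; apply: eq_bigr => j; apply: gh. Qed.

Lemma pair_prodM n (g h : 'I_n -> 'I_n -> K) :
  pair_prod (fun i j => g i j * h i j) = pair_prod g * pair_prod h.
Proof. by rewrite /pair_prod -big_split; apply: eq_bigr => i _; rewrite big_split. Qed.

Lemma pair_prod_perm n (s : 'S_n) (g : 'I_n -> 'I_n -> K) :
  (forall i j, g i j = g j i) ->
  pair_prod (fun i j => g (s i) (s j)) = pair_prod g.
Proof.
move=> gC; rewrite /pair_prod !pair_big_dep /=.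
pose h (t : 'S_n) (u : 'I_n * 'I_n) :=
  if (t u.1 < t u.2)%N then (t u.1, t u.2) else (t u.2, t u.1).
have hK (t : 'S_n) (u : 'I_n * 'I_n) : (u.1 < u.2)%N -> h t^-1%g (h t u) = u.
  case: u => i j /= ij; rewrite /h /=.
  case tij: (t i < t j)%N; rewrite /= !permK ?ij //.
  by rewrite ltnNge ltnW.
have h_lt (t : 'S_n) (u : 'I_n * 'I_n) : (u.1 < u.2)%N -> ((h t u).1 < (h t u).2)%N.
  case: u => i j /= ij; rewrite /h /=; case: (ltngtP (t i) (t j)) => //= tij.
  by move: ij; rewrite (perm_inj (ord_inj tij)) ltnn.
rewrite [RHS](reindex_onto (h s) (h s^-1%g)) /=; last first.
  by move=> u /(hK s^-1%g); rewrite invgK.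
apply: eq_big => [u|u uu].
  apply/idP/andP => [uu|[lt /eqP e]]; first by rewrite h_lt ?hK.
  by rewrite -e; apply: h_lt.
by rewrite /h; case: ifP => //=; rewrite gC.
Qed.

Lemma vandermonde_perm n (s : 'S_n) (a : 'I_n -> K) :
  pair_prod (fun i j => a (s j) - a (s i)) = (-1) ^+ s * pair_prod (fun i j => a j - a i).
Proof.
have V (b : 'I_n -> K) : pair_prod (fun i j => b j - b i) = \det (Vandermonde n (\row_i b i)).
  by rewrite det_Vandermonde; apply: eq_pair_prod => i j _; rewrite !mxE.
rewrite !V.
have -> : Vandermonde n (\row_i a (s i)) = col_perm s (Vandermonde n (\row_i a i)).
  by apply/matrixP => i j; rewrite !mxE.
by rewrite col_permE det_mulmx det_perm mulrC odd_permV.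
Qed.

(** The Weyl denominator of type C. *)
Definition weyl n (x : 'I_n -> K) : K :=
  \prod_(i < n) (x i - (x i)^-1) * pair_prod (fun i j => invsum (x j) - invsum (x i)).

Definition flip_sign n (e : {ffun 'I_n -> bool}) : K := \prod_(i < n) (-1) ^+ e i.

Lemma invsum_flip n e (x : 'I_n -> K) i : invsum (flip e x i) = invsum (x i).
Proof. by rewrite /invsum /flip; case: ifP => // _; rewrite invrK addrC. Qed.

Lemma weyl_flip n e (x : 'I_n -> K) : weyl (flip e x) = flip_sign e * weyl x.
Proof.
rewrite /weyl [RHS]mulrA; congr (_ * _).
  rewrite -big_split; apply: eq_bigr => i _ /=; rewrite /flip; case: (e i); rewrite ?mul1r //.
  by rewrite invrK expr1 mulN1r opprB.
by apply: eq_pair_prod => i j _; rewrite !invsum_flip.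
Qed.

Lemma weyl_permute n s (x : 'I_n -> K) : weyl (permute s x) = (-1) ^+ s * weyl x.
Proof.
rewrite /weyl /permute (vandermonde_perm s (fun i => invsum (x i))) mulrCA; congr (_ * (_ * _)).
by rewrite [RHS](reindex_inj (@perm_inj _ s)).
Qed.

Lemma flip_signK n e : @flip_sign n e * flip_sign e = 1.
Proof.
by rewrite /flip_sign -big_split big1 => [//|i _] /=; rewrite -signr_addb addbb.
Qed.

Lemma signK m : (-1) ^+ m * (-1) ^+ m = 1 :> K.
Proof. by rewrite -expr2 sqrr_sign. Qed.

(** Up to sign, [P] is a Chebyshev polynomial of the second kind; the three-term
    recurrence constructs it. *)
Lemma chebyshev (k : int) : exists P : {poly K},
  forall x, x != 0 -> x ^ k - x ^ (- k) = (x - x^-1) * P.[invsum x].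
Proof.
suff nat_case m : exists P : {poly K}, forall x, x != 0 ->
    x ^+ m - x ^- m = (x - x^-1) * P.[invsum x].
  case: k => m.
    by have [P PE] := nat_case m; exists P => x nzx; rewrite -PE // -exprnN.
  have [P PE] := nat_case m.+1; exists (- P) => x nzx.
  by rewrite hornerN mulrN -PE // opprB NegzE opprK -exprnN.
elim/ltn_ind: m => -[|[|m]] IH.
- by exists 0 => x _; rewrite horner0 mulr0 expr0 invr1 subrr.
- by exists 1 => x _; rewrite hornerC mulr1 expr1.
have [P PE] := IH m.+1 (ltnSn _); have [Q QE] := IH m (ltnW (ltnSn _)).
exists ('X * P - Q) => x nzx; rewrite hornerD hornerN hornerM hornerX mulrBr.
rewrite mulrCA -PE // -QE // /invsum -!exprVn !exprS.
have nzm : x ^+ m != 0 by rewrite expf_neq0.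
have nzm' : x^-1 ^+ m != 0 by rewrite exprVn invr_eq0.
move: (x ^+ m) (x^-1 ^+ m) => a b; by field.
Qed.

(** The coefficients of the quotient of [C(y) - C(c)] by [y - c]. *)
Definition divdiff d (C : nat -> K) (c : K) (i : nat) : K :=
  \sum_(j < d | (i < j)%N) C j * c ^+ (j - i.+1).

Definition peval d (C : nat -> K) (y : K) : K := \sum_(j < d) C j * y ^+ j.

Lemma peval_divdiff d C c y :
  peval d C y = peval d C c + (y - c) * peval d (divdiff d C c) y.
Proof.
apply/eqP; rewrite addrC -subr_eq /peval -sumrB; apply/eqP.
under [X in _ = _ * X]eq_bigr => i _ do rewrite mulr_suml.
rewrite (exchange_big_dep predT) //= mulr_sumr; apply: eq_bigr => j _.
rewrite -mulrBr -opprB subrXX -mulNr opprB mulrCA; congr (_ * _).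
rewrite mulr_sumr (big_ord_widen d (fun i => C j * (c ^+ (j.-1 - i) * y ^+ i)) (ltnW (ltn_ord j))).
apply: eq_bigr => i ij; rewrite mulrA; congr (_ * c ^+ _ * _).
by case: (nat_of_ord j) ij => // m _; rewrite subSS.
Qed.

Fixpoint newton_coef d (C : nat -> K) (c : nat -> K) (k : nat) : nat -> K :=
  if k is k'.+1 then divdiff d (newton_coef d C c k') (c k') else C.

(** Newton's form of the interpolation of a polynomial at the points [c l].  Divided
    differences are obtained by dividing polynomials, hence are polynomial in the
    points, which may coincide. *)
Lemma newton_expansion d C (c : nat -> K) m y :
  peval d C y = \sum_(k < m) (\prod_(l < k) (y - c l)) * peval d (newton_coef d C c k) (c k)
    + \prod_(l < m) (y - c l) * peval d (newton_coef d C c m) y.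
Proof.
elim: m => [|m IHm]; first by rewrite !big_ord0 mul1r add0r.
rewrite big_ord_recr /= [X in _ + X * _]big_ord_recr /= {1}IHm -addrA; congr (_ + _).
by rewrite {1}(peval_divdiff _ _ (c m)) mulrDr mulrA.
Qed.

Lemma laurent_invsum n (i : 'I_n) : laurent_fun (fun x : 'I_n -> K => invsum (x i)).
Proof. by apply: laurent_add; [exact: laurent_coord | exact: laurent_coordV]. Qed.

(** Newton's expansion of every column at the points [invsum (x i)] writes the matrix
    as a triangular one, whose determinant is the Vandermonde product, times a
    matrix of divided differences. *)
Lemma det_horner_invsum n (P : 'I_n -> {poly K}) : exists G, laurent_fun G /\
  forall x, \det (\matrix_(i, j) (P j).[invsum (x i)]) =
    pair_prod (fun i j => invsum (x j) - invsum (x i)) * G x.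
Proof.
pose d := \max_j size (P j).
(* Newton's expansion takes a sequence of points; it is extended by zeros. *)
pose c (x : 'I_n -> K) (k : nat) := oapp (fun i => invsum (x i)) 0 (insub k : option 'I_n).
have cE x (i : 'I_n) : c x i = invsum (x i) by rewrite /c valK.
have Lc k : laurent_fun (fun x => c x k).
  rewrite /c; case: insub => [i|] /=; [exact: laurent_invsum | exact: laurent_const].
have Lcoef (j : 'I_n) k i : laurent_fun (fun x => newton_coef d (fun m => (P j)`_m) (c x) k i).
  elim: k i => [|k IHk] i /=; first exact: laurent_const.
  apply: laurent_sum => l _; apply: laurent_mul; first exact: IHk.
  exact: laurent_exp.
have PE (j : 'I_n) y : (P j).[y] = peval d (fun m => (P j)`_m) y.
  rewrite horner_coef /peval (big_ord_widen d (fun i => (P j)`_i * y ^+ i)); last first.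
    exact: leq_bigmax.
  rewrite big_mkcond; apply: eq_bigr => i _; case: ltnP => // sz.
  by rewrite nth_default ?mul0r.
pose L x : 'M[K]_n := \matrix_(i, k) \prod_(l < k) (invsum (x i) - c x l).
pose D x : 'M[K]_n := \matrix_(k, j)
   peval d (newton_coef d (fun m => (P j)`_m) (c x) k) (c x k).
exists (fun x => \det (D x)); split.
  apply: laurent_sum => s _; apply: laurent_mul; first exact: laurent_const.
  apply: laurent_prod => i _.
  apply: (@laurent_ext _ _ (fun x => peval d (newton_coef d (fun m => (P (s i))`_m) (c x) i) (c x i))).
    by move=> x _; rewrite mxE.
  apply: laurent_sum => m _; apply: laurent_mul; first exact: Lcoef.
  exact: laurent_exp.
move=> x; have -> : \matrix_(i, j) (P j).[invsum (x i)] = L x *m D x.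
  apply/matrixP => i j; rewrite !mxE PE (newton_expansion _ _ (c x) n).
  rewrite [X in _ + X * _](bigD1 i) //= cE subrr !mul0r addr0.
  by apply: eq_bigr => k _; rewrite !mxE.
rewrite det_mulmx det_trig; last first.
  apply/is_trig_mxP => i k ik; rewrite mxE.
  by rewrite (bigD1 (Ordinal ik)) //= cE subrr mul0r.
congr (_ * _); rewrite /pair_prod (exchange_big_dep predT) //=; apply: eq_bigr => i _.
rewrite mxE (big_ord_widen n (fun l => invsum (x i) - c x l)) 1?ltnW //.
by apply: eq_bigr => l _; rewrite cE.
Qed.

Hypothesis char0 : [pchar K] =i pred0.

(** By multilinearity the alternating sum of a monomial is a determinant with
    entries [x_i ^ k_j - x_i ^ (- k_j)], to which [chebyshev] applies. *)
Lemma alternating_mono n (k : {ffun 'I_n -> int}) : exists G, laurent_fun G /\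
  forall x : 'I_n -> K, nonzero x ->
    \sum_(s : 'S_n) \sum_(e : {ffun 'I_n -> bool})
      (-1) ^+ s * flip_sign e * mono (flip e (permute s x)) k = weyl x * G x.
Proof.
have [P PE] := fin_all_exists (fun i : 'I_n => chebyshev (k i)).
have [G [LG detE]] := det_horner_invsum P.
exists G; split=> // x nzx.
rewrite /weyl -mulrA -detE.
pose B : 'M[K]_n := \matrix_(i, j) (P j).[invsum (x i)].
pose d : 'rV[K]_n := \row_i (x i - (x i)^-1).
have -> : \prod_(i < n) (x i - (x i)^-1) * \det B = \det (diag_mx d *m B)^T.
  rewrite det_tr det_mulmx det_diag; congr (_ * _).
  by apply: eq_bigr => i _; rewrite mxE.
rewrite /determinant; apply: eq_bigr => s _.
rewrite (eq_bigr (fun e => (-1) ^+ s * (flip_sign e * mono (flip e (permute s x)) k))); last first.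
  by move=> e _; rewrite -mulrA.
rewrite -mulr_sumr; congr (_ * _).
transitivity (\prod_(i < n) \sum_(b : bool)
    (-1) ^+ b * (if b then (x (s i))^-1 else x (s i)) ^ k i).
  rewrite bigA_distr_bigA /=; apply: eq_bigr => e _.
  by rewrite /flip_sign /mono -big_split.
apply: eq_bigr => i _; rewrite big_bool /= expr1 expr0 mul1r mulN1r exprz_inv addrC PE //.
rewrite !mxE (bigD1 (s i)) //= !mxE eqxx mulr1n big1 ?addr0 // => j ji.
by rewrite !mxE eq_sym (negPf ji) mul0r.
Qed.

(** Antisymmetrizing [F] multiplies it by the order of the group, and turns each of
    its monomials into a multiple of the Weyl denominator. *)
Lemma alternating_div n (F : ('I_n -> K) -> K) : laurent_fun F ->
  (forall s x, nonzero x -> F (permute s x) = (-1) ^+ s * F x) ->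
  (forall e x, nonzero x -> F (flip e x) = flip_sign e * F x) ->
  exists G, in_span predT G /\ forall x, nonzero x -> F x = weyl x * G x.
Proof.
move=> [r Fr] Fperm Fflip.
pose N : K := (#|{: 'S_n}| * #|{: {ffun 'I_n -> bool}}|)%:R.
have N_neq0 : N != 0.
  apply: natr_neq0 => //; rewrite muln_gt0; apply/andP; split; apply/card_gt0P.
    by exists 1%g.
  by exists [ffun=> false].
have [G [LG GE]] : exists G, laurent_fun G /\
    forall x : 'I_n -> K, nonzero x -> N * F x = weyl x * G x.
  have [H [LH HE]] : exists H, laurent_fun H /\ forall x : 'I_n -> K, nonzero x ->
      \sum_(s : 'S_n) \sum_(e : {ffun 'I_n -> bool})
        (-1) ^+ s * flip_sign e * (\sum_(u <- r) u.1 * mono (flip e (permute s x)) u.2)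
      = weyl x * H x.
    elim: (r) => [|u r' [H [LH HE]]].
      exists (fun=> 0); split=> [|x _]; first exact: laurent_const.
      by rewrite mulr0 big1 // => s _; rewrite big1 // => e _; rewrite big_nil mulr0.
    have [G [LG GE]] := alternating_mono u.2.
    exists (fun x => u.1 * G x + H x); split=> [|x nzx].
      by apply: laurent_add => //; apply: laurent_mul => //; apply: laurent_const.
    rewrite mulrDr mulrCA -GE // -HE // mulr_sumr -big_split; apply: eq_bigr => s _.
    rewrite mulr_sumr -big_split; apply: eq_bigr => e _.
    by rewrite big_cons mulrDr mulrCA.
  exists H; split=> // x nzx; rewrite -HE //.
  under [RHS]eq_bigr => s _.
    under eq_bigr => e _.
      rewrite -Fr; last by apply/nonzero_flip/nonzero_permute.
      rewrite Fflip ?Fperm //; last exact: nonzero_permute.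
      rewrite mulrA -[_ * _ * flip_sign e]mulrA flip_signK mulr1 mulrA signK mul1r; over.
    rewrite sumr_const; over.
  by rewrite sumr_const -mulrnA -(mulr_natl (F x)) mulnC.
have weylG w x : nonzero x -> weyl x * G (hyper_act w x) = N * F x.
  move=> nzx; pose c : K := flip_sign [ffun j => w.2 ((w.1^-1)%g j)] * (-1) ^+ (w.1^-1)%g.
  have cK : c * c = 1 by rewrite /c mulrACA flip_signK signK mulr1.
  have weylc : weyl (hyper_act w x) = c * weyl x.
    by rewrite weyl_flip weyl_permute mulrA.
  have Fc : F (hyper_act w x) = c * F x.
    by rewrite Fflip ?Fperm ?mulrA //; exact: nonzero_permute.
  have -> : weyl x = c * weyl (hyper_act w x) by rewrite weylc mulrA cK mul1r.
  rewrite -mulrA -GE; last exact: nonzero_hyper_act.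
  by rewrite Fc mulrCA [c * (c * _)]mulrA cK mul1r.
(* [G] is known to be symmetric only where the denominator does not vanish, so it
   is replaced by its average. *)
pose M := #|{: 'S_n * {ffun 'I_n -> bool}}|.
exists (fun x => (N * M%:R)^-1 * \sum_w G (hyper_act w x)); split.
  by apply: span_scale; apply: average_span.
move=> x nzx; rewrite mulrCA mulr_sumr.
under eq_bigr => w _ do rewrite weylG //.
have M_neq0 : M%:R != 0 :> K by apply/natr_neq0/hyper_group_gt0.
rewrite sumr_const -(mulr_natl (N * F x)) [_%:R * (N * _)]mulrA [_%:R * N]mulrC mulKf //.
by rewrite mulf_neq0.
Qed.

End Alternating.

(** * Dominance *)

Section Dominance.
Variable n : nat.
Implicit Types la mu nu : part n.

Definition psum la k := (\sum_(i < n | (i < k)%N) la i)%N.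

Lemma psumS la (i : 'I_n) : psum la i.+1 = (psum la i + la i)%N.
Proof.
rewrite /psum (bigD1 i) //= addnC; congr (_ + _)%N.
by apply: eq_bigl => j; rewrite ltnS ltn_neqAle andbC.
Qed.

Lemma psum_ge la k : (n <= k)%N -> psum la k = psum la n.
Proof.
move=> nk; apply: eq_bigl => i.
by rewrite ltn_ord (leq_trans (ltn_ord i) nk).
Qed.

Lemma dominatedP mu la :
  reflect (forall k, (psum mu k <= psum la k)%N) (dominated mu la).
Proof.
apply: (iffP forallP) => [dom k|dom k]; last exact: dom.
case: (leqP k n) => [kn|nk]; first exact: (dom (Ordinal (n := n.+1) (m := k) kn)).
by rewrite !(psum_ge _ (ltnW nk)); exact: (dom (Ordinal (ltnSn n))).
Qed.

Lemma dominated_refl la : dominated la la.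
Proof. by apply/dominatedP. Qed.

Lemma dominated_trans mu la nu : dominated la mu -> dominated mu nu -> dominated la nu.
Proof.
move=> /dominatedP lm /dominatedP mn; apply/dominatedP => k.
exact: leq_trans (lm k) (mn k).
Qed.

Lemma eq_psum mu la : (forall k, psum mu k = psum la k) -> mu = la.
Proof.
move=> e; apply: val_inj; apply/ffunP => i; have := psumS mu i.
by rewrite !e psumS => /addnI.
Qed.

Lemma dominated_anti mu la : dominated mu la -> dominated la mu -> mu = la.
Proof.
move=> /dominatedP ml /dominatedP lm; apply: eq_psum => k.
by apply/eqP; rewrite eqn_leq ml lm.
Qed.

Lemma strictly_dominatedW mu la : strictly_dominated mu la -> dominated mu la.
Proof. by case/andP. Qed.

Lemma dominated_strict_trans mu la nu :
  dominated la mu -> strictly_dominated mu nu -> strictly_dominated la nu.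
Proof.
move=> lm /andP[mn mn_neq]; rewrite /strictly_dominated (dominated_trans lm mn).
by apply: contraNneq mn_neq => e; apply/eqP/dominated_anti => //; rewrite -e.
Qed.

Definition dominance_rank la := (\sum_(k < n.+1) psum la k)%N.

Lemma strictly_dominated_rank mu la :
  strictly_dominated mu la -> (dominance_rank mu < dominance_rank la)%N.
Proof.
move=> /andP[/dominatedP ml neq]; rewrite ltn_neqAle leq_sum ?andbT => [|k _]; last exact: ml.
apply: contra neq => /eqP e; apply/eqP/eq_psum.
have eqk k : (k <= n)%N -> psum mu k = psum la k.
  move=> kn; have [_] := leqif_sum (P := xpredT) (fun (k : 'I_n.+1) _ => leqif_eq (ml k)).
  rewrite -/(dominance_rank mu) -/(dominance_rank la) e eqxx => /esym /forallP.
  by move=> /(_ (Ordinal (n := n.+1) (m := k) kn)) /eqP.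
move=> k; case: (leqP k n) => [/eqk //|/ltnW nk].
by rewrite !(psum_ge _ nk) eqk.
Qed.

Lemma part_leq la (i j : 'I_n) : (i <= j)%N -> (la j <= la i)%N.
Proof.
by have /forallP/(_ i)/forallP/(_ j)/implyP := part_decreasing la.
Qed.

Lemma included_dominated mu la : included mu la -> dominated mu la.
Proof. by move=> /forallP ml; apply/dominatedP => k; apply: leq_sum. Qed.

(** Comparing every part with the threshold [la j] turns the sum over [j]
    arbitrary rows into the sum over the first [j] rows. *)
Lemma psum_perm_leq la (s : 'S_n) j :
  (\sum_(i < n | (i < j)%N) la (s i) <= psum la j)%N.
Proof.
pose c := if insub j is Some i then la (i : 'I_n) else 0%N.
have c_lo (i : 'I_n) : (i < j)%N -> (c <= la i)%N.
  by rewrite /c; case: insubP => // j' _ ej ij; rewrite part_leq // ej ltnW.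
have c_hi (i : 'I_n) : (j <= i)%N -> (la i <= c)%N.
  rewrite /c => ji; case: insubP => [j' _ ej|]; first by rewrite part_leq // ej.
  by rewrite (leq_ltn_trans ji).
apply: (@leq_trans (\sum_(i < n | (i < j)%N) (c + (la (s i) - c)))%N).
  by apply: leq_sum => i _; rewrite -leq_subLR.
have -> : psum la j = (\sum_(i < n | (i < j)%N) (c + (la i - c)))%N.
  by apply: eq_bigr => i /c_lo; lia.
rewrite !big_split leq_add2l /=.
have -> : (\sum_(i < n | (i < j)%N) (la i - c) = \sum_(i < n) (la i - c))%N.
  rewrite big_mkcond; apply: eq_bigr => i _; case: ltnP => // /c_hi; lia.
rewrite [X in (_ <= X)%N](reindex_inj (@perm_inj _ s)) /= [X in (_ <= X)%N](bigID (fun i : 'I_n => (i < j)%N)).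
exact: leq_addr.
Qed.

Implicit Type k : {ffun 'I_n -> int}.

Definition exponent_dominated k la :=
  forall j, (\sum_(i < n | (i < j)%N) `|k i| <= psum la j)%N.

Lemma bc_orbit_dominated k la : k \in bc_orbit (exponent la) -> exponent_dominated k la.
Proof.
case/mem_bc_orbit => -[s e] -> j; apply: leq_trans (psum_perm_leq la s j).
by apply: leq_sum => i _; rewrite !ffunE abszMsign.
Qed.

Lemma exponent_dominated_trans k mu la :
  exponent_dominated k mu -> dominated mu la -> exponent_dominated k la.
Proof. by move=> km /dominatedP ml j; apply: leq_trans (km j) (ml j). Qed.

Lemma mem_exponent_orbit la : exponent la \in bc_orbit (exponent la).
Proof.
apply/mem_bc_orbit; exists (1%g, [ffun=> false]); apply/ffunP => i.
by rewrite !ffunE perm1 mul1r.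
Qed.

Lemma exponent_orbit_dominated mu la :
  exponent la \in bc_orbit (exponent mu) -> dominated la mu.
Proof.
move=> /bc_orbit_dominated dom; apply/dominatedP => j; apply: leq_trans (dom j).
by apply: leq_sum => i _; rewrite ffunE absz_nat.
Qed.

(** ** Weights *)

Implicit Type a : nat -> nat.

Definition weight a k : int := \sum_(i < n) (a i)%:Z * k i.

Definition strictly_decreasing a m := forall i j, (i < j)%N -> (j < m)%N -> (a j < a i)%N.

(** Along a curve on which the coordinates grow with exponents [a], the monomial of
    [la] then outgrows all the others that [la] dominates. *)
Definition sharp a la := forall k, exponent_dominated k la ->
  weight a k <= weight a (exponent la) /\
  (weight a k = weight a (exponent la) -> k = exponent la).

End Dominance.

(** Abel summation: decreasing weights are combinations with nonnegative
    coefficients of the indicators of initial segments. *)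
Lemma abel_ge0 n (a : nat -> nat) (d : nat -> int) :
  (forall i j, (i <= j)%N -> (j < n)%N -> (a j <= a i)%N) ->
  (forall k, (k <= n)%N -> 0 <= \sum_(i < k) d i) ->
  0 <= \sum_(i < n) (a i)%:Z * d i.
Proof.
elim: n a => [|n IHn] a a_dec d_ge0; first by rewrite big_ord0.
have -> : \sum_(i < n.+1) (a i)%:Z * d i =
    \sum_(i < n) (a i - a n)%N%:Z * d i + (a n)%:Z * \sum_(i < n.+1) d i.
  rewrite !big_ord_recr /= mulrDr addrA; congr (_ + _).
  rewrite mulr_sumr -big_split; apply: eq_bigr => i _ /=.
  by rewrite -mulrDl -PoszD subnK // a_dec // ltnW.
apply: addr_ge0; last by apply: mulr_ge0; rewrite ?d_ge0.
apply: (IHn (fun i => a i - a n)%N) => [i j ij jn|k kn]; last by apply: d_ge0; rewrite leqW.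
by apply: leq_sub2r; rewrite a_dec // leqW.
Qed.

Lemma abel_eq0 n (a : nat -> nat) (d : nat -> int) :
  strictly_decreasing a n -> (forall i, (i < n)%N -> (0 < a i)%N) ->
  (forall k, (k <= n)%N -> 0 <= \sum_(i < k) d i) ->
  \sum_(i < n) (a i)%:Z * d i = 0 -> forall i, (i < n)%N -> d i = 0.
Proof.
elim: n a => [|n IHn] a a_dec a_gt0 d_ge0 //.
have -> : \sum_(i < n.+1) (a i)%:Z * d i =
    \sum_(i < n) (a i - a n)%N%:Z * d i + (a n)%:Z * \sum_(i < n.+1) d i.
  rewrite !big_ord_recr /= mulrDr addrA; congr (_ + _).
  rewrite mulr_sumr -big_split; apply: eq_bigr => i _ /=.
  by rewrite -mulrDl -PoszD subnK // ltnW // a_dec.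
have d_ge0' k : (k <= n)%N -> 0 <= \sum_(i < k) d i by move=> kn; rewrite d_ge0 // leqW.
have S_ge0 : 0 <= \sum_(i < n) (a i - a n)%N%:Z * d i.
  apply: (@abel_ge0 n (fun i => (a i - a n)%N)) => // i j ij jn.
  apply: leq_sub2r; move: ij; rewrite leq_eqVlt => /orP[/eqP -> //|ij].
  by rewrite ltnW // a_dec // leqW.
move=> /eqP; rewrite paddr_eq0 //; last by apply: mulr_ge0; rewrite ?d_ge0.
case/andP => /eqP /(IHn (fun i => a i - a n)%N) IH; rewrite mulf_eq0 => /orP[/eqP an0|/eqP dn0].
  by have := a_gt0 n (ltnSn n); rewrite -ltz_nat an0.
have {}IH i : (i < n)%N -> d i = 0.
  move=> i_n; apply: IH => // [j l jl ln|j jn].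
    by apply: ltn_sub2r; apply: a_dec; rewrite ?(ltn_trans jl ln) // leqW.
  by rewrite subn_gt0 a_dec.
move=> i; rewrite ltnS leq_eqVlt => /orP[/eqP ->|/IH //].
by move: dn0; rewrite big_ord_recr /= big1 ?add0r // => j _; apply: IH.
Qed.

Definition nat_extend T (z : T) n (f : 'I_n -> T) (i : nat) : T :=
  if insub i is Some j then f j else z.

Lemma nat_extendE T (z : T) n (f : 'I_n -> T) (i : 'I_n) : nat_extend z f i = f i.
Proof. by rewrite /nat_extend valK. Qed.

Lemma sum_nat_extend n (f : 'I_n -> int) k : (k <= n)%N ->
  \sum_(i < k) nat_extend 0 f i = \sum_(i < n | (i < k)%N) f i.
Proof.
move=> kn; rewrite (big_ord_widen n (nat_extend 0 f) kn).
by apply: eq_bigr => i _; rewrite nat_extendE.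
Qed.

Lemma Posz_sum I (r : seq I) (P : pred I) (F : I -> nat) :
  (\sum_(i <- r | P i) F i)%N%:Z = \sum_(i <- r | P i) (F i)%:Z.
Proof. exact: (big_morph Posz PoszD (erefl _)). Qed.

Lemma exponent_gap_ge0 n (k : {ffun 'I_n -> int}) (la : part n) j :
  exponent_dominated k la -> 0 <= \sum_(i < n | (i < j)%N) (exponent la i - k i).
Proof.
move=> /(_ j) dom; rewrite sumrB subr_ge0.
apply: (@le_trans _ _ (\sum_(i < n | (i < j)%N) `|k i|%N%:Z)).
  by apply: ler_sum => i _; rewrite abszE ler_norm.
rewrite -Posz_sum; have -> : \sum_(i < n | (i < j)%N) exponent la i = (psum la j)%:Z.
  by rewrite Posz_sum; apply: eq_bigr => i _; rewrite ffunE.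
by rewrite lez_nat.
Qed.

Lemma sum_nat_extend_gap n (a : nat -> nat) (k l : {ffun 'I_n -> int}) :
  weight a l - weight a k =
  \sum_(i < n) (a i)%:Z * nat_extend 0 (fun i => l i - k i) i.
Proof.
rewrite /weight -sumrB; apply: eq_bigr => i _.
by rewrite nat_extendE mulrBr.
Qed.

(** The last weight has to be positive because dominance compares partitions of
    different sizes. *)
Lemma positive_sharp n (a : nat -> nat) (la : part n) :
  strictly_decreasing a n -> (forall i, (i < n)%N -> (0 < a i)%N) -> sharp a la.
Proof.
move=> a_dec a_gt0 k dom.
pose d := nat_extend 0 (fun i => exponent la i - k i).
have d_ge0 j : (j <= n)%N -> 0 <= \sum_(i < j) d i.
  by move=> jn; rewrite sum_nat_extend //; apply: exponent_gap_ge0.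
split=> [|e].
  rewrite -subr_ge0 sum_nat_extend_gap; apply: abel_ge0 => // i j ij jn.
  by move: ij; rewrite leq_eqVlt => /orP[/eqP -> //|ij]; rewrite ltnW // a_dec.
apply/ffunP => i; have := abel_eq0 a_dec a_gt0 d_ge0.
rewrite -sum_nat_extend_gap e subrr => /(_ erefl i (ltn_ord i)).
by rewrite /d nat_extendE => /eqP; rewrite subr_eq0 => /eqP.
Qed.

(** ** Appending a zero part and adding a column of length n *)

Lemma widen_ord_max n (i : 'I_n) : widen_ord (leqnSn n) i = lift ord_max i.
Proof. by apply: ord_inj; rewrite lift_max. Qed.

Definition pad_fun n (la : 'I_n -> nat) : 'I_n.+1 -> nat :=
  fun i => if unlift ord_max i is Some j then la j else 0%N.

Lemma pad_decreasing n (la : part n) : decreasing [ffun i => pad_fun la i].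
Proof.
apply/forallP => i; apply/forallP => j; apply/implyP => ij; rewrite !ffunE /pad_fun.
case: unliftP => [j' ej|//]; case: unliftP => [i' ei|ei].
  by apply: part_leq; move: ij; rewrite ei ej !lift_max.
by move: ij; rewrite ei ej lift_max /= leqNgt ltn_ord.
Qed.

Definition pad n (la : part n) : part n.+1 := Part (pad_decreasing la).

Lemma pad_lift n (la : part n) i : pad la (lift ord_max i) = la i.
Proof. by rewrite ffunE /pad_fun liftK. Qed.

Lemma pad_max n (la : part n) : pad la ord_max = 0%N.
Proof. by rewrite ffunE /pad_fun unlift_none. Qed.

Lemma psum_pad n (la : part n) k : psum (pad la) k = psum la k.
Proof.
rewrite /psum big_mkcond big_ord_recr /= pad_max if_same addn0 [RHS]big_mkcond.
apply: eq_bigr => i _.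
by rewrite widen_ord_max pad_lift.
Qed.

Lemma pad_inj n : injective (@pad n).
Proof. by move=> la mu e; apply: eq_psum => k; rewrite -[LHS]psum_pad -[RHS]psum_pad e. Qed.

Lemma dominated_pad n (la mu : part n) : dominated (pad la) (pad mu) = dominated la mu.
Proof. by apply/dominatedP/dominatedP => dom k; have := dom k; rewrite !psum_pad. Qed.

Lemma strictly_dominated_pad n (la mu : part n) :
  strictly_dominated (pad la) (pad mu) = strictly_dominated la mu.
Proof. by rewrite /strictly_dominated dominated_pad (inj_eq (@pad_inj n)). Qed.

Lemma pad_of n (la : part n.+1) : la ord_max = 0%N -> exists mu : part n, la = pad mu.
Proof.
move=> la0; have dec : decreasing [ffun i : 'I_n => la (lift ord_max i)].
  apply/forallP => i; apply/forallP => j; apply/implyP => ij; rewrite !ffunE.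
  by apply: part_leq; rewrite !lift_max.
exists (Part dec); apply: val_inj; apply/ffunP => i; case: (unliftP ord_max i) => [j|] ->.
  by rewrite -[RHS]/(pad (Part dec) _) pad_lift ffunE.
by rewrite -[RHS]/(pad (Part dec) _) pad_max.
Qed.

Lemma add_column_decreasing n (la : part n) : decreasing [ffun i => (la i).+1].
Proof.
apply/forallP => i; apply/forallP => j; apply/implyP => ij; rewrite !ffunE ltnS.
exact: part_leq.
Qed.

Definition add_column n (la : part n) : part n := Part (add_column_decreasing la).

Lemma add_columnE n (la : part n) i : add_column la i = (la i).+1.
Proof. by rewrite ffunE. Qed.

Lemma add_column_inj n : injective (@add_column n).
Proof.
move=> la mu e; apply: val_inj; apply/ffunP => i.
by have := add_columnE la i; rewrite e add_columnE => -[].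
Qed.

Lemma psum_add_column n (la : part n) k :
  psum (add_column la) k = (psum la k + \sum_(i < n | (i < k)%N) 1)%N.
Proof.
by rewrite -big_split; apply: eq_bigr => i _; rewrite add_columnE /= addn1.
Qed.

Lemma dominated_add_column n (la mu : part n) :
  dominated (add_column la) (add_column mu) = dominated la mu.
Proof.
by apply/dominatedP/dominatedP => dom k; have := dom k; rewrite !psum_add_column leq_add2r.
Qed.

Lemma strictly_dominated_add_column n (la mu : part n) :
  strictly_dominated (add_column la) (add_column mu) = strictly_dominated la mu.
Proof. by rewrite /strictly_dominated dominated_add_column (inj_eq (@add_column_inj n)). Qed.

Lemma add_column_of n (la : part n) :
  (forall i, (0 < la i)%N) -> exists mu : part n, la = add_column mu.
Proof.
move=> la_gt0; have dec : decreasing [ffun i : 'I_n => (la i).-1].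
  apply/forallP => i; apply/forallP => j; apply/implyP => ij; rewrite !ffunE.
  by rewrite -ltnS !prednK ?part_leq.
exists (Part dec); apply: val_inj; apply/ffunP => i.
by rewrite -[RHS]/(add_column (Part dec) _) add_columnE ffunE prednK.
Qed.

Lemma part_peel n (la : part n.+1) :
  (exists mu : part n, la = pad mu) \/ (exists mu : part n.+1, la = add_column mu).
Proof.
case: (posnP (la ord_max)) => [/pad_of|la_gt0]; first by left.
right; apply: add_column_of => i; apply: leq_trans la_gt0 (part_leq _ _).
exact: leq_ord.
Qed.

Lemma part0_eq (la mu : part 0) : la = mu.
Proof. by apply: val_inj; apply/ffunP => -[]. Qed.

(** The induction along which diagonal values and norms are computed: removing a
    zero part or a full column changes them by simple factors. *)
Lemma part_peel_ind (P : forall n, part n -> Prop) :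
  (forall la : part 0, P 0%N la) ->
  (forall n (la : part n), P n la -> P n.+1 (pad la)) ->
  (forall n (la : part n.+1), P n.+1 la -> P n.+1 (add_column la)) ->
  forall n (la : part n), P n la.
Proof.
move=> P0 Ppad Pcol; elim=> [|n IHn] la //.
move: {2}(la ord_max) (erefl (la ord_max)) => m.
elim: m la => [|m IHm] la e.
  by have [mu ->] := pad_of e; apply/Ppad/IHn.
case: (part_peel la) e => [[mu ->]|[mu ->]]; first by rewrite pad_max.
by rewrite add_columnE => -[/IHm]; apply: Pcol.
Qed.

(** The last weight may be zero if the last part is: a dominated exponent that agrees
    with [la] in the first [n] entries leaves nothing for the last one. *)
Lemma pad_sharp n (a : nat -> nat) (la : part n) :
  strictly_decreasing a n -> (forall i, (i < n)%N -> (0 < a i)%N) -> a n = 0%N ->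
  sharp a (pad la).
Proof.
move=> a_dec a_gt0 an0 k dom.
pose d := nat_extend 0 (fun i => exponent (pad la) i - k i).
have d_ge0 j : (j <= n)%N -> 0 <= \sum_(i < j) d i.
  by move=> jn; rewrite sum_nat_extend 1?leqW //; apply: exponent_gap_ge0.
have gapE : weight a (exponent (pad la)) - weight a k = \sum_(i < n) (a i)%:Z * d i.
  by rewrite sum_nat_extend_gap big_ord_recr /= an0 mul0r addr0.
split=> [|e].
  rewrite -subr_ge0 gapE; apply: abel_ge0 => [i j ij jn|//].
  by move: ij; rewrite leq_eqVlt => /orP[/eqP -> //|ij]; rewrite ltnW // a_dec.
have eq_lift i : k (lift ord_max i) = (la i)%:Z.
  have := abel_eq0 a_dec a_gt0 d_ge0.
  rewrite -gapE e subrr => /(_ erefl i (ltn_ord i)).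
  have -> : d i = d (lift ord_max i) by rewrite lift_max.
  by rewrite /d nat_extendE ffunE pad_lift => /eqP; rewrite subr_eq0 => /eqP.
apply/ffunP => i; case: (unliftP ord_max i) => [j|] ->.
  by rewrite eq_lift ffunE pad_lift.
rewrite ffunE pad_max; apply/eqP; rewrite -absz_eq0 -leqn0.
have := dom n.+1; rewrite psum_pad psum_ge // big_mkcond big_ord_recr /= ltnSn.
have -> : (\sum_(i < n) (if (i < n.+1)%N then `|k (widen_ord (leqnSn n) i)| else 0) = psum la n)%N.
  rewrite /psum [RHS]big_mkcond; apply: eq_bigr => j _.
  by rewrite widen_ord_max eq_lift absz_nat ltn_ord (ltn_trans (ltn_ord j)).
by rewrite -[X in (_ <= X)%N]addn0 leq_add2l.
Qed.

(** * Formal limits and leading orbit sums *)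

Section Limits.
Variable K : fieldType.

(** Outside of the zeros of a nonzero polynomial, hence for all but finitely many [v]. *)
Definition eventually (S : K -> Prop) :=
  exists R : {poly K}, R != 0 /\ forall v, R.[v] != 0 -> S v.

(** The value at 0 of a function that is eventually rational and regular at 0. *)
Definition tends (g : K -> K) (c : K) := exists P Q : {poly K},
  [/\ Q.[0] != 0, P.[0] = c * Q.[0] & eventually (fun v => g v * Q.[v] = P.[v])].

Lemma eventually_and (S T : K -> Prop) :
  eventually S -> eventually T -> eventually (fun v => S v /\ T v).
Proof.
move=> [R [R0 RS]] [R' [R'0 RT]]; exists (R * R'); split=> [|v].
  by rewrite mulf_neq0.
by rewrite hornerM mulf_eq0 negb_or => /andP[/RS Sv /RT].
Qed.

Lemma eventually_mono (S T : K -> Prop) :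
  (forall v, S v -> T v) -> eventually S -> eventually T.
Proof. by move=> ST [R [R0 RS]]; exists R; split=> // v /RS /ST. Qed.

Lemma eventually_horner (P : {poly K}) : P != 0 -> eventually (fun v => P.[v] != 0).
Proof. by move=> P0; exists P. Qed.

Lemma eventually_neq0 : eventually (fun v => v != 0).
Proof.
by apply: eventually_mono (eventually_horner (negbT (polyX_eq0 K))) => v; rewrite hornerX.
Qed.

Lemma eventually_all (I : finType) (S : I -> K -> Prop) :
  (forall i, eventually (S i)) -> eventually (fun v => forall i, S i v).
Proof.
move=> evS; have [R RS] := fin_all_exists evS.
exists (\prod_i R i); split=> [|v Rv i].
  by apply/prodf_neq0 => i _; case: (RS i).
case: (RS i) => _; apply; move: Rv; rewrite horner_prod (bigD1 i) //= mulf_eq0.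
by case/norP.
Qed.

Lemma tends_ext g h c : eventually (fun v => g v = h v) -> tends g c -> tends h c.
Proof.
move=> gh [P [Q [Q0 P0 gP]]]; exists P, Q; split=> //.
by apply: eventually_mono (eventually_and gh gP) => v [<-].
Qed.

Lemma tends_poly (P : {poly K}) : tends (fun v => P.[v]) P.[0].
Proof.
exists P, 1; rewrite hornerC mulr1 oner_eq0; split=> //.
by exists 1; rewrite oner_eq0; split=> // v _; rewrite hornerC mulr1.
Qed.

Lemma tends_const c : tends (fun=> c) c.
Proof.
have := tends_poly c%:P; rewrite hornerC; apply: tends_ext.
by apply: eventually_mono eventually_neq0 => v _; rewrite hornerC.
Qed.

Lemma tends_add g h c d : tends g c -> tends h d -> tends (fun v => g v + h v) (c + d).
Proof.
move=> [P [Q [Q0 P0 gP]]] [P' [Q' [Q'0 P'0 hP']]].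
exists (P * Q' + P' * Q), (Q * Q'); rewrite ?hornerD !hornerM; split; first by rewrite mulf_neq0.
  by rewrite P0 P'0; ring.
apply: eventually_mono (eventually_and gP hP') => v [eg eh].
by rewrite ?hornerD !hornerM -eg -eh; ring.
Qed.

Lemma tends_mul g h c d : tends g c -> tends h d -> tends (fun v => g v * h v) (c * d).
Proof.
move=> [P [Q [Q0 P0 gP]]] [P' [Q' [Q'0 P'0 hP']]].
exists (P * P'), (Q * Q'); rewrite ?hornerD !hornerM; split; first by rewrite mulf_neq0.
  by rewrite P0 P'0; ring.
apply: eventually_mono (eventually_and gP hP') => v [eg eh].
by rewrite ?hornerD !hornerM -eg -eh; ring.
Qed.

Lemma tends_inv g c : c != 0 -> tends g c -> tends (fun v => (g v)^-1) c^-1.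
Proof.
move=> c0 [P [Q [Q0 P0 gP]]]; have P00 : P.[0] != 0 by rewrite P0 mulf_neq0.
exists Q, P; split=> //; first by rewrite P0 mulKf.
have Pn0 : P != 0 by apply: contraNneq P00 => ->; rewrite horner0.
apply: eventually_mono (eventually_and (eventually_horner Pn0) gP) => v [Pv e].
have gv : g v != 0 by apply: contraNneq Pv => g0; rewrite -e g0 mul0r.
by rewrite -e mulKf.
Qed.

Lemma tends_sum I (r : seq I) (Q : pred I) (g : I -> K -> K) (c : I -> K) :
  (forall i, Q i -> tends (g i) (c i)) ->
  tends (fun v => \sum_(i <- r | Q i) g i v) (\sum_(i <- r | Q i) c i).
Proof.
move=> gc; elim: r => [|i r IHr].
  rewrite big_nil; apply: tends_ext (tends_const 0).
  by apply: eventually_mono eventually_neq0 => v _; rewrite big_nil.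
rewrite big_cons; case Qi: (Q i); last first.
  by apply: tends_ext IHr; apply: eventually_mono eventually_neq0 => v _; rewrite big_cons Qi.
apply: tends_ext (tends_add (gc i Qi) IHr).
by apply: eventually_mono eventually_neq0 => v _; rewrite big_cons Qi.
Qed.

Lemma tends_prod I (r : seq I) (Q : pred I) (g : I -> K -> K) (c : I -> K) :
  (forall i, Q i -> tends (g i) (c i)) ->
  tends (fun v => \prod_(i <- r | Q i) g i v) (\prod_(i <- r | Q i) c i).
Proof.
move=> gc; elim: r => [|i r IHr].
  rewrite big_nil; apply: tends_ext (tends_const 1).
  by apply: eventually_mono eventually_neq0 => v _; rewrite big_nil.
rewrite big_cons; case Qi: (Q i); last first.
  by apply: tends_ext IHr; apply: eventually_mono eventually_neq0 => v _; rewrite big_cons Qi.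
apply: tends_ext (tends_mul (gc i Qi) IHr).
by apply: eventually_mono eventually_neq0 => v _; rewrite big_cons Qi.
Qed.

Lemma tends_exp e : (0 < e)%N -> tends (fun v => v ^+ e) 0.
Proof.
move=> e_gt0; have := tends_poly 'X^e; rewrite hornerXn expr0n eqn0Ngt e_gt0.
by apply: tends_ext; apply: eventually_mono eventually_neq0 => v _; rewrite hornerXn.
Qed.

Hypothesis char0 : [pchar K] =i pred0.

Lemma natr_inj : injective (fun m : nat => m%:R : K).
Proof.
suff le m m' : (m <= m')%N -> m%:R = m'%:R :> K -> m = m'.
  by move=> m m' e; case/orP: (leq_total m m') => /le; [apply | move=> h; rewrite h].
move=> mm' /esym/eqP; rewrite -subr_eq0 -natrB // ((pcharf0P K).1 char0) subn_eq0 => m'm.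
by apply/eqP; rewrite eqn_leq mm'.
Qed.

Lemma poly_eq0 (P : {poly K}) : (forall v, P.[v] = 0) -> P = 0.
Proof.
move=> P0; apply: (@roots_geq_poly_eq0 _ P [seq i%:R | i <- iota 0 (size P)]).
- by apply/allP => v _; apply/rootP.
- by rewrite map_inj_uniq ?iota_uniq //; exact: natr_inj.
- by rewrite size_map size_iota.
Qed.

(** In characteristic zero the field is infinite, so that a rational function is
    determined by its values. *)
Lemma tends_unique g c d : tends g c -> tends g d -> c = d.
Proof.
move=> [P [Q [Q0 P0 gP]]] [P' [Q' [Q'0 P'0 gP']]].
have [R [R0 RE]] := eventually_and gP gP'.
have e : (P * Q' - P' * Q) * R = 0.
  apply: poly_eq0 => v; rewrite !hornerE; have [->|Rv] := eqVneq R.[v] 0; first exact: mulr0.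
  by have [<- <-] := RE v Rv; ring.
have {}e : P * Q' = P' * Q.
  by apply/eqP; move/eqP: e; rewrite mulf_eq0 (negPf R0) orbF subr_eq0.
have := congr1 (horner^~ 0) e; rewrite /= !hornerM P0 P'0 mulrAC.
by move/(mulIf Q0)/(mulIf Q'0).
Qed.

End Limits.

(** ** Behaviour at infinity along monomial curves *)

Lemma digits_inj n B (f g : nat -> nat) :
  (forall i, (i < n)%N -> (f i < B)%N) -> (forall i, (i < n)%N -> (g i < B)%N) ->
  (\sum_(i < n) B ^ (n - i.+1) * f i = \sum_(i < n) B ^ (n - i.+1) * g i)%N ->
  forall i, (i < n)%N -> f i = g i.
Proof.
elim: n => [|n IHn] fB gB //.
have rec (h : nat -> nat) : (\sum_(i < n.+1) B ^ (n.+1 - i.+1) * h i =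
    B * (\sum_(i < n) B ^ (n - i.+1) * h i) + h n)%N.
  rewrite big_ord_recr /= subnn expn0 mul1n big_distrr /=; congr (_ + _)%N.
  apply: eq_bigr => i _; rewrite mulnA -expnS; congr (_ ^ _ * _)%N.
  by have := ltn_ord i; lia.
rewrite !rec => e.
have en : f n = g n.
  have := congr1 (modn^~ B) e.
  by rewrite /= !(mulnC B) !modnMDl !modn_small ?fB ?gB.
move: e; rewrite en => /addIn /eqP.
have B_gt0 : (0 < B)%N by apply: leq_ltn_trans (fB n _).
rewrite eqn_pmul2l // => /eqP e i; rewrite ltnS leq_eqVlt => /orP[/eqP -> //|].
by apply: IHn e _ => j jn; rewrite ?fB ?gB // leqW.
Qed.

Section Leading.
Variable K : fieldType.
Hypothesis char0 : [pchar K] =i pred0.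
Implicit Type a : nat -> nat.

(** As [v] goes to 0 the coordinates go to infinity, the faster the larger their
    weights. *)
Definition curve n (al : 'I_n -> K) a (v : K) : 'I_n -> K := fun i => al i * v ^- a i.

Definition top_weight n a (la : part n) : nat := (\sum_(i < n) a i * la i)%N.

Lemma weight_exponent n a (la : part n) : weight a (exponent la) = (top_weight a la)%:Z.
Proof. by rewrite /weight Posz_sum; apply: eq_bigr => i _; rewrite ffunE PoszM. Qed.

Lemma nonzero_curve n (al : 'I_n -> K) a v : nonzero al -> v != 0 -> nonzero (curve al a v).
Proof. by move=> nzal v0 i; rewrite mulf_neq0 // invr_eq0 expf_neq0. Qed.

Lemma mono_curve n (al : 'I_n -> K) a v k : v != 0 ->
  mono (curve al a v) k = mono al k * v ^ (- weight a k).
Proof.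
move=> v0; rewrite /mono /weight -sumrN.
rewrite (big_morph (fun z => v ^ z) (fun x y => expfzDr x y v0) (expr0z v)) -big_split.
apply: eq_bigr => i _ /=.
by rewrite expfzMl exprnN exprz_exp mulNr.
Qed.

Lemma tends_mono n (al : 'I_n -> K) a la k : sharp a la -> exponent_dominated k la ->
  tends (fun v => v ^+ top_weight a la * mono (curve al a v) k)
    (if k == exponent la then mono al k else 0).
Proof.
move=> sh dom; have [le eq_la] := sh k dom.
have [m em] : exists m : nat, (top_weight a la)%:Z - weight a k = m%:Z.
  move: le; rewrite weight_exponent -subr_ge0; case: (_ - _) => // m _.
  by exists m.
apply: (@tends_ext _ (fun v => mono al k * v ^+ m)).
  apply: eventually_mono (@eventually_neq0 K) => v v0.
  rewrite mono_curve // mulrCA; congr (_ * _).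
  by rewrite -[v ^+ m]/(v ^ m%:Z) -em expfzDr.
case: eqP => [ek|nk].
  move: em; rewrite ek weight_exponent subrr => -[<-].
  apply: tends_ext (tends_const _).
  by apply: eventually_mono (@eventually_neq0 K) => v _; rewrite mulr1.
rewrite -[X in tends _ X](mulr0 (mono al k)); apply: tends_mul; first exact: tends_const.
apply: tends_exp; rewrite lt0n; apply: contra_not_neq nk => m0; apply: eq_la.
by apply/esym/eqP; rewrite weight_exponent -subr_eq0 em m0.
Qed.

Lemma tends_orbit_sum n (al : 'I_n -> K) a (mu la : part n) : sharp a la -> dominated mu la ->
  tends (fun v => v ^+ top_weight a la * orbit_sum mu (curve al a v))
    (if mu == la then mono al (exponent la) else 0).
Proof.
move=> sh dom.
have -> : (if mu == la then mono al (exponent la) else 0) =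
    \sum_(k <- bc_orbit (exponent mu)) if k == exponent la then mono al k else 0.
  case: eqP => [->|neq].
    rewrite (bigD1_seq (exponent la)) ?bc_orbit_uniq ?mem_exponent_orbit //= eqxx.
    by rewrite big1 ?addr0 // => k /negPf ->.
  rewrite big_seq big1 // => k ko; case: eqP => // e; case: neq.
  by apply: dominated_anti => //; apply: exponent_orbit_dominated; rewrite -e.
rewrite big_seq.
apply: (@tends_ext _ (fun v => \sum_(k <- bc_orbit (exponent mu) | k \in bc_orbit (exponent mu))
    v ^+ top_weight a la * mono (curve al a v) k)).
  by apply: eventually_mono (@eventually_neq0 K) => v _; rewrite -big_seq mulr_sumr.
apply: tends_sum => k /bc_orbit_dominated ko; apply: tends_mono => //.
exact: exponent_dominated_trans dom.
Qed.

Definition below n (la : part n) : pred (part n) := fun mu => strictly_dominated mu la.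

Definition lead n (la : part n) (c : K) (F : ('I_n -> K) -> K) :=
  exists G, in_span (below la) G /\ forall x, nonzero x -> F x = c * orbit_sum la x + G x.

Lemma lead_span n (la : part n) c F : lead la c F -> in_span (fun mu => dominated mu la) F.
Proof.
move=> [G [SG FG]]; apply: (@span_ext _ _ _ (fun x => c * orbit_sum la x + G x)).
  by move=> x nzx; rewrite FG.
apply: span_add; first by apply/span_scale/span_orbit_sum/dominated_refl.
by apply: sub_span SG => mu /strictly_dominatedW.
Qed.

Lemma lead_laurent n (la : part n) c F : lead la c F -> laurent_fun F.
Proof. by move/lead_span/span_laurent. Qed.

Lemma lead_symmetric n (la : part n) c F : lead la c F -> symmetric_fun F.
Proof. by move/lead_span/span_symmetric. Qed.

Lemma lead_orbit_sum n (la : part n) : lead la 1 (orbit_sum la).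
Proof.
by exists (fun=> 0); split=> [|x _]; [apply: span0 | rewrite mul1r addr0].
Qed.

Lemma lead_tends n (la : part n) c F (al : 'I_n -> K) a :
  lead la c F -> sharp a la -> nonzero al ->
  tends (fun v => v ^+ top_weight a la * F (curve al a v)) (c * mono al (exponent la)).
Proof.
move=> [G [[r [below_r GE]] FE]] sh nzal.
apply: (@tends_ext _ (fun v => c * (v ^+ top_weight a la * orbit_sum la (curve al a v)) +
   \sum_(u <- r | u \in r) u.1 * (v ^+ top_weight a la * orbit_sum u.2 (curve al a v)))).
  apply: eventually_mono (@eventually_neq0 K) => v v0.
  have nzc := nonzero_curve a nzal v0.
  rewrite FE // GE // mulrDr -big_seq [X in _ = X + _]mulrCA mulr_sumr; congr (_ + _).
  by apply: eq_bigr => u _; rewrite mulrCA.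
rewrite -[X in tends _ X]addr0; apply: tends_add.
  apply: tends_mul; first exact: tends_const.
  by have := tends_orbit_sum al sh (dominated_refl la); rewrite eqxx.
have e0 : 0 = \sum_(u <- r | u \in r) u.1 * 0 :> K by rewrite big1 // => u _; rewrite mulr0.
rewrite {2}e0; apply: tends_sum => u ur; apply: tends_mul; first exact: tends_const.
have /andP[dom /negPf neq] : strictly_dominated u.2 la by apply: (allP below_r).
by have := tends_orbit_sum al sh dom; rewrite neq.
Qed.

Lemma sum_by_part n (r : seq (K * part n)) (M : seq (part n)) (x : 'I_n -> K) :
  uniq M -> all (fun u => u.2 \in M) r ->
  \sum_(u <- r) u.1 * orbit_sum u.2 x =
  \sum_(mu <- M) (\sum_(u <- r | u.2 == mu) u.1) * orbit_sum mu x.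
Proof.
move=> uniqM /allP rM.
transitivity (\sum_(u <- r) \sum_(mu <- M | mu == u.2) u.1 * orbit_sum mu x).
  rewrite big_seq [RHS]big_seq; apply: eq_bigr => u ur.
  by rewrite -big_filter filter_pred1_uniq ?rM // big_seq1.
rewrite (exchange_big_dep predT) //=; apply: eq_bigr => mu _.
by rewrite mulr_suml; apply: eq_bigl => u; rewrite eq_sym.
Qed.

Lemma span_normal_form n (P : pred (part n)) F : in_span P F -> exists (M : seq (part n)) C,
  [/\ uniq M, all P M & forall x, nonzero x -> F x = \sum_(mu <- M) C mu * @orbit_sum K n mu x].
Proof.
move=> [r [Pr FE]]; pose M := undup [seq u.2 | u <- r].
exists M, (fun mu => \sum_(u <- r | u.2 == mu) u.1); split; first exact: undup_uniq.
  by apply/allP => mu; rewrite mem_undup => /mapP[u ur ->]; apply: (allP Pr).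
move=> x nzx; rewrite FE //; apply: sum_by_part; first exact: undup_uniq.
by apply/allP => u ur; rewrite mem_undup map_f.
Qed.

(** The powers of [B] give different weights to different partitions, whose parts
    are read as digits, and a large [N] makes the partial sum of length [k]
    decisive. *)
Definition digit_weight n B N k : nat -> nat :=
  fun i => ((if (i < k)%N then N else 0) + B ^ (n - i.+1))%N.

Lemma digit_weight_decreasing n B N k :
  (1 < B)%N -> strictly_decreasing (digit_weight n B N k) n.
Proof.
move=> B_gt1 i j ij jn; rewrite /digit_weight.
have lt : (B ^ (n - j.+1) < B ^ (n - i.+1))%N by rewrite ltn_exp2l //; lia.
by case: (ltnP j k) => jk; case: (ltnP i k) => ik; lia.
Qed.

Lemma top_digit_weight n B N k (la : part n) :
  top_weight (digit_weight n B N k) la =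
  (N * psum la k + \sum_(i < n) B ^ (n - i.+1) * la i)%N.
Proof.
rewrite /top_weight /digit_weight.
under eq_bigr => i _ do rewrite mulnDl.
rewrite big_split /= /psum big_distrr /= [in RHS]big_mkcond; congr (_ + _)%N.
by apply: eq_bigr => i _; case: ifP.
Qed.

Lemma digit_weight_inj n B N k (la mu : part n) :
  (forall i, (la i < B)%N) -> (forall i, (mu i < B)%N) ->
  (\sum_(i < n) B ^ (n - i.+1) * la i < N)%N ->
  (\sum_(i < n) B ^ (n - i.+1) * mu i < N)%N ->
  top_weight (digit_weight n B N k) la = top_weight (digit_weight n B N k) mu -> la = mu.
Proof.
move=> laB muB laN muN; rewrite !top_digit_weight => e.
have {}e : (\sum_(i < n) B ^ (n - i.+1) * la i = \sum_(i < n) B ^ (n - i.+1) * mu i)%N.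
  by have := congr1 (modn^~ N) e; rewrite /= !(mulnC N) !modnMDl !modn_small.
apply: val_inj; apply/ffunP => i.
have ext (nu : part n) : (\sum_(i < n) B ^ (n - i.+1) * nu i =
    \sum_(i < n) B ^ (n - i.+1) * nat_extend 0 nu i)%N.
  by apply: eq_bigr => j _; rewrite nat_extendE.
have extB (nu : part n) : (forall i, (nu i < B)%N) ->
    forall j, (j < n)%N -> (nat_extend 0%N nu j < B)%N.
  by move=> nuB j jn; rewrite -[j]/(nat_of_ord (Ordinal jn)) nat_extendE.
have := digits_inj (extB _ laB) (extB _ muB).
by rewrite -!ext e => /(_ erefl i (ltn_ord i)); rewrite !nat_extendE.
Qed.

Lemma arg_max_seq (T : eqType) (f : T -> nat) (s : seq T) x : x \in s ->
  exists2 y, y \in s & forall z, z \in s -> (f z <= f y)%N.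
Proof.
elim: s x => // a s IHs x _; case: s IHs => [|b s] IHs.
  by exists a; rewrite ?mem_head // => z; rewrite inE => /eqP ->.
have [y ys ymax] := IHs b (mem_head _ _).
case: (leqP (f a) (f y)) => [ay|/ltnW ya].
  by exists y; rewrite 1?inE ?ys ?orbT // => z; rewrite inE => /orP[/eqP -> //|/ymax].
exists a; rewrite ?mem_head // => z; rewrite inE => /orP[/eqP -> //|/ymax zy].
exact: leq_trans zy ya.
Qed.

(** Boundedness along all monomial curves detects the dominance order: a
    partition of the expansion violating dominance at the partial sum [k] would
    make the function grow too fast for a suitable weight vector. *)
Lemma lead_criterion n (la : part n) c F : in_span predT F ->
  (forall a, strictly_decreasing a n -> (forall i, (i < n)%N -> (0 < a i)%N) ->
    tends (fun v => v ^+ top_weight a la * F (curve (fun=> 1) a v)) c) ->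
  lead la c F.
Proof.
move=> /span_normal_form[M [C [uniqM _ FE]]] limF.
have nz1 : nonzero (fun _ : 'I_n => 1 : K) by move=> i; exact: oner_neq0.
have mono1 k : mono (fun _ : 'I_n => 1 : K) k = 1.
  by rewrite /mono big1 // => i _; rewrite exp1rz.
have below_la mu : mu \in M -> C mu != 0 -> dominated mu la.
  move=> muM Cmu; apply/dominatedP => k; rewrite leqNgt; apply/negP => lt_k.
  (* [B] bounds the parts and [N] the digit sums of all partitions that occur. *)
  pose B := (2 + \sum_(nu <- la :: M) \sum_(i < n) nu i)%N.
  pose N := (1 + \sum_(nu <- la :: M) \sum_(i < n) B ^ (n - i.+1) * nu i)%N.
  pose a := digit_weight n B N k.
  have a_dec : strictly_decreasing a n by apply: digit_weight_decreasing.
  have a_gt0 i : (i < n)%N -> (0 < a i)%N by move=> _; rewrite addn_gt0 expn_gt0 orbT.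
  have leB nu : nu \in la :: M -> forall i, (nu i < B)%N.
    move=> nuM i; rewrite /B add2n ltnS leqW // (big_rem nu) //= (bigD1 i) //=.
    by rewrite -!addnA leq_addr.
  have leN nu : nu \in la :: M -> (\sum_(i < n) B ^ (n - i.+1) * nu i < N)%N.
    by move=> nuM; rewrite /N add1n ltnS (big_rem nu) //= leq_addr.
  have [y] : exists2 y, y \in [seq nu <- M | C nu != 0] &
      forall z, z \in [seq nu <- M | C nu != 0] -> (top_weight a z <= top_weight a y)%N.
    by apply: (@arg_max_seq _ _ _ mu); rewrite mem_filter Cmu.
  rewrite mem_filter => /andP[Cy yM] ymax.
  have lt_y : (top_weight a la < top_weight a y)%N.
    apply: leq_trans (ymax mu _); last by rewrite mem_filter Cmu.
    rewrite !top_digit_weight.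
    have : (N * (psum la k).+1 <= N * psum mu k)%N by rewrite leq_mul2l lt_k orbT.
    by have := leN la (mem_head _ _); rewrite mulnS; lia.
  (* The partition [y] of maximal weight decides the growth of [F]: its coefficient
     is a limit that the hypothesis on [F] forces to be zero. *)
  have lim0 : tends (fun v => v ^+ top_weight a y * F (curve (fun=> 1) a v)) 0.
    have := tends_mul (@tends_exp K (top_weight a y - top_weight a la) _) (limF a a_dec a_gt0).
    rewrite subn_gt0 lt_y mul0r => /(_ isT); apply: tends_ext.
    apply: eventually_mono (@eventually_neq0 K) => v _.
    by rewrite mulrA -exprD subnK // ltnW.
  have lim1 : tends (fun v => v ^+ top_weight a y * F (curve (fun=> 1) a v)) (C y).
    apply: (@tends_ext _ (fun v => \sum_(nu <- M | nu \in M)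
        C nu * (v ^+ top_weight a y * orbit_sum nu (curve (fun=> 1) a v)))).
      apply: eventually_mono (@eventually_neq0 K) => v v0.
      rewrite FE; last exact: nonzero_curve.
      by rewrite -big_seq mulr_sumr; apply: eq_bigr => nu _; rewrite mulrCA.
    have -> : C y = \sum_(nu <- M | nu \in M) C nu * (if nu == y then 1 else 0).
      rewrite -big_seq (bigD1_seq y) //= eqxx mulr1 big1 ?addr0 // => nu /negPf ->.
      by rewrite mulr0.
    apply: tends_sum => nu nuM.
    have sharp_a pi := @positive_sharp n a pi a_dec a_gt0.
    case: eqVneq => [->|neq].
      apply: tends_mul; first exact: tends_const.
      by have := tends_orbit_sum (fun=> 1) (sharp_a y) (dominated_refl y); rewrite eqxx mono1.
    have [->|Cnu] := eqVneq (C nu) 0.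
      rewrite mul0r; apply: tends_ext (tends_const 0).
      by apply: eventually_mono (@eventually_neq0 K) => v _; rewrite mul0r.
    apply: tends_mul; first exact: tends_const.
    have lt : (top_weight a nu < top_weight a y)%N.
      rewrite ltn_neqAle ymax ?mem_filter ?Cnu // andbT; apply: contra neq => /eqP e.
      by apply/eqP; apply: digit_weight_inj e; (apply: leB || apply: leN); rewrite inE ?nuM ?yM orbT.
    have lim_nu := tends_orbit_sum (fun=> 1) (sharp_a nu) (dominated_refl nu).
    have := tends_mul (@tends_exp K (top_weight a y - top_weight a nu) _) lim_nu.
    rewrite subn_gt0 lt mul0r => /(_ isT); apply: tends_ext.
    apply: eventually_mono (@eventually_neq0 K) => v _.
    by rewrite mulrA -exprD subnK // ltnW.
  by case/eqP: Cy; apply: (tends_unique char0) lim1 lim0.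
pose d := if la \in M then C la else 0.
have lead_d : lead la d F.
  exists (fun x => \sum_(mu <- [seq nu <- M | (C nu != 0) && (nu != la)]) C mu * orbit_sum mu x).
  split.
    exists [seq (C mu, mu) | mu <- [seq nu <- M | (C nu != 0) && (nu != la)]]; split.
      apply/allP => u /mapP[mu]; rewrite mem_filter => /andP[/andP[Cmu neq] muM] -> /=.
      by rewrite /below /strictly_dominated neq below_la.
    by move=> x _; rewrite big_map.
  move=> x nzx; rewrite FE // big_filter.
  have dE : d * orbit_sum la x = \sum_(mu <- M | mu == la) C mu * orbit_sum mu x.
    rewrite /d -big_filter; case: ifP => laM.
      by rewrite filter_pred1_uniq // big_seq1.
    rewrite mul0r big_filter big_seq_cond big1 // => mu /andP[muM /eqP e].
    by rewrite -e muM in laM.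
  rewrite dE (bigID (fun mu => mu == la)) /=; congr (_ + _).
  rewrite (bigID (fun mu => C mu != 0)) /= [X in _ + X]big1 ?addr0.
    by apply: eq_bigl => mu; rewrite andbC.
  by move=> mu /andP[_ /negPn/eqP ->]; rewrite mul0r.
have a_dec : strictly_decreasing (fun i => n - i)%N n by move=> i j ij jn; lia.
have a_gt0 i : (i < n)%N -> (0 < n - i)%N by rewrite subn_gt0.
have := lead_tends lead_d (positive_sharp (la := la) a_dec a_gt0) nz1.
rewrite mono1 mulr1 => /(tends_unique char0) /(_ (limF _ a_dec a_gt0)) <-.
exact: lead_d.
Qed.

End Leading.


(** * Interpolation at the nodes *)

Section Nodes.
Variable K : fieldType.
Implicit Types q t s : K.

(** Multiplicative independence; it stands for genericity of the parameters. *)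
Definition independent (q t s : K) := [/\ q != 0, t != 0, s != 0 &
  forall a b c : int, q ^ a * t ^ b * s ^ c = 1 -> [/\ a = 0, b = 0 & c = 0]].

Lemma independent_shift q t s (a b : int) :
  independent q t s -> independent q t (q ^ a * t ^ b * s).
Proof.
move=> [q0 t0 s0 ind]; split=> //; first by rewrite !mulf_neq0 // expfz_neq0.
move=> x y z; rewrite !expfzMl !exprz_exp.
have -> : q ^ x * t ^ y * (q ^ (a * z) * t ^ (b * z) * s ^ z) =
    q ^ (x + a * z) * t ^ (y + b * z) * s ^ z by rewrite !expfzDr //; ring.
by case/ind => ex ey ez; move: ex ey; rewrite ez !mulr0 !addr0.
Qed.

Lemma independent_mulq q t s : independent q t s -> independent q t (q * s).
Proof. by move/(independent_shift 1 0); rewrite expr1z expr0z mulr1. Qed.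

Lemma independent_mult q t s : independent q t s -> independent q t (t * s).
Proof. by move/(independent_shift 0 1); rewrite expr1z expr0z mul1r. Qed.

Lemma independent_inv q t s : independent q t s -> independent q t s^-1.
Proof.
move=> [q0 t0 s0 ind]; split=> //; first by rewrite invr_eq0.
move=> x y z; rewrite exprz_inv => /ind[-> -> /eqP]; rewrite oppr_eq0 => /eqP ->.
by split.
Qed.

Lemma independent_neq1 q t s (a b c : int) : independent q t s ->
  [|| a != 0, b != 0 | c != 0] -> q ^ a * t ^ b * s ^ c != 1.
Proof.
by case=> _ _ _ ind; apply: contraTneq => /ind[-> -> ->]; rewrite eqxx.
Qed.

Lemma invsum_sub (a b : K) : a != 0 -> b != 0 ->
  invsum a - invsum b = (a - b) * (1 - (a * b)^-1).
Proof. by move=> a0 b0; rewrite /invsum; field; rewrite ?a0 ?b0. Qed.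

Lemma invsum_neq q t s (a b a' b' : int) : independent q t s ->
  [|| a != a' | b != b'] ->
  invsum (q ^ a * t ^ b * s) != invsum (q ^ a' * t ^ b' * s).
Proof.
move=> ind neq; have [q0 t0 s0 _] := ind.
rewrite -subr_eq0 invsum_sub ?mulf_neq0 ?expfz_neq0 // ?subr_eq0.
  have := @independent_neq1 q t s (a - a') (b - b') 0 ind.
  rewrite !subr_eq0 eqxx orbF => /(_ neq); apply: contra => /eqP/(mulIf s0) e.
  rewrite !expfzDr // expr0z mulr1 mulrACA e -mulrACA -!expfzDr // !subrr !expr0z mulr1.
  exact: eqxx.
have := @independent_neq1 q t s (a + a') (b + b') 2 ind.
rewrite orbA orbT => /(_ isT); apply: contra; rewrite eq_sym invr_eq1 => /eqP <-.
apply/eqP; rewrite !expfzDr // expr1z; ring.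
Qed.

Lemma node_neq0 q t s n (mu : part n) i : independent q t s -> node q t mu s i != 0.
Proof. by case=> q0 t0 s0 _; rewrite !mulf_neq0 // expf_neq0. Qed.

Lemma node_nonzero q t s n (mu : part n) : independent q t s -> nonzero (node q t mu s).
Proof. by move=> ind i; apply: node_neq0. Qed.

Lemma node_add_column q t s n (mu : part n) i :
  node q t (add_column mu) s i = node q t mu (q * s) i.
Proof. by rewrite /node add_columnE exprSr; ring. Qed.

Definition snoc n (x : 'I_n -> K) (s : K) : 'I_n.+1 -> K :=
  fun i => if unlift ord_max i is Some j then x j else s.

Lemma snoc_lift n (x : 'I_n -> K) s i : snoc x s (lift ord_max i) = x i.
Proof. by rewrite /snoc liftK. Qed.

Lemma snoc_max n (x : 'I_n -> K) s : snoc x s ord_max = s.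
Proof. by rewrite /snoc unlift_none. Qed.

Lemma nonzero_snoc n (x : 'I_n -> K) s : nonzero x -> s != 0 -> nonzero (snoc x s).
Proof. by move=> nzx s0 i; rewrite /snoc; case: unliftP. Qed.

Lemma node_pad q t s n (mu : part n) : node q t (pad mu) s = snoc (node q t mu (t * s)) s.
Proof.
apply: functional_extensionality => i; case: (unliftP ord_max i) => [j|] ->.
  rewrite snoc_lift /node pad_lift lift_max subSn // exprSr; ring.
by rewrite snoc_max /node pad_max subnn !mul1r.
Qed.

Hypothesis char0 : [pchar K] =i pred0.

Definition mul_column n s (F : ('I_n -> K) -> K) (x : 'I_n -> K) :=
  \prod_(i < n) (invsum (x i) - invsum s) * F x.

Lemma invsum_permute n (p : 'S_n) (x : 'I_n -> K) (c : K) :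
  \prod_(i < n) (invsum (permute p x i) - c) = \prod_(i < n) (invsum (x i) - c).
Proof. by rewrite [RHS](reindex_inj (@perm_inj _ p)). Qed.

(** The product adds one to every exponent of the leading monomial, and it vanishes
    at the nodes with a zero last part. *)
Lemma lead_mul_column n s (la : part n) c F :
  lead la c F -> lead (add_column la) c (mul_column s F).
Proof.
move=> lF; apply: lead_criterion => //.
  apply: symmetric_span => //.
    apply: laurent_mul; last exact: lead_laurent lF.
    apply: laurent_prod => i _; apply: laurent_add; first exact: laurent_invsum.
    exact: laurent_const.
  have [symp symf] := lead_symmetric lF.
  split=> [p|e] x nzx; rewrite /mul_column ?invsum_permute ?symp ?symf //.
  by congr (_ * _); apply: eq_bigr => i _; rewrite invsum_flip.
move=> a a_dec a_gt0.
have nz1 : nonzero (fun _ : 'I_n => 1 : K) by move=> i; exact: oner_neq0.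
have := lead_tends lF (positive_sharp (la := la) a_dec a_gt0) nz1.
have -> : mono (fun _ : 'I_n => 1 : K) (exponent la) = 1.
  by rewrite /mono big1 // => i _; rewrite exp1rz.
rewrite mulr1 => limF.
have lim1 : tends (fun v => \prod_(i < n) (1 + v ^+ (a i + a i) + - invsum s * v ^+ a i))
    (\prod_(i < n) (1 + 0 + - invsum s * 0)).
  apply: tends_prod => i _; apply: tends_add; last first.
    by apply: tends_mul; [exact: tends_const | apply: tends_exp; exact: a_gt0].
  apply: tends_add; first exact: tends_const.
  by apply: tends_exp; rewrite addn_gt0 a_gt0.
have := tends_mul lim1 limF; rewrite [X in X * c]big1 ?mul1r; last first.
  by move=> i _; rewrite mulr0 !addr0.
apply: tends_ext; apply: eventually_mono (@eventually_neq0 K) => v v0.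
have -> : top_weight a (add_column la) = (\sum_(i < n) a i + top_weight a la)%N.
  rewrite /top_weight -big_split; apply: eq_bigr => i _ /=.
  by rewrite add_columnE mulnS.
rewrite /mul_column exprD mulrACA; congr (_ * _).
rewrite (big_morph (fun m => v ^+ m) (exprD v) (expr0 v)) -big_split.
apply: eq_bigr => i _ /=; rewrite /curve mul1r /invsum exprD.
have : v ^+ a i != 0 by rewrite expf_neq0.
rewrite invrK; move: (v ^+ a i) (s + s^-1) => w S w0; by field.
Qed.

Lemma permute_snoc n (p : 'S_n) (x : 'I_n -> K) s :
  snoc (permute p x) s = permute (lift_perm ord_max ord_max p) (snoc x s).
Proof.
apply: functional_extensionality => i; rewrite /permute.
case: (unliftP ord_max i) => [j|] ->.
  by rewrite lift_perm_lift !snoc_lift.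
by rewrite lift_perm_id !snoc_max.
Qed.

Lemma flip_snoc n e (x : 'I_n -> K) s :
  snoc (flip e x) s = flip [ffun i => if unlift ord_max i is Some j then e j else false] (snoc x s).
Proof.
apply: functional_extensionality => i; rewrite /flip ffunE.
case: (unliftP ord_max i) => [j|] ->; first by rewrite !snoc_lift.
by rewrite !snoc_max.
Qed.

(** The variable that is kept constant has weight zero on the curve, which
    [pad_sharp] allows. *)
Lemma lead_snoc n s (la : part n) c F : s != 0 ->
  lead (pad la) c F -> lead la c (fun x => F (snoc x s)).
Proof.
move=> s0 lF; apply: lead_criterion => //.
  apply: symmetric_span => //.
    apply: (laurent_comp (S := fun x => snoc x s)) (lead_laurent lF) => [x nzx|i k]; first exact: nonzero_snoc.
    case: (unliftP ord_max i) => [j|] ->.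
      have L := @laurent_coordz K n j k. refine (laurent_ext _ L) => x _.
      by rewrite snoc_lift.
    by apply: (@laurent_ext K n _ _ _ (laurent_const n (s ^ k))) => x _; rewrite snoc_max.
  have [symp symf] := lead_symmetric lF.
  split=> [p|e] x nzx; rewrite ?permute_snoc ?flip_snoc ?symp ?symf //;
  exact: nonzero_snoc.
move=> a a_dec a_gt0; pose a' i := if (i < n)%N then a i else 0%N.
have a'_dec : strictly_decreasing a' n.
  by move=> i j ij jn; rewrite /a' jn (ltn_trans ij jn) a_dec.
have a'_gt0 i : (i < n)%N -> (0 < a' i)%N by move=> i_n; rewrite /a' i_n a_gt0.
have a'n : a' n = 0%N by rewrite /a' ltnn.
have nz1 : nonzero (snoc (fun _ : 'I_n => 1 : K) s).
  by apply: nonzero_snoc => // i; exact: oner_neq0.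
have := lead_tends lF (pad_sharp (la := la) a'_dec a'_gt0 a'n) nz1.
have -> : mono (snoc (fun _ : 'I_n => 1 : K) s) (exponent (pad la)) = 1.
  rewrite /mono big1 // => i _; case: (unliftP ord_max i) => [j|] ->.
    by rewrite snoc_lift exp1rz.
  by rewrite snoc_max ffunE pad_max expr0z.
rewrite mulr1; apply: tends_ext; apply: eventually_mono (@eventually_neq0 K) => v v0.
have -> : top_weight a' (pad la) = top_weight a la.
  rewrite /top_weight big_ord_recr /= a'n mul0n addn0; apply: eq_bigr => i _.
  by rewrite widen_ord_max pad_lift /a' ltn_ord.
congr (_ * F _); apply: functional_extensionality => i; rewrite /curve.
case: (unliftP ord_max i) => [j|] ->.
  by rewrite !snoc_lift lift_max /a' ltn_ord.
by rewrite !snoc_max a'n invr1 mulr1.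
Qed.

(** Restricting the last variable to [s] maps the orbit sum of [pad la] to that of
    [la] up to lower terms, which are corrected by induction. *)
Lemma lift_orbit_sum n s (la : part n) : s != 0 ->
  exists F, lead (pad la) 1 F /\ forall x, nonzero x -> F (snoc x s) = orbit_sum la x.
Proof.
move=> s0; move: {2}(dominance_rank la) (leqnn (dominance_rank la)) => m.
elim/ltn_ind: m la => m IH la rk.
have [G [[r [below_r GE]] resE]] := lead_snoc s0 (@lead_orbit_sum K _ (pad la)).
have [H [SH HE]] : exists H, in_span (below (pad la)) H /\
    forall x, nonzero x -> H (snoc x s) = \sum_(u <- r) u.1 * orbit_sum u.2 x.
  elim: (r) below_r => [_|u r' IHr /= /andP[bu /IHr[H [SH HE]]]].
    by exists (fun=> 0); split=> [|x _]; [exact: span0 | rewrite big_nil].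
  have lt_rank := strictly_dominated_rank bu.
  have [F [lF FE]] := IH _ (leq_trans lt_rank rk) u.2 (leqnn _).
  exists (fun x => u.1 * F x + H x); split=> [|x nzx]; last by rewrite big_cons FE // HE.
  apply: span_add => //; apply: span_scale; apply: sub_span (lead_span lF) => nu dom.
  by apply: dominated_strict_trans dom _; rewrite strictly_dominated_pad.
exists (fun x => orbit_sum (pad la) x - H x); split=> [|x nzx].
  exists (fun x => - 1 * H x); split; first exact: span_scale.
  by move=> x _; rewrite mul1r mulN1r.
by rewrite resE // GE // HE // mul1r addrK.
Qed.

Definition dominance_ideal n (L : pred (part n)) :=
  forall mu nu, L nu -> dominated mu nu -> L mu.

Lemma orbit_sum0 (la : part 0) (x : 'I_0 -> K) : orbit_sum la x = 1.
Proof.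
have mono1 k : mono x k = 1 by rewrite /mono big_ord0.
rewrite /orbit_sum (bigD1_seq (exponent la)) ?bc_orbit_uniq ?mem_exponent_orbit //= mono1.
rewrite big1 ?addr0 // => k /eqP[]; by apply/ffunP => -[].
Qed.

(** Induction on the number of variables and on the largest part: the values at
    nodes with last part zero are reached by extending a solution in one variable
    less, and the others are then adjusted by a multiple of
    [\prod_i (x_i + 1/x_i - s - 1/s)], which vanishes at the former. *)
Lemma interpolation_surjective q t n s m (L : pred (part n)) (tau : part n -> K) :
  independent q t s -> dominance_ideal L ->
  (forall mu, L mu -> forall i, (mu i < m)%N) ->
  exists F, in_span L F /\ forall mu, L mu -> F (node q t mu s) = tau mu.
Proof.
elim: n s m L tau => [|n IHn] s m L tau.
  move=> _ _ _; pose la := rect 0 0.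
  case Lla: (L la); last first.
    exists (fun=> 0); split=> [|mu]; first exact: span0.
    by rewrite (part0_eq mu la) Lla.
  exists (fun x => tau la * orbit_sum la x); split; first exact/span_scale/span_orbit_sum.
  by move=> mu _; rewrite orbit_sum0 mulr1 (part0_eq mu la).
elim: m s L tau => [|m IHm] s L tau ind idL Lm.
  exists (fun=> 0); split=> [|mu /Lm /(_ ord0) //]; exact: span0.
have [q0 t0 s0 _] := ind.
have ind_t := independent_mult ind.
have ind_q := independent_mulq ind.
have [F0 [[r0 [Lr0 F0E]] F0tau]] : exists F, in_span (fun mu => L (pad mu)) F /\
    forall mu, L (pad mu) -> F (node q t mu (t * s)) = tau (pad mu).
  apply: (IHn _ m.+1 (fun mu => L (pad mu)) (fun mu => tau (pad mu)) ind_t).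
    by move=> mu nu Lnu dom; apply: idL Lnu _; rewrite dominated_pad.
  by move=> mu /Lm Lmu i; rewrite -pad_lift.
have [F1 [SF1 F1E]] : exists F, in_span L F /\ forall x, nonzero x -> F (snoc x s) = F0 x.
  suff [F [SF FE]] : exists F, in_span L F /\
      forall x, nonzero x -> F (snoc x s) = \sum_(u <- r0) u.1 * orbit_sum u.2 x.
    by exists F; split=> // x nzx; rewrite FE // F0E.
  elim: (r0) Lr0 => [_|u r IHr /= /andP[Lu /IHr[H [SH HE]]]].
    by exists (fun=> 0); split=> [|x _]; [exact: span0 | rewrite big_nil].
  have [F [lF FE]] := lift_orbit_sum u.2 s0.
  exists (fun x => u.1 * F x + H x); split=> [|x nzx]; last by rewrite big_cons FE // HE.
  apply: span_add => //; apply: span_scale; refine (sub_span _ (lead_span lF)) => nu dom.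
  exact: idL Lu dom.
pose D (mu : part n.+1) := \prod_(i < n.+1) (invsum (node q t mu s i) - invsum s).
have D_neq0 nu : D (add_column nu) != 0.
  apply/prodf_neq0 => i _; rewrite subr_eq0.
  have := @invsum_neq q t s (nu i).+1%:Z (n.+1 - i.+1)%N%:Z 0 0 ind isT.
  by rewrite !expr0z !mul1r /node add_columnE.
have [F2 [[r2 [Lr2 F2E]] F2tau]] : exists F, in_span (fun mu => L (add_column mu)) F /\
    forall mu, L (add_column mu) -> F (node q t mu (q * s)) =
      (tau (add_column mu) - F1 (node q t (add_column mu) s)) / D (add_column mu).
  apply: (IHm _ (fun mu => L (add_column mu)) (fun mu =>
    (tau (add_column mu) - F1 (node q t (add_column mu) s)) / D (add_column mu)) ind_q).
    by move=> mu nu Lnu dom; apply: idL Lnu _; rewrite dominated_add_column.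
  by move=> mu /Lm Lmu i; have := Lmu i; rewrite add_columnE.
exists (fun x => F1 x + mul_column s F2 x); split.
  apply: span_add => //.
  apply: (@span_ext _ _ _ (fun x => \sum_(u <- r2 | u \in r2)
      u.1 * mul_column s (orbit_sum u.2) x)).
    move=> x nzx; rewrite /mul_column F2E // -big_seq mulr_sumr; apply: eq_bigr => u _.
    by rewrite mulrCA.
  apply: span_sum => u /(allP Lr2) Lu; apply: span_scale.
  refine (sub_span _ (lead_span (lead_mul_column s (@lead_orbit_sum K _ u.2)))) => nu dom.
  exact: idL Lu dom.
move=> mu Lmu; case: (part_peel mu) Lmu => [[nu ->]|[nu ->]] Lnu.
  rewrite node_pad F1E; last exact: node_nonzero.
  rewrite F0tau // /mul_column (bigD1 ord_max) //= snoc_max subrr !mul0r addr0 //.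
have nodeE : node q t (add_column nu) s = node q t nu (q * s).
  by apply: functional_extensionality => i; apply: node_add_column.
rewrite /mul_column -/(D (add_column nu)) nodeE F2tau // -nodeE.
by rewrite mulrC divfK // addrC subrK.
Qed.

Lemma span_list n (P : pred (part n)) (F : ('I_n -> K) -> K) (M : seq (part n)) :
  in_span P F -> uniq M -> (forall mu, P mu -> mu \in M) ->
  exists C, forall x, nonzero x -> F x = \sum_(mu <- M) C mu * orbit_sum mu x.
Proof.
move=> [r [Pr FE]] uniqM PM.
exists (fun mu => \sum_(u <- r | u.2 == mu) u.1) => x nzx.
rewrite FE //; apply: sum_by_part => //.
by apply/allP => u /(allP Pr)/PM.
Qed.

(** Surjectivity of evaluation at as many nodes as there are orbit sums entails
    injectivity. *)
Lemma interpolation_unique q t n s m (L : pred (part n)) (F : ('I_n -> K) -> K) :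
  independent q t s -> dominance_ideal L ->
  (forall mu, L mu -> forall i, (mu i < m)%N) ->
  in_span L F -> (forall mu, L mu -> F (node q t mu s) = 0) ->
  forall x, nonzero x -> F x = 0.
Proof.
move=> ind idL Lm SF F0.
(* [A] is the square matrix of the values of orbit sums at the nodes, and the rows
   [X i] given by surjectivity form a left inverse. *)
pose M := [seq mu <- parts_in_rect n m | L mu].
have uniqM : uniq M by rewrite filter_uniq ?parts_in_rect_uniq.
have mem_M mu : (mu \in M) = L mu.
  rewrite mem_filter mem_parts_in_rect; case Lmu: (L mu) => //=.
  by apply/forallP => i; rewrite ffunE ltnW // Lm.
pose N := size M; pose e (j : 'I_N) := nth (rect n 0) M j.
have eL j : L (e j) by rewrite -mem_M mem_nth.
have sumM (f : part n -> K) : \sum_(mu <- M) f mu = \sum_(j < N) f (e j).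
  by rewrite (big_nth (rect n 0)) big_mkord.
pose A : 'M[K]_N := \matrix_(i, j) orbit_sum (e i) (node q t (e j) s).
have /fin_all_exists[X XA] : forall i : 'I_N, exists X : 'rV[K]_N, X *m A = delta_mx 0 i.
  move=> i.
  have [G [SG GE]] := interpolation_surjective (fun mu => (mu == e i)%:R) ind idL Lm.
  have [C CE] := span_list SG uniqM (fun mu Lmu => etrans (mem_M mu) Lmu).
  exists (\row_j C (e j)); apply/rowP => j; rewrite !mxE eqxx /=.
  transitivity (G (node q t (e j) s)).
    rewrite CE; last exact: node_nonzero.
    by rewrite sumM; apply: eq_bigr => l _; rewrite !mxE.
  by rewrite GE // /e nth_uniq.
have unitA : A \in unitmx.
  suff /mulmx1_unit[_ ->] : (\matrix_i X i) *m A = 1%:M by [].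
  by apply/row_matrixP => i; rewrite row_mul rowK XA row1.
have [C CE] := span_list SF uniqM (fun mu Lmu => etrans (mem_M mu) Lmu).
have C0 : (\row_j C (e j)) = 0.
  rewrite -(mulmxK unitA (\row_j C (e j))); apply/eqP.
  rewrite (_ : _ *m A = 0) ?mul0mx //; apply/rowP => j; rewrite !mxE -[RHS](F0 _ (eL j)) CE; last first.
    exact: node_nonzero.
  by rewrite sumM; apply: eq_bigr => l _; rewrite !mxE.
move=> x nzx; rewrite CE // sumM big1 // => j _.
by have /rowP/(_ j) := C0; rewrite !mxE => ->; rewrite mul0r.
Qed.

End Nodes.

(** * Interpolation polynomials *)

Section InterpolationPolynomials.
Variable K : fieldType.
Implicit Types q t s : K.

Lemma laurent_eval_mmap n (f : laurent K n) x : laurent_eval f x = mmap idfun (mono x) f.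
Proof. by []. Qed.

Lemma laurent_evalZ n c (f : laurent K n) x : laurent_eval (c *: f) x = c * laurent_eval f x.
Proof.
rewrite !laurent_eval_mmap (mmapEw (msuppZ_le _ _)) mmapE mulr_sumr.
by apply: eq_bigr => k _; rewrite mcoeffZ mulrA.
Qed.

Lemma laurent_evalD n (f g : laurent K n) x :
  laurent_eval (f + g) x = laurent_eval f x + laurent_eval g x.
Proof. by rewrite !laurent_eval_mmap mmapD. Qed.

Lemma laurent_eval_sum n I (r : seq I) (f : I -> laurent K n) x :
  laurent_eval (\sum_(i <- r) f i) x = \sum_(i <- r) laurent_eval (f i) x.
Proof.
by elim/big_rec2: _ => [|i y z _ <-]; rewrite ?laurent_evalD // laurent_eval_mmap mmap0.
Qed.

Lemma laurent_eval_monomial_sym n (la : part n) x :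
  laurent_eval (monomial_sym K la) x = orbit_sum la x.
Proof.
rewrite laurent_eval_sum; apply: eq_bigr => k _.
by rewrite laurent_eval_mmap mmapU mul1r.
Qed.

Lemma monomial_sym_symmetric n (la : part n) : bc_symmetric (monomial_sym K la).
Proof.
have coefE k : (monomial_sym K la)@_k = (k \in bc_orbit (exponent la))%:R.
  rewrite /monomial_sym -/(exponent la) raddf_sum /=.
  under eq_bigr => l _ do rewrite mcoeffU.
  case ko: (k \in _).
    rewrite (bigD1_seq k) ?bc_orbit_uniq //= eqxx big1 ?addr0 // => l /negPf ->.
    by [].
  rewrite big1_seq // => l /andP[_ lo]; case: eqP => // e.
  by rewrite -e lo in ko.
by move=> w k; rewrite !coefE bc_orbit_act.
Qed.

(** The conditions on an interpolation polynomial, for functions; the symmetry is a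
    consequence of [lead]. *)
Definition interpolant q t n (la : part n) s (F : ('I_n -> K) -> K) :=
  lead la 1 F /\ forall mu, strictly_dominated mu la -> F (node q t mu s) = 0.

Lemma part_le_psum n (mu : part n) i : (mu i <= psum mu n)%N.
Proof. by rewrite /psum (bigD1 i) //= leq_addr. Qed.

Lemma below_ideal n (la : part n) : dominance_ideal (below la).
Proof. by move=> mu nu bnu dom; apply: dominated_strict_trans dom bnu. Qed.

Lemma below_bounded n (la mu : part n) i : below la mu -> (mu i < (psum la n).+1)%N.
Proof.
by move=> /strictly_dominatedW/dominatedP/(_ n); apply: leq_trans; apply: part_le_psum.
Qed.

Hypothesis char0 : [pchar K] =i pred0.

Lemma is_interpolation_interpolant q t n (la : part n) s f :
  is_interpolation q t la s f -> interpolant q t la s (laurent_eval f).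
Proof.
move=> [_ [r [c [below_r fE]]] f0]; split=> //.
exists (fun x => \sum_(mu <- r) c mu * orbit_sum mu x); split.
  by exists [seq (c mu, mu) | mu <- r]; split=> [|x _]; rewrite ?all_map // big_map.
move=> x _; rewrite fE laurent_evalD laurent_eval_monomial_sym mul1r laurent_eval_sum.
by congr (_ + _); apply: eq_bigr => mu _; rewrite laurent_evalZ laurent_eval_monomial_sym.
Qed.

Lemma interpolation_is_interpolation q t n (la : part n) s :
  independent q t s -> is_interpolation q t la s (interpolation q t la s).
Proof.
move=> ind; apply: epsilon_spec.
have [F [SF FE]] := interpolation_surjective char0 (fun mu => - orbit_sum la (node q t mu s)) ind
  (@below_ideal n la) (fun mu bmu i => below_bounded i bmu).
have [M [C [_ below_M FC]]] := span_normal_form SF.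
exists (monomial_sym K la + \sum_(mu <- M) C mu *: monomial_sym K mu); split.
- move=> w k; rewrite !mcoeffD; congr (_ + _); first exact: monomial_sym_symmetric.
  rewrite !raddf_sum; apply: eq_bigr => mu _; rewrite /= !mcoeffZ; congr (_ * _).
  exact: monomial_sym_symmetric.
- by exists M, C.
move=> mu bmu; rewrite laurent_evalD laurent_eval_monomial_sym laurent_eval_sum.
under eq_bigr => nu _ do rewrite laurent_evalZ laurent_eval_monomial_sym.
by rewrite -FC ?FE ?subrr //; apply: node_nonzero.
Qed.

Lemma interpolant_unique q t n (la : part n) s F G : independent q t s ->
  interpolant q t la s F -> interpolant q t la s G -> forall x, nonzero x -> F x = G x.
Proof.
move=> ind [[F' [SF' FE]] F0] [[G' [SG' GE]] G0] x nzx.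
apply/eqP; rewrite -subr_eq0; apply/eqP.
apply: (interpolation_unique (F := fun x => F x - G x) char0 ind (@below_ideal n la)
  (fun mu bmu i => below_bounded i bmu)) nzx.
  apply: (span_ext _ (span_sub SF' SG')) => y nzy.
  by rewrite FE // GE // opprD addrACA subrr add0r.
by move=> mu bmu; rewrite F0 // G0 // subrr.
Qed.

Lemma interpolation_interpolant q t n (la : part n) s : independent q t s ->
  interpolant q t la s (laurent_eval (interpolation q t la s)).
Proof. by move/interpolation_is_interpolation/is_interpolation_interpolant; apply. Qed.

Lemma interp_atE q t n (la mu : part n) s F : independent q t s ->
  interpolant q t la s F -> interp_at q t la mu s = F (node q t mu s).
Proof.
move=> ind iF; apply: (interpolant_unique ind _ iF); last exact: node_nonzero.
exact: interpolation_interpolant.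
Qed.

End InterpolationPolynomials.

Section Transfer.
Variables (K L : fieldType) (phi : {rmorphism K -> L}).
Hypothesis char0 : [pchar K] =i pred0.

Lemma orbit_sum_rmorph n (la : part n) (x : 'I_n -> K) :
  phi (orbit_sum la x) = orbit_sum la (phi \o x).
Proof.
rewrite rmorph_sum; apply: eq_bigr => k _; rewrite rmorph_prod.
by apply: eq_bigr => i _; rewrite fmorphXz.
Qed.

Lemma node_rmorph (q t s : K) n (mu : part n) :
  phi \o node q t mu s = node (phi q) (phi t) mu (phi s).
Proof.
by apply: functional_extensionality => i; rewrite /= /node !rmorphM !rmorphXn.
Qed.

Lemma independent_rmorph (q t s : K) :
  independent q t s -> independent (phi q) (phi t) (phi s).
Proof.
move=> [q0 t0 s0 ind]; split; rewrite ?fmorph_eq0 // => a b c.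
by rewrite -!fmorphXz -!rmorphM -(rmorph1 phi) => /fmorph_inj /ind.
Qed.

(** Interpolation polynomials do not change under extension of the field, since
    they are characterized by linear equations with a unique solution. *)
Lemma interp_at_rmorph (q t s : K) n (la mu : part n) : independent q t s ->
  phi (interp_at q t la mu s) = interp_at (phi q) (phi t) la mu (phi s).
Proof.
move=> ind; have charL : [pchar L] =i pred0 by move=> p; rewrite (fmorph_pchar phi) char0.
have [[G [SG FE]] F0] := interpolation_interpolant char0 la ind.
have [M [C [_ below_M GE]]] := span_normal_form SG.
pose H (y : 'I_n -> L) := 1 * orbit_sum la y + \sum_(nu <- M) phi (C nu) * orbit_sum nu y.
have HE x : nonzero x -> H (phi \o x) = phi (laurent_eval (interpolation q t la s) x).
  move=> nzx; rewrite /H FE // GE // rmorphD rmorphM rmorph1 orbit_sum_rmorph.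
  congr (_ + _); rewrite rmorph_sum; apply: eq_bigr => nu _.
  by rewrite rmorphM orbit_sum_rmorph.
rewrite (@interp_atE L charL _ _ _ la mu _ H (independent_rmorph ind)).
  by rewrite -node_rmorph HE //; apply: node_nonzero.
split=> [|nu bnu]; last first.
  by rewrite -node_rmorph HE ?F0 ?rmorph0 //; apply: node_nonzero.
exists (fun y => \sum_(nu <- M) phi (C nu) * orbit_sum nu y); split=> //.
exists [seq (phi (C nu), nu) | nu <- M]; split=> [|x _]; last by rewrite big_map.
by rewrite all_map.
Qed.

End Transfer.

(** * The difference operator *)

Section DifferenceOperator.
Variable K : fieldType.
Implicit Types p t A b : K.

Definition kernel n t A b (y : 'I_n -> K) : K :=
  \prod_(i < n) ((1 - A * y i) * (1 - b * y i) / (1 - y i ^+ 2)) *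
  pair_prod (fun i j => (1 - t * (y i * y j)) / (1 - y i * y j)).

(** When [p] is a square root of [q] and [A] is [r], this operator changes the
    parameter of interpolation polynomials from [p * r] to [r]. *)
Definition shift_op n p t A b (F : ('I_n -> K) -> K) (x : 'I_n -> K) : K :=
  \sum_(e : {ffun 'I_n -> bool}) kernel t A b (flip e x) * F (fun i => p * flip e x i).

(** The Weyl denominator, which contains all the poles of the operator, does not
    vanish at such points. *)
Definition generic_point n (x : 'I_n -> K) := [/\ nonzero x,
  forall i, x i ^+ 2 != 1 &
  forall i j : 'I_n, (i < j)%N -> x i * x j != 1 /\ x i != x j].

Lemma generic_flip n e (x : 'I_n -> K) : generic_point x -> generic_point (flip e x).
Proof.
move=> [nzx x1 x2]; split; first exact: nonzero_flip.
  by move=> i; rewrite /flip; case: ifP; rewrite ?exprVn ?invr_eq1.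
move=> i j ij; have [xm xd] := x2 i j ij; have xi := nzx i; have xj := nzx j.
have xd' : x i / x j != 1 by rewrite -subr_eq0 -[1](divff xj) -mulrBl mulf_neq0 ?subr_eq0 ?invr_eq0.
have xm' : x i != (x j)^-1 by apply: contraNneq xm => ->; rewrite mulVf.
rewrite /flip; case: (e i); case: (e j) => //; split=> //.
- by rewrite -invfM invr_eq1.
- by rewrite (inj_eq invr_inj).
- by rewrite -invr_eq1 invfM invrK.
- by rewrite -(inj_eq invr_inj) invrK.
Qed.

Lemma weyl_neq0 n (x : 'I_n -> K) : generic_point x -> weyl x != 0.
Proof.
move=> [nzx x1 x2]; rewrite mulf_neq0 //; apply/prodf_neq0 => i _.
  apply: contraNneq (x1 i) => /eqP; rewrite subr_eq0 => /eqP e.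
  by rewrite expr2 {1}e mulVf.
apply/prodf_neq0 => j ij; have [xm xd] := x2 i j ij.
rewrite invsum_sub // mulf_neq0 ?subr_eq0 1?eq_sym // ?invr_eq1 1?mulrC //.
Qed.

(** The Weyl denominator clears the poles of every summand of the operator, which
    leaves this Laurent polynomial. *)
Definition numerator n p t A b (F : ('I_n -> K) -> K) (y : 'I_n -> K) : K :=
  \prod_(i < n) (- (y i)^-1 * (1 - A * y i) * (1 - b * y i)) *
  (pair_prod (fun i j => y j - y i) *
   pair_prod (fun i j => - (y i * y j)^-1 * (1 - t * (y i * y j)))) *
  F (fun i => p * y i).

Lemma weyl_kernel n p t A b F (y : 'I_n -> K) : generic_point y ->
  weyl y * (kernel t A b y * F (fun i => p * y i)) = numerator p t A b F y.
Proof.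
move=> [nzy y1 y2]; rewrite mulrA; congr (_ * _); rewrite /weyl /kernel mulrACA.
congr (_ * _).
  rewrite -big_split; apply: eq_bigr => i _ /=.
  have yi := nzy i; have : 1 - y i ^+ 2 != 0 by rewrite subr_eq0 eq_sym.
  by move: (y i) yi => u u0 u2; field; rewrite u0.
rewrite -!pair_prodM; apply: eq_pair_prod => i j ij; have [ym yd] := y2 i j ij.
have yi := nzy i; have yj := nzy j.
have : 1 - y i * y j != 0 by rewrite subr_eq0 eq_sym.
rewrite invsum_sub //.
by move: (y i) (y j) yi yj => u v u0 v0 uv; field; rewrite u0 v0.
Qed.

Lemma numerator_permute n p t A b F s (y : 'I_n -> K) : nonzero y -> p != 0 ->
  symmetric_fun F -> numerator p t A b F (permute s y) = (-1) ^+ s * numerator p t A b F y.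
Proof.
move=> nzy p0 [symp _]; rewrite /numerator.
have -> : F (fun i => p * permute s y i) = F (fun i => p * y i).
  by apply: (symp s (fun i => p * y i)) => i; rewrite mulf_neq0.
rewrite [RHS]mulrA; congr (_ * _).
rewrite [X in X * _ = _](_ : _ = \prod_(i < n) (- (y i)^-1 * (1 - A * y i) * (1 - b * y i))); last first.
  by rewrite [RHS](reindex_inj (@perm_inj _ s)).
rewrite (vandermonde_perm s y).
rewrite (pair_prod_perm s (g := fun i j => - (y i * y j)^-1 * (1 - t * (y i * y j)))); last first.
  by move=> i j; rewrite [y j * y i]mulrC.
by rewrite -mulrA mulrCA.
Qed.

Lemma laurent_numerator n p t A b F : p != 0 -> laurent_fun F ->
  laurent_fun (@numerator n p t A b F).
Proof.
move=> p0 LF.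
have Lc c : laurent_fun (fun _ : 'I_n -> K => c) := laurent_const n c.
have Lx i : laurent_fun (fun x : 'I_n -> K => x i) := laurent_coord K i.
have Lxx i j : laurent_fun (fun x : 'I_n -> K => x i * x j) by apply: laurent_mul.
have L1 c i : laurent_fun (fun x : 'I_n -> K => 1 - c * x i).
  by apply: laurent_add => //; apply: laurent_opp; apply: laurent_mul.
apply: laurent_mul; last by apply: (laurent_scale (c := fun=> p)).
apply: laurent_mul; [|apply: laurent_mul]; apply: laurent_prod => i _.
- apply: laurent_mul => //; apply: laurent_mul => //.
  by apply: laurent_opp; apply: laurent_coordV.
- by apply: laurent_prod => j _; apply: laurent_add => //; apply: laurent_opp.
apply: laurent_prod => j _; apply: laurent_mul; last first.
  by apply: laurent_add => //; apply: laurent_opp; apply: laurent_mul.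
apply: laurent_opp.
refine (laurent_ext _ (laurent_mul (laurent_coordV K i) (laurent_coordV K j))) => x _.
by rewrite invfM.
Qed.

Definition alternating_sum n p t A b (F : ('I_n -> K) -> K) (x : 'I_n -> K) : K :=
  \sum_(e : {ffun 'I_n -> bool}) flip_sign K e * numerator p t A b F (flip e x).

Lemma weyl_shift_op n p t A b F (x : 'I_n -> K) : generic_point x ->
  weyl x * shift_op p t A b F x = alternating_sum p t A b F x.
Proof.
move=> gx; rewrite mulr_sumr; apply: eq_bigr => e _.
rewrite -weyl_kernel; last exact: generic_flip.
by rewrite weyl_flip -[flip_sign K e * weyl x * _]mulrA [RHS]mulrA flip_signK mul1r.
Qed.

Lemma alternating_sum_flip n p t A b F e (x : 'I_n -> K) :
  alternating_sum p t A b F (flip e x) = flip_sign K e * alternating_sum p t A b F x.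
Proof.
have inj : injective (fun f : {ffun 'I_n -> bool} => [ffun i => f i (+) e i]).
  by move=> f g /ffunP fg; apply/ffunP => i; have := fg i; rewrite !ffunE => /addIb.
rewrite /alternating_sum mulr_sumr [RHS](reindex_inj inj); apply: eq_bigr => f _.
rewrite [RHS]mulrA; congr (_ * _); last congr (numerator _ _ _ _ _ _).
  rewrite -big_split; apply: eq_bigr => i _ /=; rewrite ffunE.
  by rewrite -signr_addb addbC addbK.
apply: functional_extensionality => i; rewrite /flip ffunE.
by case: (f i); case: (e i) => //=; rewrite invrK.
Qed.

Lemma alternating_sum_permute n p t A b F s (x : 'I_n -> K) : nonzero x -> p != 0 ->
  symmetric_fun F ->
  alternating_sum p t A b F (permute s x) = (-1) ^+ s * alternating_sum p t A b F x.
Proof.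
move=> nzx p0 SF.
have inj : injective (fun f : {ffun 'I_n -> bool} => [ffun i => f (s i)]).
  move=> f g /ffunP fg; apply/ffunP => i.
  by have := fg ((s^-1)%g i); rewrite !ffunE permKV.
rewrite /alternating_sum mulr_sumr (reindex_inj inj); apply: eq_bigr => f _.
have -> : flip [ffun i => f (s i)] (permute s x) = permute s (flip f x).
  by apply: functional_extensionality => i; rewrite /flip /permute ffunE.
rewrite numerator_permute //; last exact: nonzero_flip.
rewrite mulrCA; congr (_ * (_ * _)); rewrite /flip_sign [RHS](reindex_inj (@perm_inj _ s)).
by apply: eq_bigr => i _; rewrite ffunE.
Qed.

Hypothesis char0 : [pchar K] =i pred0.

(** Multiplied by the Weyl denominator, the operator produces an alternating Laurent
    polynomial, which the denominator divides. *)
Lemma shift_op_span n p t A b (F : ('I_n -> K) -> K) : p != 0 ->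
  laurent_fun F -> symmetric_fun F -> exists G, in_span predT G /\
  forall x, generic_point x -> shift_op p t A b F x = G x.
Proof.
move=> p0 LF SF.
have LN : laurent_fun (@alternating_sum n p t A b F).
  apply: laurent_sum => e _; apply: laurent_mul; first exact: laurent_const.
  by apply: laurent_flip; apply: laurent_numerator.
have [G [SG GE]] := alternating_div char0 LN
  (fun s x nzx => alternating_sum_permute t A b s nzx p0 SF)
  (fun e x _ => alternating_sum_flip p t A b F e x).
exists G; split=> // x gx; have [nzx _ _] := gx.
by apply: (mulfI (weyl_neq0 gx)); rewrite weyl_shift_op // GE.
Qed.

Lemma eventually_exp_neq1 m : (0 < m)%N -> eventually (fun v : K => v ^+ m != 1).
Proof.
move=> m_gt0; have X1 : 'X^m - 1%:P != 0 :> {poly K}.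
  by rewrite -size_poly_eq0 size_XnsubC.
apply: eventually_mono (eventually_horner X1) => v.
by rewrite hornerD hornerN hornerXn hornerC subr_eq0.
Qed.

Lemma eventually_generic n (a : nat -> nat) :
  strictly_decreasing a n -> (forall i, (i < n)%N -> (0 < a i)%N) ->
  eventually (fun v => generic_point (curve (fun _ : 'I_n => 1 : K) a v)).
Proof.
move=> a_dec a_gt0.
have ev1 : eventually (fun v : K => forall i : 'I_n, v ^+ (a i * 2) != 1).
  by apply: eventually_all => i; apply: eventually_exp_neq1; rewrite muln_gt0 a_gt0.
have ev2 : eventually (fun v : K => forall u : 'I_n * 'I_n, v ^+ (a u.1 + a u.2) != 1).
  apply: eventually_all => u; apply: eventually_exp_neq1.
  by rewrite addn_gt0 a_gt0.
have ev3 : eventually (fun v : K => forall u : 'I_n * 'I_n,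
    (u.1 < u.2)%N -> v ^+ (a u.1 - a u.2) != 1).
  apply: eventually_all => u; case: (ltnP u.1 u.2) => lt.
    apply: eventually_mono (@eventually_exp_neq1 (a u.1 - a u.2) _) => //.
    by rewrite subn_gt0 a_dec.
  by apply: eventually_mono (@eventually_neq0 K) => v _.
have := eventually_and (@eventually_neq0 K) (eventually_and ev1 (eventually_and ev2 ev3)).
apply: eventually_mono => v [v0 [v1 [v2 v3]]]; split.
- by apply: nonzero_curve => // i; apply: oner_neq0.
- by move=> i; rewrite /curve mul1r exprVn -exprM invr_eq1.
move=> i j ij; rewrite /curve !mul1r; split.
  by rewrite -invfM invr_eq1 -exprD (v2 (i, j)).
rewrite (inj_eq invr_inj); have := v3 (i, j) ij => /=; apply: contra => /eqP e.
have le : (a j <= a i)%N by rewrite ltnW // a_dec.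
rewrite -(inj_eq (mulIf (expf_neq0 (a j) v0))) -exprD subnK // mul1r e eqxx //.
Qed.

Lemma tends_pole (g h : K) m : (0 < m)%N -> h != 0 ->
  tends (fun v => (1 - g * v ^- m) / (1 - h * v ^- m)) (g / h).
Proof.
move=> m_gt0 h0.
have lim (c : K) : tends (fun v => v ^+ m - c) (- c).
  rewrite -{2}[- c]add0r; apply: tends_add; last exact: tends_const.
  exact: tends_exp.
have h0' : - h != 0 by rewrite oppr_eq0.
have := tends_mul (lim g) (tends_inv h0' (lim h)).
rewrite invrN mulrNN; apply: tends_ext; apply: eventually_mono (@eventually_neq0 K) => v v0.
have w0 : v ^+ m != 0 by rewrite expf_neq0.
have e (c : K) : 1 - c * v ^- m = (v ^+ m - c) * v ^- m by rewrite mulrBl divff.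
by rewrite !e invfM invrK mulrACA mulVf // mulr1.
Qed.

Lemma tends_regular (g h : K) m : (0 < m)%N ->
  tends (fun v => (1 - g * v ^+ m) / (1 - h * v ^+ m)) 1.
Proof.
move=> m_gt0.
have lim (c : K) : tends (fun v => 1 + - c * v ^+ m) (1 + - c * 0).
  apply: tends_add; first exact: tends_const.
  by apply: tends_mul; [exact: tends_const | exact: tends_exp].
have h0 : 1 + - h * 0 != 0 by rewrite mulr0 addr0 oner_neq0.
have := tends_mul (lim g) (tends_inv h0 (lim h)).
rewrite !mulr0 !addr0 invr1 mulr1; apply: tends_ext.
by apply: eventually_mono (@eventually_neq0 K) => v _; rewrite !mulNr.
Qed.

Lemma count_larger n i : (\sum_(j < n | (i < j)%N) 1 = n - i.+1)%N.
Proof.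
elim: n => [|n IHn]; first by rewrite big_ord0.
rewrite big_mkcond big_ord_recr -big_mkcond IHn /=.
by case: ltnP => h; lia.
Qed.

Definition eigenvalue_at n p t A b (la : part n) : K :=
  \prod_(i < n) (p ^- la i - A * b * t ^+ (n - i.+1) * p ^+ la i).

(** In the limit the kernel separates into one factor for every variable, so that
    the sum over sign patterns becomes a product. *)
Lemma tends_kernel n t A b (e : {ffun 'I_n -> bool}) (a : nat -> nat) :
  strictly_decreasing a n -> (forall i, (i < n)%N -> (0 < a i)%N) ->
  tends (fun v => kernel t A b (flip e (curve (fun _ : 'I_n => 1 : K) a v)))
    (\prod_(i < n) if e i then 1 else - (A * b * t ^+ (n - i.+1))).
Proof.
move=> a_dec a_gt0.
have -> : \prod_(i < n) (if e i then 1 else - (A * b * t ^+ (n - i.+1))) =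
    \prod_(i < n) (if e i then 1 else - (A * b)) *
    pair_prod (fun i j : 'I_n => if e i then 1 else t).
  rewrite /pair_prod -big_split; apply: eq_bigr => i _ /=.
  case: (e i); first by rewrite big1 ?mulr1.
  rewrite -mulNr; congr (_ * _); rewrite prodr_const; congr (_ ^+ _).
  by rewrite -sum1_card count_larger.
apply: tends_mul; apply: tends_prod => i _.
  rewrite /flip /curve; case: (e i).
    have := tends_mul (tends_regular A 1 (a_gt0 i (ltn_ord i)))
      (tends_regular b (- 1) (a_gt0 i (ltn_ord i))).
    rewrite mulr1; apply: tends_ext; apply: eventually_mono (@eventually_neq0 K) => v v0.
    rewrite !mul1r invrK mulNr mul1r opprK mulf_div; congr (_ / _).
    by ring.
  have h1 : - 1 != 0 :> K by rewrite oppr_eq0 oner_neq0.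
  have := tends_mul (tends_pole A (a_gt0 i (ltn_ord i)) (oner_neq0 K))
    (tends_pole b (a_gt0 i (ltn_ord i)) h1).
  rewrite divr1 invrN invr1 mulrN1 mulrN; apply: tends_ext.
  apply: eventually_mono (@eventually_neq0 K) => v v0.
  by rewrite mul1r mulNr mul1r opprK mulf_div; congr (_ / _); ring.
apply: tends_prod => j ij.
have aij : (0 < a i - a j)%N by rewrite subn_gt0 a_dec.
have le : (a j <= a i)%N by rewrite ltnW // a_dec.
have aij' : (0 < a i + a j)%N by rewrite addn_gt0 a_gt0.
have ediff v : v != 0 -> v ^+ a i / v ^+ a j = v ^+ (a i - a j) :> K.
  by move=> v0; rewrite expfB // a_dec.
rewrite /flip /curve; case: (e i); case: (e j).
- apply: tends_ext (tends_regular t 1 aij').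
  by apply: eventually_mono (@eventually_neq0 K) => v _; rewrite !mul1r !invrK -exprD.
- apply: tends_ext (tends_regular t 1 aij).
  by apply: eventually_mono (@eventually_neq0 K) => v v0; rewrite !mul1r !invrK ediff.
- have := tends_pole t aij (oner_neq0 K); rewrite divr1; apply: tends_ext.
  apply: eventually_mono (@eventually_neq0 K) => v v0.
  have e' : v ^- a i * v ^+ a j = v ^- (a i - a j) by rewrite -ediff // invf_div mulrC.
  by rewrite !mul1r !invrK e'.
have := tends_pole t aij' (oner_neq0 K); rewrite divr1; apply: tends_ext.
apply: eventually_mono (@eventually_neq0 K) => v v0.
by rewrite !mul1r -invfM -exprD.
Qed.

(** By [lead_criterion] it is enough to know the growth along curves.  There every
    summand has a limit, and expanding the eigenvalue, a product of sums of two
    terms, gives the sum of these limits. *)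
Lemma shift_op_lead n p t A b (la : part n) c F : p != 0 -> lead la c F ->
  exists G, lead la (c * eigenvalue_at p t A b la) G /\
    forall x, generic_point x -> shift_op p t A b F x = G x.
Proof.
move=> p0 lF; have SF := lead_symmetric lF.
have [G [SG GE]] := shift_op_span t A b p0 (lead_laurent lF) SF.
exists G; split=> //; apply: lead_criterion => // a a_dec a_gt0.
pose al (e : {ffun 'I_n -> bool}) : 'I_n -> K := fun i => if e i then p^-1 else p.
have nz_al e : nonzero (al e) by move=> i; rewrite /al; case: ifP; rewrite ?invr_eq0.
have -> : c * eigenvalue_at p t A b la = \sum_(e : {ffun 'I_n -> bool})
    (\prod_(i < n) if e i then 1 else - (A * b * t ^+ (n - i.+1))) *
    (c * mono (al e) (exponent la)).
  under eq_bigr => e _ do rewrite mulrCA.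
  rewrite -mulr_sumr; congr (_ * _).
  transitivity (\prod_(i < n) \sum_(f : bool)
      (if f then 1 else - (A * b * t ^+ (n - i.+1))) * (if f then p^-1 else p) ^+ la i).
    apply: eq_bigr => i _; rewrite big_bool /= mul1r exprVn; congr (_ + _).
    by rewrite mulNr.
  rewrite bigA_distr_bigA; apply: eq_bigr => e _ /=.
  by rewrite /mono -big_split; apply: eq_bigr => i _; rewrite ffunE.
apply: (@tends_ext _ (fun v => \sum_(e : {ffun 'I_n -> bool})
  kernel t A b (flip e (curve (fun=> 1) a v)) *
  (v ^+ top_weight a la * F (curve (al e) a v)))).
  have := eventually_and (@eventually_neq0 K) (eventually_generic a_dec a_gt0).
  apply: eventually_mono => v [v0 gv]; rewrite -GE // mulr_sumr; apply: eq_bigr => e _.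
  rewrite mulrCA; congr (_ * (_ * _)).
  have <- : flip e (fun i => p * flip e (curve (fun=> 1) a v) i) = curve (al e) a v.
    apply: functional_extensionality => i; rewrite /flip /curve /al !mul1r.
    by case: (e i); rewrite // invfM invrK.
  case: SF => _ symf; rewrite symf // => i; rewrite mulf_neq0 //.
  by apply: nonzero_flip; apply: nonzero_curve => // j; apply: oner_neq0.
apply: tends_sum => e _; apply: tends_mul; first exact: tends_kernel.
by apply: lead_tends => //; apply: positive_sharp.
Qed.

End DifferenceOperator.

(** * The difference operator at the nodes *)

Section OperatorAtNodes.
Variable K : fieldType.
Implicit Types p q t r b : K.

Lemma independent_sqr p t r : independent p t r -> independent (p ^+ 2) t r.
Proof.
move=> [p0 t0 r0 ind]; split=> //; first by rewrite expf_neq0.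
move=> a b c; rewrite -[p ^+ 2]/(p ^ 2) exprz_exp => /ind[/eqP].
by rewrite mulf_eq0 /= => /eqP -> -> ->; split.
Qed.

Lemma node_intpow q t n (mu : part n) r i :
  node q t mu r i = q ^ (mu i)%:Z * t ^ (n - i.+1)%N%:Z * r.
Proof. by []. Qed.

Lemma node_mul_neq1 q t r n (mu nu : part n) i j (a b : int) : independent q t r ->
  q ^ a * t ^ b * (node q t mu r i * node q t nu r j) != 1.
Proof.
move=> ind; have [q0 t0 r0 _] := ind.
have := @independent_neq1 K q t r (a + (mu i)%:Z + (nu j)%:Z)
  (b + (n - i.+1)%N%:Z + (n - j.+1)%N%:Z) 2 ind.
rewrite orbA orbT => /(_ isT); congr (_ != _).
by rewrite !node_intpow !expfzDr // expr1z; ring.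
Qed.

Lemma node_neq q t r n (mu nu : part n) (i j : 'I_n) : independent q t r ->
  (i != j) || (mu i != nu i) -> node q t mu r i != node q t nu r j.
Proof.
move=> ind neq; have [q0 t0 r0 _] := ind.
have := @independent_neq1 K q t r ((mu i)%:Z - (nu j)%:Z)
  ((n - i.+1)%N%:Z - (n - j.+1)%N%:Z) 0 ind.
have -> : [|| (mu i)%:Z - (nu j)%:Z != 0,
    (n - i.+1)%N%:Z - (n - j.+1)%N%:Z != 0 | 0 != 0 :> int].
  rewrite !subr_eq0 !eqz_nat eqxx orbF; move: neq; case: (eqVneq i j) => [-> /= -> //|ij _].
  apply/orP; right; apply: contra ij => /eqP e; apply/eqP/ord_inj.
  by have := ltn_ord i; have := ltn_ord j; lia.
move=> /(_ isT); apply: contra => /eqP e; apply/eqP.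
have : node q t mu r i / node q t nu r j = 1 by rewrite e divff // node_neq0.
rewrite !node_intpow expr0z mulr1 => <-.
rewrite !expfzDr // -!exprnN -!exprnP; field.
by rewrite !expf_neq0 // r0.
Qed.

Lemma generic_node q t r n (mu : part n) : independent q t r -> generic_point (node q t mu r).
Proof.
move=> ind; split; first exact: node_nonzero.
  by move=> i; have := node_mul_neq1 mu mu i i 0 0 ind; rewrite !expr0z !mul1r.
move=> i j ij; split; first by have := node_mul_neq1 mu mu i j 0 0 ind; rewrite !expr0z !mul1r.
by apply: node_neq => //; rewrite -(inj_eq (@ord_inj n)) neq_ltn ij.
Qed.

(** [mu / nu] is a vertical strip. *)
Definition strip n (mu nu : part n) : bool := [forall i, nu i <= mu i <= (nu i).+1]%N.

Definition strip_sign n (mu nu : part n) : {ffun 'I_n -> bool} := [ffun i => nu i < mu i]%N.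

Lemma strip_included n (mu nu : part n) : strip mu nu -> included nu mu.
Proof. by move=> /forallP st; apply/forallP => i; case/andP: (st i). Qed.

Lemma strip_refl n (mu : part n) : strip mu mu.
Proof. by apply/forallP => i; rewrite leqnn leqnSn. Qed.

Lemma strip_part n (mu nu : part n) i :
  strip mu nu -> nu i = (mu i - strip_sign mu nu i)%N.
Proof.
by move=> /forallP/(_ i)/andP[le1 le2]; rewrite ffunE; case: ltnP => /= lt; lia.
Qed.

Lemma adjacent_decreasing n (l : {ffun 'I_n -> nat}) :
  (forall i j : 'I_n, j = i.+1 :> nat -> (l j <= l i)%N) -> decreasing l.
Proof.
move=> adj; apply/forallP => i; apply/forallP => j; apply/implyP.
move e: (j - i)%N => d; elim: d j e => [|d IHd] j e ij.
  by have -> : j = i by apply: ord_inj; lia.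
have lt : (j.-1 < n)%N by apply: leq_ltn_trans (leq_pred _) (ltn_ord j).
apply: leq_trans (adj (Ordinal lt) j _) (IHd (Ordinal lt) _ _) => /=; lia.
Qed.

(** Inverting coordinate [i] means removing a box from row [i].  If the result is
    not a partition, then either the box is removed from the upper one of two equal
    rows only, and a factor [1 - t * (y i * y j)] vanishes, or it is removed from an
    empty last row, and the factor [1 - r * y i] vanishes. *)
Lemma kernel_support q t r b n (mu : part n) (e : {ffun 'I_n -> bool}) : independent q t r ->
  kernel t r b (flip e (node q t mu r)) != 0 -> exists nu, strip mu nu /\ e = strip_sign mu nu.
Proof.
move=> ind; have [q0 t0 r0 _] := ind; rewrite mulf_eq0 negb_or => /andP[ker1 ker2].
have adj (i j : 'I_n) : j = i.+1 :> nat -> e i -> mu i = mu j -> e j.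
  move=> ji ei muij; apply: contraNT ker2 => /negPf ej.
  rewrite /pair_prod (bigD1 i) //= (bigD1 j) /=; last by rewrite ji.
  rewrite {1}/flip ei {1}/flip ej.
  have -> : t * ((node q t mu r i)^-1 * node q t mu r j) = 1.
    have -> : node q t mu r i = t * node q t mu r j.
      rewrite /node muij ji (_ : (n - i.+1 = (n - i.+2).+1)%N) ?exprS; first by ring.
      by have := ltn_ord j; lia.
    by rewrite invfM -mulrA mulVf ?mulr1 ?mulfV // node_neq0.
  by rewrite subrr !mul0r.
have last_gt0 (i : 'I_n) : i.+1 = n :> nat -> e i -> (0 < mu i)%N.
  move=> i_n ei; rewrite lt0n; apply: contraNneq ker1 => mu0.
  rewrite (bigD1 i) //= {1}/flip ei /node mu0 i_n subnn !mul1r divff // subrr.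
  by rewrite !mul0r.
have gt0 (i : 'I_n) : e i -> (0 < mu i)%N.
  move d_def: (n - i)%N => d; elim: d i d_def => [|d IHd] i d_def ei.
    by have := ltn_ord i; lia.
  case: (ltnP i.+1 n) => [lt|ge]; last by apply: last_gt0 => //; have := ltn_ord i; lia.
  rewrite lt0n; apply/eqP => mu0; pose j := Ordinal lt.
  have muj : mu j = 0%N by apply/eqP; rewrite -leqn0 -mu0; apply: part_leq.
  have ej : e j by apply: adj ei _ => //; rewrite mu0 muj.
  by have := IHd j _ ej; rewrite muj /= => h; have := h ltac:(lia).
have dec : decreasing [ffun i => (mu i - e i)%N].
  apply: adjacent_decreasing => i j ji; rewrite !ffunE.
  have le : (mu j <= mu i)%N by rewrite part_leq // ji.
  have := adj i j ji; case: (e i) => [/(_ isT)|]; last by case: (e j) => /=; lia.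
  case: (e j) => /= h; first by lia.
  suff : mu i != mu j by lia.
  by apply/eqP => /h.
exists (Part dec); have nuE i : Part dec i = (mu i - e i)%N by rewrite ffunE.
split; first by apply/forallP => i; rewrite nuE; case: (e i); rewrite /=; lia.
apply/ffunP => i; rewrite ffunE nuE; have := gt0 i.
by case: (e i) => [/(_ isT)|_] /=; lia.
Qed.

Lemma strip_sign_inj n (mu nu nu' : part n) : strip mu nu -> strip mu nu' ->
  strip_sign mu nu = strip_sign mu nu' -> nu = nu'.
Proof.
move=> st st' e; apply: val_inj; apply/ffunP => i.
by rewrite [LHS](strip_part i st) [RHS](strip_part i st') e.
Qed.

Lemma sum_strip n m (mu : part n) (f : {ffun 'I_n -> bool} -> K) :
  included mu (rect n m) ->
  (forall e, f e != 0 -> exists nu, strip mu nu /\ e = strip_sign mu nu) ->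
  \sum_e f e = \sum_(nu <- parts_in_rect n m | strip mu nu) f (strip_sign mu nu).
Proof.
move=> mu_in supp.
pose S := [seq strip_sign mu nu | nu <- parts_in_rect n m & strip mu nu].
have uniqS : uniq S.
  rewrite map_inj_in_uniq ?filter_uniq ?parts_in_rect_uniq // => nu nu'.
  rewrite !mem_filter => /andP[st _] /andP[st' _]; exact: strip_sign_inj.
have -> : \sum_(nu <- parts_in_rect n m | strip mu nu) f (strip_sign mu nu) = \sum_(e in S) f e.
  by rewrite -big_uniq // big_map big_filter.
rewrite (bigID (mem S)) /= [X in _ + X]big1 ?addr0 // => e eS.
apply/eqP; apply: contraNT eS => /supp[nu [st ->]].
apply: map_f; rewrite mem_filter st mem_parts_in_rect.
apply/forallP => i; have /forallP/(_ i) := strip_included st.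
by move/leq_trans; apply; apply: (forallP mu_in).
Qed.

Lemma shift_op_node p t r b n m (mu : part n) F : independent p t r -> symmetric_fun F ->
  included mu (rect n m) ->
  shift_op p t r b F (node (p ^+ 2) t mu r) =
  \sum_(nu <- parts_in_rect n m | strip mu nu)
    kernel t r b (flip (strip_sign mu nu) (node (p ^+ 2) t mu r)) *
    F (node (p ^+ 2) t nu (p * r)).
Proof.
move=> ind [_ symf] mu_in; have [p0 t0 r0 _] := ind.
have indq := independent_sqr ind.
rewrite /shift_op (sum_strip mu_in); last first.
  by move=> e; rewrite mulf_eq0 negb_or => /andP[ke _]; apply: kernel_support ke.
apply: eq_bigr => nu st; congr (_ * _).
have indp := independent_sqr (independent_mulq ind).
rewrite -(symf (strip_sign mu nu) _ (node_nonzero nu indp)).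
congr (F _); apply: functional_extensionality => i.
rewrite /flip /node (strip_part i st); have /forallP/(_ i)/andP[le1 le2] := st.
rewrite !ffunE; case: ltnP => lt /=; last by rewrite subn0; ring.
case: (mu i) lt => // k _; rewrite subn1 /= exprS; field.
by rewrite ?expf_neq0 // ?p0 ?r0 ?t0.
Qed.

Hypothesis char0 : [pchar K] =i pred0.

(** Both sides are interpolation polynomials up to the factor: the operator
    preserves vanishing at dominated nodes, since removing a vertical strip from a
    partition only makes it smaller. *)
Lemma interpolant_shift_op p t r b n m (la mu : part n) F F' : independent p t r ->
  interpolant (p ^+ 2) t la (p * r) F -> interpolant (p ^+ 2) t la r F' ->
  included mu (rect n m) ->
  \sum_(nu <- parts_in_rect n m | strip mu nu)
    kernel t r b (flip (strip_sign mu nu) (node (p ^+ 2) t mu r)) *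
    F (node (p ^+ 2) t nu (p * r)) =
  eigenvalue_at p t r b la * F' (node (p ^+ 2) t mu r).
Proof.
move=> ind [lF F0] [[G' [SG' F'E]] F'0] mu_in; have [p0 t0 r0 _] := ind.
have indq := independent_sqr ind.
have [G [[H [SH GE]] opE]] := shift_op_lead char0 t r b p0 lF.
rewrite -(shift_op_node _ ind (lead_symmetric lF) mu_in) opE; last exact: generic_node.
apply/eqP; rewrite -subr_eq0; apply/eqP; set E := eigenvalue_at _ _ _ _ _ in GE *.
apply: (interpolation_unique (F := fun x => G x - E * F' x) char0 indq (@below_ideal n la)
  (fun nu bnu i => below_bounded i bnu)) (node_nonzero mu indq).
  apply: (span_ext _ (span_sub SH (span_scale E SG'))) => y nzy.
  by rewrite GE // F'E // !mul1r; ring.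
move=> nu bnu; rewrite F'0 // mulr0 subr0 -opE; last exact: generic_node.
have nu_in : included nu (rect n (psum la n).+1).
  by apply/forallP => i; rewrite ffunE ltnW // below_bounded.
rewrite (shift_op_node _ ind (lead_symmetric lF) nu_in) big1 // => pi st.
rewrite F0 ?mulr0 //; apply: dominated_strict_trans bnu.
exact: included_dominated (strip_included st).
Qed.

End OperatorAtNodes.

Section Vanishing.
Variable K : fieldType.
Implicit Types p q t r s b : K.
Hypothesis char0 : [pchar K] =i pred0.

Lemma interp_at_shift p t r b n m (la mu : part n) : independent p t r ->
  included mu (rect n m) ->
  \sum_(nu <- parts_in_rect n m | strip mu nu)
    kernel t r b (flip (strip_sign mu nu) (node (p ^+ 2) t mu r)) *
    interp_at (p ^+ 2) t la nu (p * r) =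
  eigenvalue_at p t r b la * interp_at (p ^+ 2) t la mu r.
Proof.
move=> ind mu_in; apply: interpolant_shift_op => //; apply: interpolation_interpolant => //.
  exact/independent_sqr/independent_mulq.
exact: independent_sqr.
Qed.

Lemma eigenvalue_at_eq0 p t r n (la : part n) i : independent p t r ->
  eigenvalue_at p t r (node (p ^+ 2) t la r i)^-1 la = 0.
Proof.
case=> p0 t0 r0 _; rewrite /eigenvalue_at (bigD1 i) //= /node.
rewrite [X in X * _](_ : _ = 0) ?mul0r //.
rewrite -exprM mulnC exprM expr2.
by field; rewrite ?expf_neq0 // ?p0 ?r0 ?t0.
Qed.

Lemma kernel_node_neq0 q t r b n (mu : part n) : independent q t r ->
  (forall i, b * node q t mu r i != 1) -> kernel t r b (node q t mu r) != 0.
Proof.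
move=> ind b1; have [q0 t0 r0 _] := ind; have [nz g1 g2] := generic_node mu ind.
rewrite mulf_neq0 //; apply/prodf_neq0 => i _.
  apply: mulf_neq0; last by rewrite invr_eq0 subr_eq0 eq_sym.
  apply: mulf_neq0; rewrite subr_eq0 eq_sym //.
  have := @independent_neq1 K q t r (mu i)%:Z (n - i.+1)%N%:Z 2 ind.
  rewrite orbA orbT => /(_ isT); congr (_ != _).
  by rewrite node_intpow -[r ^ 2]/(r ^+ 2); ring.
apply/prodf_neq0 => j ij; have [xm _] := g2 i j ij.
apply: mulf_neq0; last by rewrite invr_eq0 subr_eq0 eq_sym.
rewrite subr_eq0 eq_sym.
by have := node_mul_neq1 mu mu i j 0 1 ind; rewrite expr0z expr1z mul1r.
Qed.

Lemma flip_diag n (mu : part n) (x : 'I_n -> K) : flip (strip_sign mu mu) x = x.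
Proof. by apply: functional_extensionality => i; rewrite /flip ffunE ltnn. Qed.

(** The parameter [b] is chosen to annihilate the eigenvalue, so that the value at
    [mu] is a combination of those at the smaller partitions obtained by removing a
    strip from [mu], which vanish by induction. *)
Lemma interp_at_eq0 p t s n (la mu : part n) : independent p t s ->
  ~~ included la mu -> interp_at (p ^+ 2) t la mu s = 0.
Proof.
have [m] := ubnP (\sum_(i < n) mu i)%N; elim: m mu => // m IHm mu lt_m ind.
rewrite negb_forall => /existsP[i]; rewrite -ltnNge => lt_i.
have [p0 t0 s0 _] := ind; pose r := s / p.
have indr : independent p t r.
  have := independent_shift (-1) 0 ind; rewrite expr0z exprN1 mulr1.
  by rewrite /r [s / p]mulrC.
have sE : s = p * r by rewrite /r mulrC divfK.
pose b := (node (p ^+ 2) t la r i)^-1.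
have mu_in : included mu (rect n (psum mu n)).
  by apply/forallP => j; rewrite ffunE part_le_psum.
have := interp_at_shift b la indr mu_in; rewrite eigenvalue_at_eq0 // mul0r -sE.
rewrite big_mkcond (bigD1_seq mu) ?parts_in_rect_uniq ?mem_parts_in_rect //= strip_refl.
rewrite big1 ?addr0 => [|nu neq]; last first.
  case: ifP => // st; rewrite IHm ?mulr0 //.
    rewrite -ltnS; apply: leq_trans lt_m; rewrite ltnS ltn_neqAle.
    have /forallP st' := strip_included st.
    rewrite leq_sum ?andbT //; apply: contra neq => /eqP e.
    apply/eqP/val_inj/ffunP => j.
    have := leqif_sum (P := xpredT) (fun (j : 'I_n) _ => leqif_eq (st' j)) => -[_].
    by rewrite e eqxx => /esym/forallP/(_ j)/eqP.
  rewrite negb_forall; apply/existsP; exists i; rewrite -ltnNge.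
  by apply: leq_ltn_trans lt_i; apply: (forallP (strip_included st)).
rewrite flip_diag => /eqP; rewrite mulf_eq0 => /orP[|/eqP //].
have indq := independent_sqr indr.
apply: contraTeq => _; apply: kernel_node_neq0 => // j.
apply/eqP => /(congr1 (fun x => node (p ^+ 2) t la r i * x)).
rewrite mulr1 /b mulVKf ?node_neq0 // => /eqP; apply/negP.
apply: node_neq => //; case: eqVneq => //= ->; by rewrite neq_ltn lt_i.
Qed.

(** ** Diagonal values *)

(** Multiplication by the product carries the conditions on the interpolation
    polynomial of [la] with parameter [q * s] to those for [add_column la]. *)
Lemma interp_at_add_column q t s n (la mu : part n) : independent q t s ->
  interp_at q t (add_column la) (add_column mu) s =
  \prod_(i < n) (invsum (node q t mu (q * s) i) - invsum s) * interp_at q t la mu (q * s).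
Proof.
move=> ind.
have indq := independent_mulq ind.
have [lF F0] := interpolation_interpolant char0 la indq.
have nodeE nu : node q t (add_column nu) s = node q t nu (q * s).
  by apply: functional_extensionality => i; apply: node_add_column.
rewrite (interp_atE char0 (F := mul_column s (laurent_eval (interpolation q t la (q * s)))) _ ind).
  by rewrite /mul_column nodeE.
split; first exact: lead_mul_column.
case: n la mu lF F0 nodeE => [|n] la mu lF F0 nodeE nu bnu.
  by case/andP: bnu => _; rewrite (part0_eq nu (add_column la)) eqxx.
case: (part_peel nu) bnu => [[pi ->]|[pi ->]] bnu.
  by rewrite /mul_column node_pad (bigD1 ord_max) //= snoc_max subrr !mul0r.
by rewrite /mul_column nodeE F0 ?mulr0 // -strictly_dominated_add_column.
Qed.

(** Restricting the last variable to [s] carries the conditions for [pad la] to those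
    for [la] with parameter [t * s]. *)
Lemma interp_at_pad q t s n (la mu : part n) : independent q t s ->
  interp_at q t (pad la) (pad mu) s = interp_at q t la mu (t * s).
Proof.
move=> ind; have [q0 t0 s0 _] := ind.
have indt := independent_mult ind.
have [lF F0] := interpolation_interpolant char0 (pad la) ind.
rewrite (interp_atE char0 (F := fun x => laurent_eval (interpolation q t (pad la) s) (snoc x s)) _ indt).
  by rewrite -node_pad.
split; first exact: lead_snoc.
by move=> nu bnu; rewrite -node_pad F0 // strictly_dominated_pad.
Qed.

End Vanishing.

(** * Product formulas *)

Section ProductFormulas.
Variable K : fieldType.
Implicit Types q t s c x : K.

Definition qpoch q c k : K := \prod_(r < k) (1 - q ^+ r * c).

Lemma qpoch0 q c : qpoch q c 0 = 1.
Proof. exact: big_ord0. Qed.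

Lemma qpochSr q c k : qpoch q c k.+1 = qpoch q c k * (1 - q ^+ k * c).
Proof. exact: big_ord_recr. Qed.

Lemma qpochS q c k : qpoch q c k.+1 = (1 - c) * qpoch q (q * c) k.
Proof.
rewrite /qpoch big_ord_recl mul1r; congr (_ * _); apply: eq_bigr => r _.
by rewrite exprSr mulrA.
Qed.

Lemma qpoch_neq0 q c k : (forall r, q ^+ r * c != 1) -> qpoch q c k != 0.
Proof. by move=> h; apply/prodf_neq0 => r _; rewrite subr_eq0 eq_sym. Qed.

Lemma qpoch_t_neq0 q t s m k : independent q t s -> (0 < m)%N -> qpoch q (t ^+ m) k != 0.
Proof.
move=> ind m_gt0; apply: qpoch_neq0 => r.
have := @independent_neq1 K q t s r%:Z m%:Z 0 ind.
by rewrite expr0z mulr1 (_ : m%:Z != 0) ?orbT ?eqz_nat -?lt0n //; apply.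
Qed.

Lemma qpoch_qt_neq0 q t s m k : independent q t s -> qpoch q (q * t ^+ m) k != 0.
Proof.
move=> ind; apply: qpoch_neq0 => r.
have := @independent_neq1 K q t s r.+1%:Z m%:Z 0 ind isT.
by rewrite expr0z mulr1 mulrA -exprSr.
Qed.

Lemma qpoch_s_neq0 q t s (a b : nat) k : independent q t s ->
  qpoch q (q ^+ a * (t ^+ b * s ^+ 2)) k != 0.
Proof.
move=> ind; apply: qpoch_neq0 => r.
have := @independent_neq1 K q t s (r + a)%N%:Z b%:Z 2 ind.
rewrite orbA orbT => /(_ isT); congr (_ != _).
by rewrite -[s ^ 2]/(s ^+ 2) -!exprnP exprD; ring.
Qed.

Lemma one_minus_s_neq0 q t s (a b : nat) : independent q t s ->
  1 - q ^+ a * (t ^+ b * s ^+ 2) != 0.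
Proof.
by move=> ind; have := qpoch_s_neq0 a b 1 ind; rewrite qpochSr qpoch0 !mul1r.
Qed.

Lemma pair_prod_recr n (g : 'I_n.+1 -> 'I_n.+1 -> K) :
  pair_prod g = pair_prod (fun i j => g (lift ord_max i) (lift ord_max j)) *
    \prod_(i < n) g (lift ord_max i) ord_max.
Proof.
rewrite /pair_prod big_ord_recr /= [X in _ * X]big1 ?mulr1; last first.
  by move=> j; rewrite ltnNge -ltnS ltn_ord.
rewrite -big_split; apply: eq_bigr => i _ /=.
rewrite big_mkcond big_ord_recr /= ltn_ord -big_mkcond widen_ord_max; congr (_ * _).
by apply: eq_bigr => j _; rewrite widen_ord_max.
Qed.

Lemma telescope_pairs n (f : nat -> K) i : (i < n)%N -> (forall k, f k != 0) ->
  \prod_(j < n | (i < j)%N) (f (n - j.+1)%N / f (n - j)%N) = f 0%N / f (n - i.+1)%N.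
Proof.
rewrite leq_eqVlt => /orP[/eqP <- |lt] f0.
  rewrite subnn divff // big_pred0 // => j.
  by apply/negbTE; rewrite -leqNgt -ltnS.
pose g k := f (n - k)%N.
transitivity (\prod_(i.+1 <= j < n) (g j.+1 / g j)).
  by rewrite big_geq_mkord.
by rewrite telescope_prodf ?/g ?subnn // => k _.
Qed.

Definition diag_single q t s n (la : part n) (i : 'I_n) : K :=
  (node q t la s i)^-1 ^+ la i * qpoch q (q * t ^+ (n - i.+1)) (la i) *
  qpoch q (t ^+ (n - i.+1 + (n - i.+1)) * s ^+ 2) (la i + la i) /
  qpoch q (t ^+ (n - i.+1) * s ^+ 2) (la i).

Definition diag_pair q t s n (la : part n) (i j : 'I_n) : K :=
  qpoch q (q * t ^+ (j - i.+1)) (la i - la j) / qpoch q (q * t ^+ (j - i)) (la i - la j) *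
  (qpoch q (t ^+ (n - i.+1 + (n - j.+1)) * s ^+ 2) (la i + la j) /
   qpoch q (t ^+ (n - i.+1 + (n - j)) * s ^+ 2) (la i + la j)).

(** The value at [la] of the interpolation polynomial of [la], as a product over rows
    and over pairs of rows like the kernel of the difference operator. *)
Definition diag_value q t s n (la : part n) : K :=
  \prod_(i < n) diag_single q t s la i * pair_prod (diag_pair q t s la).

Lemma diag_value_pad q t s n (la : part n) : independent q t s ->
  diag_value q t s (pad la) = diag_value q t (t * s) la.
Proof.
move=> ind; have [q0 t0 s0 _] := ind.
rewrite /diag_value pair_prod_recr big_ord_recr /=.
have -> : diag_single q t s (pad la) ord_max = 1.
  by rewrite /diag_single pad_max addn0 !qpoch0 expr0 invr1 !mulr1.
rewrite mulr1 [pair_prod _ * _]mulrC mulrA -big_split; congr (_ * _); last first.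
  apply: eq_pair_prod => i j ij; rewrite /diag_pair !pad_lift !lift_max.
  have e (m : nat) (k : nat) : t ^+ (m + k).+2 * s ^+ 2 = t ^+ (m + k) * (t * s) ^+ 2.
    by rewrite !exprS; ring.
  have -> : (n.+1 - i.+1 + (n.+1 - j.+1) = (n - i.+1 + (n - j.+1)).+2)%N.
    by have := ltn_ord i; have := ltn_ord j; lia.
  have -> : (n.+1 - i.+1 + (n.+1 - j) = (n - i.+1 + (n - j)).+2)%N.
    by have := ltn_ord i; have := ltn_ord j; lia.
  by rewrite !e.
apply: eq_bigr => i _; rewrite widen_ord_max /diag_single /diag_pair pad_max pad_lift.
rewrite node_pad snoc_lift !lift_max /= subn0 addn0 subSS subnn addn0 subSnn.
move e: (n - i.+1)%N => k.
have -> : (n - i = k.+1)%N by have := ltn_ord i; lia.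
have -> : (k.+1 + k.+1 = (k + k).+2)%N by lia.
have -> : t ^+ (k + k).+2 * s ^+ 2 = t ^+ (k + k) * (t * s) ^+ 2 by rewrite !exprS; ring.
have -> : t ^+ (k.+1 + 1) * s ^+ 2 = t ^+ k * (t * s) ^+ 2 by rewrite addn1 !exprS; ring.
have n1 : qpoch q (q * t ^+ k.+1) (la i) != 0 := qpoch_qt_neq0 k.+1 (la i) ind.
have n2 : qpoch q (t ^+ k.+1 * s ^+ 2) (la i) != 0.
  by have := qpoch_s_neq0 0 k.+1 (la i) ind; rewrite mul1r.
have ind_t := independent_mult ind.
have n3 : qpoch q (t ^+ k * (t * s) ^+ 2) (la i) != 0.
  by have := qpoch_s_neq0 0 k (la i) ind_t; rewrite mul1r.
move: n1 n2 n3; move: (qpoch q (q * t ^+ k.+1) _) (qpoch q (t ^+ k.+1 * s ^+ 2) _)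
  (qpoch q (t ^+ k * (t * s) ^+ 2) _) (qpoch q (q * t ^+ k) _) (qpoch q _ (la i + la i))
  => x1 x2 x3 x4 x5 n1 n2 n3.
by move: (_^-1 ^+ la i) => z; field; rewrite n1 n2 n3.
Qed.

(** The pairs formed by row [i] and the rows below it change by factors that
    telescope, and what remains is absorbed by the factor of row [i]. *)
Lemma diag_value_add_column q t s n (la : part n) : independent q t s ->
  diag_value q t s (add_column la) =
  \prod_(i < n) (invsum (node q t la (q * s) i) - invsum s) * diag_value q t (q * s) la.
Proof.
move=> ind; have [q0 t0 s0 _] := ind.
pose h u := (1 - u) * (1 - q * u).
have h0 k : h (t ^+ k * s ^+ 2) != 0.
  have := one_minus_s_neq0 0 k ind; have := one_minus_s_neq0 1 k ind.
  by rewrite expr1 mul1r => h1 h2; rewrite mulf_neq0.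
have pairE : pair_prod (diag_pair q t s (add_column la)) =
    \prod_(i < n) (h (t ^+ (n - i.+1) * s ^+ 2) / h (t ^+ (n - i.+1 + (n - i.+1)) * s ^+ 2)) *
    pair_prod (diag_pair q t (q * s) la).
  have -> : \prod_(i < n) (h (t ^+ (n - i.+1) * s ^+ 2) / h (t ^+ (n - i.+1 + (n - i.+1)) * s ^+ 2)) =
      pair_prod (fun i j : 'I_n => h (t ^+ (n - i.+1 + (n - j.+1)) * s ^+ 2) /
                                   h (t ^+ (n - i.+1 + (n - j)) * s ^+ 2)).
    apply: eq_bigr => i _; pose f k := h (t ^+ (n - i.+1 + k) * s ^+ 2).
    have f0 k : f k != 0 by apply: h0.
    by have := telescope_pairs (ltn_ord i) f0; rewrite /f addn0 => ->.
  rewrite -pair_prodM; apply: eq_pair_prod => i j ij; rewrite /diag_pair !add_columnE subSS.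
  rewrite [RHS]mulrCA; congr (_ * _); rewrite addSn addnS !qpochS mulf_div; congr (_ / _).
    by rewrite -mulrA; congr (_ * (_ * qpoch _ _ _)); ring.
  by rewrite -mulrA; congr (_ * (_ * qpoch _ _ _)); ring.
rewrite /diag_value pairE [LHS]mulrA [RHS]mulrA; congr (_ * _); rewrite -!big_split.
apply: eq_bigr => i _; rewrite /= /diag_single add_columnE node_add_column.
move e: (n - i.+1)%N => k; set l := la i; set z := node _ _ _ _ _.
have zE : z = q ^+ l.+1 * t ^+ k * s by rewrite /z /node e exprS; ring.
have z0 : z != 0 by rewrite zE !mulf_neq0 // expf_neq0.
rewrite addSn addnS !qpochS.
rewrite -(qpochS q (q * t ^+ k)) qpochSr exprSr invsum_sub //.
have -> : t ^+ (k + k) * (q * s) ^+ 2 = q * (q * (t ^+ (k + k) * s ^+ 2)) by ring.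
have -> : t ^+ k * (q * s) ^+ 2 = q * (q * (t ^+ k * s ^+ 2)) by ring.
have w1 : 1 - q * (t ^+ k * s ^+ 2) != 0 by have := one_minus_s_neq0 1 k ind.
have w2 : 1 - t ^+ k * s ^+ 2 != 0.
  by have := one_minus_s_neq0 0 k ind; rewrite mul1r.
have w3 : 1 - q * (t ^+ (k + k) * s ^+ 2) != 0 by have := one_minus_s_neq0 1 (k + k) ind.
have w4 : 1 - t ^+ (k + k) * s ^+ 2 != 0.
  by have := one_minus_s_neq0 0 (k + k) ind; rewrite mul1r.
have w5 : 1 - q ^+ l * (q * (t ^+ k * s ^+ 2)) != 0.
  by have := one_minus_s_neq0 l.+1 k ind; rewrite exprSr -mulrA.
have X0 : qpoch q (q * (t ^+ k * s ^+ 2)) l != 0.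
  by have := qpoch_s_neq0 1 k l ind.
have -> : qpoch q (q * (q * (t ^+ k * s ^+ 2))) l =
    qpoch q (q * (t ^+ k * s ^+ 2)) l * (1 - q ^+ l * (q * (t ^+ k * s ^+ 2))) /
    (1 - q * (t ^+ k * s ^+ 2)).
  by apply: (canRL (mulfK w1)); rewrite mulrC -qpochS qpochSr.
have zs0 : 1 - (z * s)^-1 = - (1 - q ^+ l * (q * (t ^+ k * s ^+ 2))) / (z * s).
  by rewrite zE exprSr; field; rewrite ?expf_neq0 // ?q0 ?t0 ?s0.
have zs1 : z - s = - (1 - q ^+ l * (q * t ^+ k)) * s by rewrite zE exprSr; ring.
rewrite zs0 zs1 /h; move: (_^-1 ^+ l) (qpoch q (q * t ^+ k) l) (qpoch q _ (l + l)) X0 => x1 x2 x3.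
move: w1 w2 w3 w4 w5 z0; move: (qpoch q _ l).
move: (1 - q ^+ l * (q * (t ^+ k * s ^+ 2))) (1 - q * (t ^+ k * s ^+ 2)) (1 - t ^+ k * s ^+ 2)
  (1 - q * (t ^+ (k + k) * s ^+ 2)) (1 - t ^+ (k + k) * s ^+ 2) (1 - q ^+ l * (q * t ^+ k)) z zE zs0 zs1.
move=> y1 y2 y3 y4 y5 y6 z _ _ _ x4 y20 y30 y40 y50 y10 z0 x40.
by field; rewrite y20 y30 y40 y50 y10 z0 x40 s0.
Qed.

Lemma interp_at_diag q t s n (la : part n) : [pchar K] =i pred0 -> independent q t s ->
  interp_at q t la la s = diag_value q t s la.
Proof.
move=> char0; elim/part_peel_ind: n / la s => [la|n la IH|n la IH] s ind.
- rewrite /diag_value /pair_prod !big_ord0 mul1r.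
  rewrite (interp_atE char0 (F := orbit_sum la) _ ind) ?orbit_sum0 //.
  split=> [|mu]; first exact: lead_orbit_sum.
  by rewrite (part0_eq mu la) /strictly_dominated eqxx andbF.
- rewrite interp_at_pad // IH ?diag_value_pad //.
  exact: independent_mult.
rewrite interp_at_add_column // IH ?diag_value_add_column //.
exact: independent_mulq.
Qed.

End ProductFormulas.

Section NormFormula.
Variable K : fieldType.
Implicit Types q t s c x : K.

Lemma conj_partE n (la : part n) j : conj_part la j = (\sum_(i < n) (j < la i))%N.
Proof. by rewrite /conj_part cardsE -sum1_card big_mkcond. Qed.

Lemma conj_part_pad n (la : part n) j : conj_part (pad la) j = conj_part la j.
Proof.
rewrite !conj_partE big_ord_recr /= pad_max addn0; apply: eq_bigr => i _.
by rewrite widen_ord_max pad_lift.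
Qed.

Lemma conj_part_add_column0 n (la : part n) : conj_part (add_column la) 0 = n.
Proof.
rewrite conj_partE (eq_bigr (fun=> 1%N)) ?sum_nat_const ?card_ord ?muln1 // => i _.
by rewrite add_columnE.
Qed.

Lemma conj_part_add_columnS n (la : part n) j :
  conj_part (add_column la) j.+1 = conj_part la j.
Proof. by rewrite !conj_partE; apply: eq_bigr => i _; rewrite add_columnE ltnS. Qed.

Lemma Cminus_pad q t n (la : part n) x : Cminus q t (pad la) x = Cminus q t la x.
Proof.
rewrite /Cminus big_ord_recr /= pad_max [X in _ * X]big_ord0 mulr1; apply: eq_bigr => i _.
rewrite widen_ord_max pad_lift; apply: eq_bigr => j _.
by rewrite conj_part_pad.
Qed.

Lemma Cminus_add_column q t n (la : part n) x : Cminus q t (add_column la) x =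
  \prod_(i < n) (1 - q ^+ la i * t ^+ (n - i.+1) * x) * Cminus q t la x.
Proof.
rewrite -big_split; apply: eq_bigr => i _; rewrite add_columnE big_ord_recl /= subSS subn0.
rewrite conj_part_add_column0; congr (_ * _); apply: eq_bigr => j _.
by rewrite /bump /= add1n conj_part_add_columnS subSS.
Qed.

Definition Cminus_pair q t x n (la : part n) (i j : 'I_n) : K :=
  qpoch q (t ^+ (j - i.+1) * x) (la i - la j) / qpoch q (t ^+ (j - i) * x) (la i - la j).

(** Within row [i] the boxes with the same leg form an interval, delimited by the
    parts of two consecutive rows; this leaves a factor for every pair of rows. *)
Lemma CminusE q t x n (la : part n) :
  (forall m k, (0 < m)%N -> qpoch q (t ^+ m * x) k != 0) ->
  Cminus q t la x = \prod_(i < n) qpoch q (t ^+ (n - i.+1) * x) (la i) *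
                    pair_prod (Cminus_pair q t x la).
Proof.
move=> nz; elim/part_peel_ind: n / la => [la|n la IH|n la IH].
- by rewrite /Cminus /pair_prod !big_ord0 mul1r.
- rewrite Cminus_pad IH pair_prod_recr big_ord_recr /= pad_max qpoch0 mulr1.
  rewrite [X in _ = _ * X]mulrC [RHS]mulrA; congr (_ * _); last first.
    by apply: eq_pair_prod => i j ij; rewrite /Cminus_pair !pad_lift !lift_max.
  rewrite -big_split; apply: eq_bigr => i _.
  rewrite widen_ord_max /= /Cminus_pair !pad_lift pad_max subn0 !lift_max /= subSS.
  by rewrite [RHS]mulrC divfK // nz // subn_gt0.
rewrite Cminus_add_column IH [LHS]mulrA; congr (_ * _); last first.
  by apply: eq_pair_prod => i j ij; rewrite /Cminus_pair !add_columnE subSS.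
rewrite -big_split; apply: eq_bigr => i _ /=.
by rewrite add_columnE qpochSr mulrC mulrA.
Qed.

Definition norm_pair q t n (la : part n) (i j : 'I_n) : K :=
  Cminus_pair q t q la i j / Cminus_pair q t t la i j.

(** The factors [C0] cancel those of the single rows in [CminusE]. *)
Lemma norm2E q t s n (la : part n) : independent q t s ->
  norm2 q t la = pair_prod (norm_pair q t la).
Proof.
move=> ind; have [q0 t0 s0 _] := ind.
have nzq m k : qpoch q (t ^+ m * q) k != 0 by rewrite mulrC; apply: qpoch_qt_neq0 ind.
have nzt m k : qpoch q (t ^+ m * t) k != 0 by rewrite -exprSr; apply: qpoch_t_neq0 ind _.
rewrite /norm2 !CminusE //.
have -> : C0 q t la (t ^+ n) = \prod_(i < n) qpoch q (t ^+ (n - i.+1) * t) (la i).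
  apply: eq_bigr => i _; apply: eq_bigr => j _; congr (1 - _); rewrite -mulrA; congr (_ * _).
  rewrite -exprSr -subSn // subSS -[X in _ * t ^+ X = _](subnK (ltnW (ltn_ord i))).
  by rewrite exprD mulrC mulfK ?expf_neq0.
have -> : C0 q t la (q * t ^ (n%:Z - 1)) = \prod_(i < n) qpoch q (t ^+ (n - i.+1) * q) (la i).
  apply: eq_bigr => i _; apply: eq_bigr => j _; congr (1 - _); rewrite -mulrA; congr (_ * _).
  have -> : n%:Z - 1 = (n - i.+1)%N%:Z + i%:Z by have := ltn_ord i; lia.
  by rewrite expfzDr // -!exprnP; field; rewrite ?expf_neq0.
have nzP (x : K) : (forall m k, qpoch q (t ^+ m * x) k != 0) ->
    \prod_(i < n) qpoch q (t ^+ (n - i.+1) * x) (la i) != 0.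
  by move=> nz; apply/prodf_neq0.
have pairE : pair_prod (norm_pair q t la) * pair_prod (Cminus_pair q t t la) =
    pair_prod (Cminus_pair q t q la).
  rewrite -pair_prodM; apply: eq_pair_prod => i j ij; rewrite divfK //.
  by rewrite mulf_neq0 ?invr_eq0.
have nz2 : pair_prod (Cminus_pair q t t la) != 0.
  by apply/prodf_neq0 => i _; apply/prodf_neq0 => j _; rewrite mulf_neq0 ?invr_eq0.
apply: (mulIf nz2); rewrite pairE; move: (nzP q nzq) (nzP t nzt) nz2.
move: (pair_prod _) (pair_prod _) (\prod_i _) (\prod_i _) => a b c d c0 d0 b0.
by field; rewrite ?c0 ?d0 ?b0.
Qed.

End NormFormula.

(** * Detailed balance *)

Section Balance.
Variable K : fieldType.
Implicit Types p q t r s b c u v : K.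

(** The factor of row [i] in [diag_value] when [T = t ^+ (n - i.+1)]. *)
Definition sfactor q T s l : K :=
  (q ^+ l * T * s)^-1 ^+ l * qpoch q (q * T) l * qpoch q (T * T * s ^+ 2) (l + l) /
  qpoch q (T * s ^+ 2) l.

Definition skernel r b (y : K) := (1 - r * y) * (1 - b * y) / (1 - y ^+ 2).

Definition sconst T U r rho : K :=
  (1 - T * r ^+ 2) * (1 - U * U * rho ^+ 2) / ((1 - T * T * r ^+ 2) * (1 - U * rho ^+ 2)).

Lemma qpoch_shift q c k : 1 - c != 0 ->
  qpoch q (q * c) k = qpoch q c k * (1 - q ^+ k * c) / (1 - c).
Proof. by move=> c1; apply: (canRL (mulfK c1)); rewrite mulrC -qpochS qpochSr. Qed.

(** ** One row *)

Section Single.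
Variables (p T U r b rho : K) (l k : nat).
Let q := p ^+ 2.
Let x := q ^+ l * T * r.
Hypotheses (p0 : p != 0) (T0 : T != 0) (U0 : U != 0) (r0 : r != 0) (b0 : b != 0).
Hypotheses (a1 : 1 - T * T * r ^+ 2 != 0) (c1 : 1 - T * r ^+ 2 != 0).

(** Here [T = t ^+ (n - i.+1)] and [U = t ^+ i] for row [i], [l] is the part of [nu]
    and [k] that of the complement of [mu].  In this lemma the row is the same in
    [mu] and [nu], and in the next one it is longer by a box in [mu].  The factors of
    the kernel that depend on [b] cancel up to a monomial, because [1 - b * x] and
    [1 - p / b * (p * x)^-1] have the same zero. *)
Lemma single_balance0 : rho = (q ^+ (l + k) * T * U * (p * r))^-1 ->
  1 - U * U * rho ^+ 2 != 0 -> 1 - U * rho ^+ 2 != 0 ->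
  1 - x ^+ 2 != 0 -> 1 - (p * x)^-1 ^+ 2 != 0 -> 1 - r * x != 0 ->
  1 - rho * (p * x)^-1 != 0 ->
  qpoch q (T * r ^+ 2) l != 0 -> qpoch q (U * rho ^+ 2) k != 0 ->
  skernel r b x * (sfactor q T (p * r) l * sfactor q U rho k) =
  - (p ^+ (l + k) * sconst T U r rho * b * r * T) *
  (skernel rho (p / b) (p * x)^-1 * (sfactor q T r l * sfactor q U (p * rho) k)).
Proof.
move=> rhoE d1 f1 x1 x2 rx rhox nz1 nz2.
have Pl0 : p ^+ l != 0 by rewrite expf_neq0.
have Pk0 : p ^+ k != 0 by rewrite expf_neq0.
have qE j : q ^+ j = p ^+ j ^+ 2 by rewrite /q -!exprM mulnC.
have x0 : x != 0 by rewrite !mulf_neq0 // qE expf_neq0.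
have rho0 : rho != 0 by rewrite rhoE invr_eq0 !mulf_neq0 // qE expf_neq0 // expf_neq0.
have n1 : q ^+ l * T * (p * r) = p * x by rewrite /x; ring.
have n2 : q ^+ k * U * rho = (p * x)^-1.
  rewrite rhoE /x !qE !exprD; field.
  by rewrite ?p0 ?T0 ?U0 ?r0 ?Pl0 ?Pk0.
have n3 : q ^+ k * U * (p * rho) = x^-1.
  by rewrite mulrCA n2; field; rewrite ?p0 ?x0.
rewrite /sfactor n1 n2 n3 -/x.
have -> : T * T * (p * r) ^+ 2 = q * (T * T * r ^+ 2) by rewrite /q; ring.
have -> : T * (p * r) ^+ 2 = q * (T * r ^+ 2) by rewrite /q; ring.
have -> : U * U * (p * rho) ^+ 2 = q * (U * U * rho ^+ 2) by rewrite /q; ring.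
have -> : U * (p * rho) ^+ 2 = q * (U * rho ^+ 2) by rewrite /q; ring.
rewrite (qpoch_shift _ _ a1) (qpoch_shift _ _ c1) (qpoch_shift _ _ d1) (qpoch_shift _ _ f1).
have -> : q ^+ (l + l) * (T * T * r ^+ 2) = x ^+ 2 by rewrite /x exprD; ring.
have -> : q ^+ l * (T * r ^+ 2) = r * x by rewrite /x; ring.
have -> : q ^+ (k + k) * (U * U * rho ^+ 2) = (p * x)^-1 ^+ 2 by rewrite -n2 exprD; ring.
have -> : q ^+ k * (U * rho ^+ 2) = rho * (p * x)^-1 by rewrite -n2; ring.
rewrite /skernel /sconst.
have -> : 1 - b * x = - (b * x) * (1 - p / b * (p * x)^-1).
  by field; rewrite ?b0 ?p0 ?x0.
have -> : - (p ^+ (l + k) * ((1 - T * r ^+ 2) * (1 - U * U * rho ^+ 2) /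
    ((1 - T * T * r ^+ 2) * (1 - U * rho ^+ 2))) * b * r * T) =
  - (p ^+ k / p ^+ l * ((1 - T * r ^+ 2) * (1 - U * U * rho ^+ 2) /
    ((1 - T * T * r ^+ 2) * (1 - U * rho ^+ 2))) * b * x).
  by rewrite /x qE exprD; field; rewrite ?Pl0 ?a1 ?f1.
rewrite !invrK; have -> : (p * x)^-1 ^+ l = (p ^+ l)^-1 * x^-1 ^+ l.
  by rewrite invfM exprMn !exprVn.
have -> : (p * x) ^+ k = p ^+ k * x ^+ k by rewrite exprMn.
move: a1 c1 d1 f1 x1 x2 rx rhox nz1 nz2 Pl0 Pk0 x0 (expf_neq0 k x0).
move: (x^-1 ^+ l) (x ^+ k) => X Y.
move: (1 - T * r ^+ 2) (1 - U * U * rho ^+ 2) (1 - T * T * r ^+ 2) (1 - U * rho ^+ 2)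
  (1 - x ^+ 2) (1 - (p * x)^-1 ^+ 2) (1 - r * x) (1 - rho * (p * x)^-1).
move=> y1 y2 y3 y4 y5 y6 y7 y8.
move: (qpoch q (T * r ^+ 2) l) (qpoch q (U * rho ^+ 2) k) (qpoch q (q * T) l)
  (qpoch q (T * T * r ^+ 2) (l + l)) (qpoch q (q * U) k)
  (qpoch q (U * U * rho ^+ 2) (k + k)) (1 - p / b * (p * x)^-1) (p ^+ l) (p ^+ k).
move=> y9 y10 y11 y12 y13 y14 y15 Pl Pk; move: x => z.
move=> h1 h2 h3 h4 h5 h6 h7 h8 h9 h10 h11 h12 h13 h14.
by field; rewrite ?h1 ?h2 ?h3 ?h4 ?h5 ?h6 ?h7 ?h8 ?h9 ?h10 ?h11 ?h12 ?h13 ?h14.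
Qed.

Lemma single_balance1 : rho = (q ^+ (l.+1 + k) * T * U * (p * r))^-1 ->
  1 - U * U * rho ^+ 2 != 0 -> 1 - U * rho ^+ 2 != 0 ->
  let x := q ^+ l.+1 * T * r in
  1 - x^-1 ^+ 2 != 0 -> 1 - (x / p) ^+ 2 != 0 -> 1 - rho * (x / p) != 0 ->
  qpoch q (q * (T * r ^+ 2)) l != 0 -> qpoch q (q * (U * rho ^+ 2)) k != 0 ->
  skernel r b x^-1 * (sfactor q T (p * r) l * sfactor q U rho k.+1) =
  - (p ^+ (l.+1 + k) * sconst T U r rho * b * r * U) *
  (skernel rho (p / b) (x / p) * (sfactor q T r l.+1 * sfactor q U (p * rho) k)).
Proof.
move=> rhoE d1 f1 z z1 z2 rhoz nz1 nz2.
have Pl0 : p ^+ l != 0 by rewrite expf_neq0.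
have Pk0 : p ^+ k != 0 by rewrite expf_neq0.
have qE j : q ^+ j = p ^+ j ^+ 2 by rewrite /q -!exprM mulnC.
have zE : z = q * q ^+ l * T * r by rewrite /z exprS.
have z0 : z != 0 by rewrite !mulf_neq0 // qE expf_neq0 // expf_neq0.
have q0 : q != 0 by rewrite /q expf_neq0.
have n1 : q ^+ l * T * (p * r) = z / p by rewrite zE /q; field.
have n2 : q ^+ k.+1 * U * rho = (z / p)^-1.
  rewrite rhoE zE !qE addSn !exprS !exprD /q; field.
  by rewrite ?p0 ?T0 ?U0 ?r0 ?Pl0 ?Pk0.
have n3 : q ^+ k * U * (p * rho) = z^-1.
  have -> : q ^+ k * U * (p * rho) = q ^+ k.+1 * U * rho / p.
    by rewrite exprS /q; field.
  by rewrite n2; field; rewrite ?p0 ?z0.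
rewrite /sfactor n1 n2 n3 -/z.
have -> : T * T * (p * r) ^+ 2 = q * (T * T * r ^+ 2) by rewrite /q; ring.
have -> : T * (p * r) ^+ 2 = q * (T * r ^+ 2) by rewrite /q; ring.
have -> : U * U * (p * rho) ^+ 2 = q * (U * U * rho ^+ 2) by rewrite /q; ring.
have -> : U * (p * rho) ^+ 2 = q * (U * rho ^+ 2) by rewrite /q; ring.
rewrite !addSn !addnS (qpochSr _ (q * T)) (qpochSr _ (q * U)).
rewrite (qpochS _ (T * T * r ^+ 2)) (qpochS _ (T * r ^+ 2)) (qpochS _ (U * U * rho ^+ 2))
  (qpochS _ (U * rho ^+ 2)) (qpochSr _ (q * (T * T * r ^+ 2))) (qpochSr _ (q * (U * U * rho ^+ 2))).
have -> : q ^+ (l + l) * (q * (T * T * r ^+ 2)) = (z / p) ^+ 2.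
  by rewrite zE exprD /q; field.
have -> : q ^+ (k + k) * (q * (U * U * rho ^+ 2)) = z^-1 ^+ 2 by rewrite -n3 exprD /q; ring.
rewrite /skernel /sconst.
have -> : 1 - r * z^-1 = - (1 - q ^+ l * (q * T)) * (r / z).
  rewrite zE; field; rewrite ?p0 ?q0 ?T0 ?r0 //.
  by rewrite expf_neq0.
have -> : 1 - b * z^-1 = - (b / z) * (1 - p / b * (z / p)).
  by field; rewrite ?b0 ?p0 ?z0.
have rz : rho * (z / p) = (q ^+ k.+1 * U)^-1.
  have rho0 : rho != 0 by rewrite rhoE invr_eq0 !mulf_neq0 // expf_neq0.
  rewrite -[z / p]invrK -n2 !invfM; field.
  by rewrite ?U0 ?rho0 ?expf_neq0.
have -> : 1 - q ^+ k * (q * U) = - (1 - rho * (z / p)) * (q ^+ k.+1 * U).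
  by rewrite rz exprS; field; rewrite ?U0 ?q0 ?expf_neq0.
have -> : (z^-1 ^+ l.+1) = z^-1 * z^-1 ^+ l by rewrite exprS.
rewrite !invrK; have -> : (z / p)^-1 ^+ l = p ^+ l * z^-1 ^+ l.
  by rewrite invfM invrK mulrC exprMn.
have -> : (z / p) ^+ k.+1 = z / p * (z ^+ k / p ^+ k) by rewrite exprS exprMn exprVn.
have -> : - (p ^+ (l.+1 + k) * ((1 - T * r ^+ 2) * (1 - U * U * rho ^+ 2) /
    ((1 - T * T * r ^+ 2) * (1 - U * rho ^+ 2))) * b * r * U) =
  - (p ^+ l / p / p ^+ k * ((1 - T * r ^+ 2) * (1 - U * U * rho ^+ 2) /
    ((1 - T * T * r ^+ 2) * (1 - U * rho ^+ 2))) * b * r * (q ^+ k.+1 * U)).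
  rewrite qE addSn !exprS exprD; field; by rewrite ?Pl0 ?Pk0 ?p0 ?a1 ?f1.
have qU0 : q ^+ k.+1 * U != 0 by rewrite mulf_neq0 // expf_neq0.
move: a1 c1 d1 f1 z1 z2 rhoz nz1 nz2 Pl0 Pk0 z0 qU0.
move: (z^-1 ^+ l) (z ^+ k) => X Y.
move: (1 - T * r ^+ 2) (1 - U * U * rho ^+ 2) (1 - T * T * r ^+ 2) (1 - U * rho ^+ 2)
  (1 - z^-1 ^+ 2) (1 - (z / p) ^+ 2) (1 - rho * (z / p)).
move=> y1 y2 y3 y4 y5 y6 y7.
move: (qpoch q (q * (T * r ^+ 2)) l) (qpoch q (q * (U * rho ^+ 2)) k) (qpoch q (q * T) l)
  (qpoch q (q * (T * T * r ^+ 2)) _) (qpoch q (q * U) k)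
  (qpoch q (q * (U * U * rho ^+ 2)) _) (1 - p / b * (z / p)) (1 - q ^+ l * (q * T))
  (p ^+ l) (p ^+ k) (q ^+ k.+1 * U).
move=> y8 y9 y10 y11 y12 y13 y14 y15 Pl Pk V; clear zE n1 n2 n3 rz; move: z => z'.
move=> h1 h2 h3 h4 h5 h6 h7 h8 h9 h10 h11 h12 h13.
by field; rewrite ?h1 ?h2 ?h3 ?h4 ?h5 ?h6 ?h7 ?h8 ?h9 ?h10 ?h11 ?h12 ?h13 ?p0.
Qed.

End Single.

Definition npair q t d m : K :=
  qpoch q (t ^+ d * q) m / qpoch q (t ^+ d.+1 * q) m /
  (qpoch q (t ^+ d * t) m / qpoch q (t ^+ d.+1 * t) m).

Definition dpair q t d u m (c : nat) : K :=
  qpoch q (q * t ^+ d) m / qpoch q (q * t ^+ d.+1) m * (qpoch q u c / qpoch q (t * u) c).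

Definition pkernel t (Y : K) := (1 - t * Y) / (1 - Y).

Definition pconst t u v : K := (1 - t * u) * (1 - v) / ((1 - u) * (1 - t * v)).

(** ** Two rows *)

Section Pair.
Variables (q t u v : K) (d : nat).
Hypotheses (q0 : q != 0) (t0 : t != 0) (u0 : u != 0).
Hypotheses (u1 : 1 - u != 0) (tu1 : 1 - t * u != 0) (v1 : 1 - v != 0) (tv1 : 1 - t * v != 0).
Hypothesis nzq : forall e m, qpoch q (q * t ^+ e) m != 0.
Hypothesis nzt : forall e m, qpoch q (t ^+ e.+1) m != 0.
Hypotheses (nzu : forall j, qpoch q u j != 0) (nztu : forall j, qpoch q (t * u) j != 0).
Hypotheses (nzv : forall j, qpoch q v j != 0) (nztv : forall j, qpoch q (t * v) j != 0).

Lemma one_minus_neq0 w e : (forall j, qpoch q w j != 0) -> 1 - q ^+ e * w != 0.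
Proof. by move/(_ e.+1); rewrite qpochSr mulf_eq0 negb_or => /andP[]. Qed.

Let nzS w : (forall j, qpoch q w j != 0) -> 1 - w != 0 -> forall j, qpoch q (q * w) j != 0.
Proof. by move=> nz w1 j; have := nz j.+1; rewrite qpochS mulf_eq0 negb_or => /andP[]. Qed.

(** The two digits tell whether a box is removed from the upper and from the lower
    row; [m] is the smaller of the differences of the two parts in [mu] and [nu]. *)
Lemma pair_balance00 m (c : nat) k : v = (q ^+ (c + k).+1 * u)^-1 ->
  npair q t d m * pkernel t (q ^+ c * u) * (dpair q t d (q * u) m c * dpair q t d v m k) =
  pconst t u v * (npair q t d m * pkernel t (q * (q ^+ c * u))^-1 *
                  (dpair q t d u m c * dpair q t d (q * v) m k)).
Proof.
move=> vE; rewrite /dpair /pkernel /pconst.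
have -> : (q * (q ^+ c * u))^-1 = q ^+ k * v.
  by rewrite vE exprS exprD; field; rewrite ?q0 ?u0 ?expf_neq0.
rewrite ![t * (q * _)]mulrCA ![t * (q ^+ _ * _)]mulrCA.
rewrite (qpoch_shift _ _ u1) (qpoch_shift _ _ tu1) (qpoch_shift _ _ v1) (qpoch_shift _ _ tv1).
have := one_minus_neq0 c nzu; have := one_minus_neq0 c nztu.
have := one_minus_neq0 k nzv; have := one_minus_neq0 k nztv.
move: u1 tu1 v1 tv1 (nzu c) (nztu c) (nzv k) (nztv k).
move: (npair _ _ _ _) (qpoch q (q * t ^+ d) m / _) => x1 x2.
move: (1 - q ^+ c * (t * u)) (1 - q ^+ c * u) (1 - q ^+ k * (t * v)) (1 - q ^+ k * v)
  (1 - t * u) (1 - u) (1 - t * v) (1 - v) (qpoch q u c) (qpoch q (t * u) c)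
  (qpoch q v k) (qpoch q (t * v) k).
move=> y1 y2 y3 y4 y5 y6 y7 y8 z1 z2 z3 z4 h1 h2 h3 h4 h5 h6 h7 h8 h9 h10 h11 h12.
by field; rewrite ?h1 ?h2 ?h3 ?h4 ?h5 ?h6 ?h7 ?h8 ?h9 ?h10 ?h11 ?h12.
Qed.

Lemma pair_balance11 m (c : nat) k : v = (q ^+ (c.+2 + k).+1 * u)^-1 ->
  npair q t d m * pkernel t (q ^+ c.+2 * u)^-1 *
    (dpair q t d (q * u) m c * dpair q t d v m k.+2) =
  pconst t u v * (npair q t d m * pkernel t (q ^+ c.+1 * u) *
                  (dpair q t d u m c.+2 * dpair q t d (q * v) m k)).
Proof.
move=> vE; rewrite /dpair /pkernel /pconst.
have -> : (q ^+ c.+2 * u)^-1 = q ^+ k * (q * v).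
  by rewrite vE !addSn !exprS exprD; field; rewrite ?q0 ?u0 ?expf_neq0.
rewrite ![t * (q ^+ _ * _)]mulrCA ![t * (q * _)]mulrCA.
have e1 w : q ^+ c.+1 * w = q ^+ c * (q * w) by rewrite exprS; ring.
rewrite !e1 !(qpochS q _ c.+1) !(qpochS q _ k.+1) !qpochSr.
have nzu' := nzS nzu u1; have nztu' := nzS nztu tu1.
have nzv' := nzS nzv v1; have nztv' := nzS nztv tv1.
have := one_minus_neq0 c nzu'; have := one_minus_neq0 c nztu'.
have := one_minus_neq0 k nzv'; have := one_minus_neq0 k nztv'.
move: u1 tu1 v1 tv1 (nzu' c) (nztu' c) (nzv' k) (nztv' k).
move: (npair _ _ _ _) (qpoch q (q * t ^+ d) m / _) => x1 x2.
move: (1 - q ^+ c * (q * (t * u))) (1 - q ^+ c * (q * u)) (1 - q ^+ k * (q * (t * v)))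
  (1 - q ^+ k * (q * v)) (1 - t * u) (1 - u) (1 - t * v) (1 - v) (qpoch q (q * u) c)
  (qpoch q (q * (t * u)) c) (qpoch q (q * v) k) (qpoch q (q * (t * v)) k).
move=> y1 y2 y3 y4 y5 y6 y7 y8 z1 z2 z3 z4 h1 h2 h3 h4 h5 h6 h7 h8 h9 h10 h11 h12.
by field; rewrite ?h1 ?h2 ?h3 ?h4 ?h5 ?h6 ?h7 ?h8 ?h9 ?h10 ?h11 ?h12.
Qed.

Let pkernelV m : pkernel t (q * (q ^+ m * t ^+ d.+1))^-1 =
  t * (1 - q * (q ^+ m * t ^+ d)) / (1 - q * (q ^+ m * t ^+ d.+1)).
Proof.
have Y2 : 1 - q * (q ^+ m * t ^+ d.+1) != 0 by rewrite mulrCA one_minus_neq0.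
have Y3 : 1 - q * (q ^+ m * t ^+ d) != 0 by rewrite mulrCA one_minus_neq0.
have h1 : 1 - (q * (q ^+ m * t ^+ d.+1))^-1 =
    - (1 - q * (q ^+ m * t ^+ d.+1)) / (q * (q ^+ m * t ^+ d.+1)).
  by field; rewrite ?q0 ?expf_neq0.
have h2 : 1 - t * (q * (q ^+ m * t ^+ d.+1))^-1 =
    - (1 - q * (q ^+ m * t ^+ d)) / (q * (q ^+ m * t ^+ d)).
  by rewrite exprS; field; rewrite ?t0 ?q0 ?expf_neq0.
rewrite /pkernel h1 h2; move: Y2 Y3; move: (1 - _) (1 - _) => a b a0 b0.
by rewrite exprS; field; rewrite ?oppr_eq0 ?t0 ?q0 ?b0 ?a0 ?expf_neq0.
Qed.

Lemma pair_balance01 m (c : nat) k :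
  npair q t d m * pkernel t (q ^+ m * t ^+ d.+1) *
    (dpair q t d (q * u) m.+1 c * dpair q t d v m.+1 k.+1) =
  pconst t u v / t * (npair q t d m.+1 * pkernel t (q * (q ^+ m * t ^+ d.+1))^-1 *
                  (dpair q t d u m c.+1 * dpair q t d (q * v) m k)).
Proof.
rewrite /npair /dpair /pkernel /pconst.
rewrite ![t * (q * _)]mulrCA ![t ^+ _ * q]mulrC -!exprSr ![t * (q ^+ _ * _)]mulrCA -exprS.
rewrite (qpochSr q (q * t ^+ d)) (qpochSr q (q * t ^+ d.+1)) (qpochSr q (t ^+ d.+1))
  (qpochSr q (t ^+ d.+2)) (qpochS q u) (qpochS q (t * u)) (qpochS q v) (qpochS q (t * v)).
have e w : q ^+ m * (q * w) = q * (q ^+ m * w) by rewrite mulrCA.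
rewrite !e; have Y0 : q ^+ m * t ^+ d.+1 != 0 by rewrite mulf_neq0 // expf_neq0.
have Y0' : q ^+ m * t ^+ d != 0 by rewrite mulf_neq0 // expf_neq0.
have Y1 : 1 - q ^+ m * t ^+ d.+1 != 0 := one_minus_neq0 m (nzt d).
have Y2 : 1 - q * (q ^+ m * t ^+ d.+1) != 0 by rewrite -e; apply: one_minus_neq0.
have Y3 : 1 - q * (q ^+ m * t ^+ d) != 0 by rewrite -e; apply: one_minus_neq0.
have Y4 : 1 - q ^+ m * t ^+ d.+2 != 0 := one_minus_neq0 m (nzt d.+1).
rewrite -/(pkernel _ (_^-1)) pkernelV.
move: u1 tu1 v1 tv1 (nzS nzu u1 c) (nzS nztu tu1 c) (nzS nzv v1 k) (nzS nztv tv1 k).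
move: (nzq d m) (nzq d.+1 m) (nzt d m) (nzt d.+1 m) Y1 Y2 Y3 Y4.
move: (1 - q * (q ^+ m * t ^+ d)) (1 - q * (q ^+ m * t ^+ d.+1)) (1 - q ^+ m * t ^+ d.+1)
  (1 - q ^+ m * t ^+ d.+2) (1 - t * u) (1 - u) (1 - t * v) (1 - v).
move=> y1 y2 y3 y4 y5 y6 y7 y8.
move: (qpoch q (q * t ^+ d) m) (qpoch q (q * t ^+ d.+1) m) (qpoch q (t ^+ d.+1) m)
  (qpoch q (t ^+ d.+2) m) (qpoch q (q * u) c) (qpoch q (q * (t * u)) c) (qpoch q (q * v) k)
  (qpoch q (q * (t * v)) k).
move=> z1 z2 z3 z4 z5 z6 z7 z8 h1 h2 h3 h4 h5 h6 h7 h8 h9 h10 h11 h12 h13 h14 h15 h16.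
by field; rewrite ?h1 ?h2 ?h3 ?h4 ?h5 ?h6 ?h7 ?h8 ?h9 ?h10 ?h11 ?h12 ?h13 ?h14 ?h15 ?h16 ?t0.
Qed.

Lemma pair_balance10 m (c : nat) k :
  npair q t d m.+1 * pkernel t (q ^+ m.+1 * t ^+ d.+1)^-1 *
    (dpair q t d (q * u) m c * dpair q t d v m k.+1) =
  pconst t u v * t * (npair q t d m * pkernel t (q ^+ m * t ^+ d.+1) *
                  (dpair q t d u m.+1 c.+1 * dpair q t d (q * v) m.+1 k)).
Proof.
rewrite /npair /dpair /pkernel /pconst.
rewrite ![t * (q * _)]mulrCA ![t ^+ _ * q]mulrC -!exprSr ![t * (q ^+ _ * _)]mulrCA -exprS.
rewrite (qpochSr q (q * t ^+ d)) (qpochSr q (q * t ^+ d.+1)) (qpochSr q (t ^+ d.+1))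
  (qpochSr q (t ^+ d.+2)) (qpochS q u) (qpochS q (t * u)) (qpochS q v) (qpochS q (t * v)).
have e w : q ^+ m * (q * w) = q * (q ^+ m * w) by rewrite mulrCA.
have e' w : q ^+ m.+1 * w = q * (q ^+ m * w) by rewrite exprS mulrA.
rewrite !e e'; have Y1 : 1 - q ^+ m * t ^+ d.+1 != 0 := one_minus_neq0 m (nzt d).
have Y2 : 1 - q * (q ^+ m * t ^+ d.+1) != 0 by rewrite -e; apply: one_minus_neq0.
have Y3 : 1 - q * (q ^+ m * t ^+ d) != 0 by rewrite -e; apply: one_minus_neq0.
have Y4 : 1 - q ^+ m * t ^+ d.+2 != 0 := one_minus_neq0 m (nzt d.+1).
rewrite -/(pkernel _ (_^-1)) pkernelV.
move: u1 tu1 v1 tv1 (nzS nzu u1 c) (nzS nztu tu1 c) (nzS nzv v1 k) (nzS nztv tv1 k).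
move: (nzq d m) (nzq d.+1 m) (nzt d m) (nzt d.+1 m) Y1 Y2 Y3 Y4.
move: (1 - q * (q ^+ m * t ^+ d)) (1 - q * (q ^+ m * t ^+ d.+1)) (1 - q ^+ m * t ^+ d.+1)
  (1 - q ^+ m * t ^+ d.+2) (1 - t * u) (1 - u) (1 - t * v) (1 - v).
move=> y1 y2 y3 y4 y5 y6 y7 y8.
move: (qpoch q (q * t ^+ d) m) (qpoch q (q * t ^+ d.+1) m) (qpoch q (t ^+ d.+1) m)
  (qpoch q (t ^+ d.+2) m) (qpoch q (q * u) c) (qpoch q (q * (t * u)) c) (qpoch q (q * v) k)
  (qpoch q (q * (t * v)) k).
move=> z1 z2 z3 z4 z5 z6 z7 z8 h1 h2 h3 h4 h5 h6 h7 h8 h9 h10 h11 h12 h13 h14 h15 h16.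
by field; rewrite ?h1 ?h2 ?h3 ?h4 ?h5 ?h6 ?h7 ?h8 ?h9 ?h10 ?h11 ?h12 ?h13 ?h14 ?h15 ?h16 ?t0.
Qed.

End Pair.

End Balance.

(** ** The complementary nodes *)

Section ExplicitWeights.
Variable K : fieldType.
Implicit Types p q t r s b : K.

Lemma pair_prod_rev n (g : 'I_n -> 'I_n -> K) :
  pair_prod g = pair_prod (fun i j => g (rev_ord j) (rev_ord i)).
Proof.
rewrite /pair_prod !pair_big_dep /=.
rewrite (reindex_inj (h := fun u : 'I_n * 'I_n => (rev_ord u.2, rev_ord u.1))) /=; last first.
  move=> [i j] [i' j'] /= e; congr pair; apply: rev_ord_inj.
    exact: (congr1 snd e).
  exact: (congr1 fst e).
apply: eq_bigl => -[i j] /=; have := ltn_ord i; have := ltn_ord j.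
by move=> hj hi; apply/idP/idP; lia.
Qed.

Lemma prod_rev n (f : 'I_n -> K) : \prod_(i < n) f i = \prod_(i < n) f (rev_ord i).
Proof. by rewrite (reindex_inj rev_ord_inj). Qed.

Lemma count_smaller n (j : 'I_n) : (\sum_(i < n | (i < j)%N) 1 = j)%N.
Proof. by rewrite -(big_ord_widen _ (fun=> 1%N)) 1?ltnW // sum1_card card_ord. Qed.

Lemma pair_prod_left n (f : 'I_n -> K) :
  pair_prod (fun i _ => f i) = \prod_(i < n) f i ^+ (n - i.+1).
Proof. by apply: eq_bigr => i _; rewrite prodr_const -sum1_card count_larger. Qed.

Lemma pair_prod_right n (f : 'I_n -> K) :
  pair_prod (fun _ j => f j) = \prod_(j < n) f j ^+ j.
Proof.
rewrite /pair_prod (exchange_big_dep predT) //=; apply: eq_bigr => j _.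
by rewrite prodr_const -sum1_card count_smaller.
Qed.

Lemma kernelE n t r b (y : 'I_n -> K) :
  kernel t r b y = \prod_(i < n) skernel r b (y i) *
                   pair_prod (fun i j => pkernel t (y i * y j)).
Proof. by []. Qed.

Lemma diag_singleE q t s n (la : part n) i :
  diag_single q t s la i = sfactor q (t ^+ (n - i.+1)) s (la i).
Proof. by rewrite /diag_single /sfactor /node exprD. Qed.

Lemma diag_pairE q t s n (la : part n) (i j : 'I_n) : (i < j)%N ->
  diag_pair q t s la i j =
  dpair q t (j - i.+1) (t ^+ (n - i.+1 + (n - j.+1)) * s ^+ 2) (la i - la j) (la i + la j).
Proof.
move=> ij; rewrite /diag_pair /dpair.
have -> : (j - i = (j - i.+1).+1)%N by lia.
have -> : (n - i.+1 + (n - j) = (n - i.+1 + (n - j.+1)).+1)%N by have := ltn_ord j; lia.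
by have -> : t ^+ (n - i.+1 + (n - j.+1)).+1 * s ^+ 2 = t * (t ^+ (n - i.+1 + (n - j.+1)) * s ^+ 2)
  by rewrite exprS mulrA.
Qed.

Lemma complement_rev n m (mu : part n) i : complement m mu (rev_ord i) = (m - mu i)%N.
Proof. by rewrite ffunE rev_ordK. Qed.

Lemma rev_ord_height n (i : 'I_n) : (n - (rev_ord i).+1 = i)%N.
Proof. by rewrite /=; have := ltn_ord i; lia. Qed.

Lemma complement_single q t s n m (mu : part n) i :
  diag_single q t s (complement m mu) (rev_ord i) = sfactor q (t ^+ i) s (m - mu i).
Proof. by rewrite diag_singleE rev_ord_height complement_rev. Qed.

Lemma complement_pair q t s n m (mu : part n) (i j : 'I_n) :
  included mu (rect n m) -> (i < j)%N ->
  diag_pair q t s (complement m mu) (rev_ord j) (rev_ord i) =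
  dpair q t (j - i.+1) (t ^+ (j + i) * s ^+ 2) (mu i - mu j) (m - mu j + (m - mu i)).
Proof.
move=> /forallP mu_in ij; have := ltn_ord i; have := ltn_ord j => hj hi.
rewrite diag_pairE; last by rewrite /=; lia.
rewrite !rev_ord_height !complement_rev.
have := mu_in i; have := mu_in j; rewrite !ffunE => h1 h2.
have -> : (rev_ord i - (rev_ord j).+1 = j - i.+1)%N by rewrite /=; lia.
by have -> : (m - mu j - (m - mu i) = mu i - mu j)%N by have := part_leq mu (ltnW ij); lia.
Qed.

Lemma norm_pairE q t n (la : part n) (i j : 'I_n) : (i < j)%N ->
  norm_pair q t la i j = npair q t (j - i.+1) (la i - la j).
Proof.
move=> ij; rewrite /norm_pair /Cminus_pair /npair.
by have -> : (j - i = (j - i.+1).+1)%N by lia.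
Qed.

Lemma subn_gapS l m : (l < m)%N -> (m - l = (m - l.+1).+1)%N.
Proof. by lia. Qed.

Lemma height_split n i j : (i < j)%N -> (j < n)%N ->
  (n - i.+1 = (j - i.+1).+1 + (n - j.+1))%N.
Proof. by lia. Qed.

Lemma height_sum n i j : (i < n)%N -> (j < n)%N ->
  (n.-1 + n.-1 = n - i.+1 + (n - j.+1) + (j + i))%N.
Proof. by lia. Qed.

Lemma sum_complement m a c : (a <= m)%N -> (c <= m)%N -> (a + c + (m - c + (m - a)) = m + m)%N.
Proof. by lia. Qed.

Section FixedParameters.
Variables (p t r b : K) (n m : nat).
Hypotheses (ind : independent p t r) (b0 : b != 0).
Let q := p ^+ 2.

(** The parameter of the complementary nodes, whose coordinates are the inverses
    of those of the nodes of parameter [p * r]. *)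
Definition dual_param : K := (q ^+ m * t ^+ n.-1 * (p * r))^-1.
Let rho := dual_param.

Lemma dual_param_independent : independent p t rho.
Proof.
apply: independent_inv; have [p0 t0 r0 _] := ind.
have := independent_shift (m.*2.+1)%:Z (n.-1)%:Z ind; congr (independent _ _ _).
by rewrite /q -!exprnP -exprM -mul2n exprS; ring.
Qed.

Let p0 : p != 0. Proof. by case: ind. Qed.
Let t0 : t != 0. Proof. by case: ind. Qed.
Let r0 : r != 0. Proof. by case: ind. Qed.
Let rho0 : rho != 0. Proof. by case: dual_param_independent. Qed.
Let indr : independent q t r. Proof. exact: independent_sqr. Qed.
Let indpr : independent q t (p * r). Proof. exact/independent_sqr/independent_mulq. Qed.
Let indrho : independent q t rho. Proof. exact/independent_sqr/dual_param_independent. Qed.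
Let q0 : q != 0. Proof. by case: indr. Qed.

Lemma one_minus_neq0_s s a e : independent q t s -> 1 - q ^+ a * t ^+ e * s ^+ 2 != 0.
Proof. by move=> inds; rewrite -mulrA; apply: one_minus_s_neq0. Qed.

Lemma one_minus_neq0_s0 s e : independent q t s -> 1 - t ^+ e * s ^+ 2 != 0.
Proof. by move=> inds; have := one_minus_s_neq0 0 e inds; rewrite mul1r. Qed.

Lemma qpoch_neq0_s0 s e k : independent q t s -> qpoch q (t ^+ e * s ^+ 2) k != 0.
Proof. by move=> inds; have := qpoch_s_neq0 0 e k inds; rewrite mul1r. Qed.

Lemma dual_paramE l k a c : (l + k = m)%N -> (a + c = n.-1)%N ->
  rho = (q ^+ (l + k) * t ^+ a * t ^+ c * (p * r))^-1.
Proof. by move=> lk ac; rewrite lk /rho /dual_param -ac [t ^+ (a + c)]exprD !mulrA. Qed.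

Variables (mu nu : part n).
Hypotheses (st : strip mu nu) (mu_in : included mu (rect n m)).
Let e := strip_sign mu nu.
Let y := flip e (node q t mu r).

(** What depends on the strip is a power of [t]; together with those of
    [strip_pair_balance] these powers are eliminated by [box_pair_powers]. *)
Lemma strip_box_balance (i : 'I_n) :
  skernel r b (y i) *
    (diag_single q t (p * r) nu i * diag_single q t rho (complement m nu) (rev_ord i)) =
  - (p ^+ m * sconst (t ^+ (n - i.+1)) (t ^+ i) r rho * b * r) *
    (if e i then t ^+ i else t ^+ (n - i.+1)) *
  (skernel rho (p / b) (p * y i)^-1 *
    (diag_single q t r mu i * diag_single q t (p * rho) (complement m mu) (rev_ord i))).
Proof.
rewrite !complement_single !diag_singleE.
have hn : (n - i.+1 + i = n.-1)%N by have := ltn_ord i; lia.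
have le_m : (mu i <= m)%N by have := forallP mu_in i; rewrite ffunE.
have a1 : 1 - t ^+ (n - i.+1) * t ^+ (n - i.+1) * r ^+ 2 != 0.
  by rewrite -exprD; apply: one_minus_neq0_s0.
have c1 : 1 - t ^+ (n - i.+1) * r ^+ 2 != 0 by apply: one_minus_neq0_s0.
have d1 : 1 - t ^+ i * t ^+ i * rho ^+ 2 != 0 by rewrite -exprD; apply: one_minus_neq0_s0.
have f1 : 1 - t ^+ i * rho ^+ 2 != 0 by apply: one_minus_neq0_s0.
have T0 : t ^+ (n - i.+1) != 0 by rewrite expf_neq0.
have U0 : t ^+ i != 0 by rewrite expf_neq0.
have nuE := strip_part i st; rewrite -/e in nuE.
have y_def : y i = if e i then (node q t mu r i)^-1 else node q t mu r i by [].
rewrite y_def; have e_def : e i = (nu i < mu i)%N by rewrite ffunE.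
have sq_neq0 a c s : independent q t s -> 1 - (q ^+ a * t ^+ c * s) ^+ 2 != 0.
  move=> inds; have := one_minus_neq0_s (a + a) (c + c) inds.
  by congr (1 - _ != 0); rewrite !exprD; ring.
case ei: (e i) nuE e_def => /= nuE e_def.
  have [l lE] : exists l, mu i = l.+1 by exists (mu i).-1; move: e_def; case: (mu i).
  have nul : nu i = l by rewrite nuE lE subn1.
  rewrite lE in le_m.
  have lk : (l.+1 + (m - l.+1) = m)%N by rewrite subnKC.
  have pyE : (p * (node q t mu r i)^-1)^-1 = node q t mu r i / p by rewrite invfM invrK mulrC.
  have n1 : node q t mu r i = q ^+ l.+1 * t ^+ (n - i.+1) * r by rewrite /node lE.
  rewrite pyE nul lE (subn_gapS le_m) n1 -[in p ^+ m]lk.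
  have zp : q ^+ l.+1 * t ^+ (n - i.+1) * r / p = q ^+ l * t ^+ (n - i.+1) * (p * r).
    by rewrite exprS /q; field.
  have zrho : q ^+ (m - l.+1) * t ^+ i * (p * rho) = (q ^+ l.+1 * t ^+ (n - i.+1) * r)^-1.
    rewrite (dual_paramE lk hn) exprD; field.
    by rewrite ?p0 ?r0 ?expf_neq0.
  rewrite [- _ * t ^+ i]mulNr.
  have qz : independent q t rho -> qpoch q (q * (t ^+ i * rho ^+ 2)) (m - l.+1) != 0.
    by move=> irho; have := qpoch_s_neq0 1 i (m - l.+1) irho; rewrite expr1.
  have qz' : qpoch q (q * (t ^+ (n - i.+1) * r ^+ 2)) l != 0.
    by have := qpoch_s_neq0 1 (n - i.+1) l indr; rewrite expr1.
  have rp0 : independent q t (p * rho).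
    exact/independent_sqr/independent_mulq/dual_param_independent.
  apply: single_balance1 => //; first exact: dual_paramE.
  - by rewrite -zrho sq_neq0.
  - by rewrite zp sq_neq0.
  - rewrite -[_ / p]invrK.
    have -> : (q ^+ l.+1 * t ^+ (n - i.+1) * r / p)^-1 = q ^+ (m - l.+1).+1 * t ^+ i * rho.
      by rewrite invfM invrK -zrho exprS /q; field.
    have -> : rho / (q ^+ (m - l.+1).+1 * t ^+ i * rho) = (q ^+ (m - l.+1).+1 * t ^+ i)^-1.
      by rewrite invfM mulrCA divff ?mulr1.
    have := one_minus_neq0 (m - l.+1) (fun j => qpoch_qt_neq0 i j indrho).
    by rewrite !subr_eq0 ![1 == _]eq_sym invr_eq1 mulrA -exprSr.
  exact: qz.
have lk : (mu i + (m - mu i) = m)%N by rewrite subnKC.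
have nul : nu i = mu i by rewrite nuE subn0.
have n1 : node q t mu r i = q ^+ mu i * t ^+ (n - i.+1) * r by [].
rewrite nul n1 -[in p ^+ m]lk [- _ * t ^+ _]mulNr.
have zp : p * (q ^+ mu i * t ^+ (n - i.+1) * r) = q ^+ mu i * t ^+ (n - i.+1) * (p * r) by ring.
have zrho : q ^+ (m - mu i) * t ^+ i * rho = (p * (q ^+ mu i * t ^+ (n - i.+1) * r))^-1.
  rewrite (dual_paramE lk hn) exprD; field.
  by rewrite ?p0 ?r0 ?expf_neq0.
apply: single_balance0 => //.
- exact: dual_paramE.
- exact: sq_neq0.
- by rewrite -zrho sq_neq0.
- have := one_minus_neq0_s (mu i) (n - i.+1) indr; congr (1 - _ != 0); ring.
- rewrite -zrho; have := one_minus_neq0_s (m - mu i) i indrho; congr (1 - _ != 0); ring.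
- exact: qpoch_neq0_s0.
- exact: qpoch_neq0_s0.
Qed.

Lemma strip_pair_balance (i j : 'I_n) : (i < j)%N ->
  norm_pair q t mu i j * pkernel t (y i * y j) *
    (diag_pair q t (p * r) nu i j *
     diag_pair q t rho (complement m nu) (rev_ord j) (rev_ord i)) =
  pconst t (t ^+ (n - i.+1 + (n - j.+1)) * r ^+ 2) (t ^+ (j + i) * rho ^+ 2) *
    ((if e i then t else 1) / (if e j then t else 1)) *
  (norm_pair q t nu i j * pkernel t ((p * y i)^-1 * (p * y j)^-1) *
    (diag_pair q t r mu i j *
     diag_pair q t (p * rho) (complement m mu) (rev_ord j) (rev_ord i))).
Proof.
move=> ij; have nu_in : included nu (rect n m).
  by apply/forallP => l; apply: leq_trans (forallP mu_in l); apply: (forallP (strip_included st)).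
rewrite !complement_pair // !norm_pairE // !diag_pairE //.
set u := t ^+ _ * r ^+ 2; set v := t ^+ _ * rho ^+ 2.
have -> : t ^+ (n - i.+1 + (n - j.+1)) * (p * r) ^+ 2 = q * u by rewrite /u /q; ring.
have -> : t ^+ (j + i) * (p * rho) ^+ 2 = q * v by rewrite /v /q; ring.
have u0 : u != 0 by rewrite mulf_neq0 ?expf_neq0.
have nzu c : qpoch q u c != 0 by apply: qpoch_neq0_s0.
have nzv c : qpoch q v c != 0 by apply: qpoch_neq0_s0.
have tuE : t * u = t ^+ (n - i.+1 + (n - j.+1)).+1 * r ^+ 2 by rewrite exprS mulrA.
have tvE : t * v = t ^+ (j + i).+1 * rho ^+ 2 by rewrite exprS mulrA.
have nztu c : qpoch q (t * u) c != 0 by rewrite tuE; apply: qpoch_neq0_s0.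
have nztv c : qpoch q (t * v) c != 0 by rewrite tvE; apply: qpoch_neq0_s0.
have u1 : 1 - u != 0 by apply: one_minus_neq0_s0.
have v1 : 1 - v != 0 by apply: one_minus_neq0_s0.
have tu1 : 1 - t * u != 0 by rewrite tuE; apply: one_minus_neq0_s0.
have tv1 : 1 - t * v != 0 by rewrite tvE; apply: one_minus_neq0_s0.
have nzq d k : qpoch q (q * t ^+ d) k != 0 by apply: qpoch_qt_neq0 indr.
have nzt d k : qpoch q (t ^+ d.+1) k != 0 by apply: qpoch_t_neq0 indr _.
have mi : (mu i <= m)%N by have := forallP mu_in i; rewrite ffunE.
have mj : (mu j <= m)%N by have := forallP mu_in j; rewrite ffunE.
have le_mu : (mu j <= mu i)%N by rewrite part_leq // ltnW.
have le_nu : (nu j <= nu i)%N by rewrite part_leq // ltnW.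
have nui := strip_part i st; have nuj := strip_part j st; rewrite -/e in nui nuj.
have yi : y i = if e i then (node q t mu r i)^-1 else node q t mu r i by [].
have yj : y j = if e j then (node q t mu r j)^-1 else node q t mu r j by [].
have ei_def : e i = (nu i < mu i)%N by rewrite ffunE.
have ej_def : e j = (nu j < mu j)%N by rewrite ffunE.
have prodE : node q t mu r i * node q t mu r j = q ^+ (mu i + mu j) * u.
  by rewrite /node /u !exprD; ring.
have quotE : node q t mu r i / node q t mu r j = q ^+ (mu i - mu j) * t ^+ (j - i.+1).+1.
  rewrite /node -[mu i in LHS](subnK le_mu).
  rewrite (height_split ij (ltn_ord j)).
  by rewrite !exprD; field; rewrite ?r0 ?expf_neq0.
have zE : (p * y i)^-1 * (p * y j)^-1 = (q * (y i * y j))^-1.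
  by rewrite -invfM; congr (_^-1); rewrite /q; ring.
have vE : v = (q ^+ (m + m).+1 * u)^-1.
  have tt : t ^+ n.-1 * t ^+ n.-1 = t ^+ (n - i.+1 + (n - j.+1)) * t ^+ (j + i).
    by rewrite -!exprD (height_sum (ltn_ord i) (ltn_ord j)).
  rewrite /v; have -> : rho ^+ 2 = (q ^+ m * q ^+ m * (t ^+ n.-1 * t ^+ n.-1) * q * r ^+ 2)^-1.
    by rewrite /rho /dual_param exprVn; congr (_^-1); rewrite /q; ring.
  rewrite tt /u [q ^+ (m + m).+1]exprS [q ^+ (m + m)]exprD.
  have A0 : t ^+ (n - i.+1 + (n - j.+1)) != 0 by rewrite expf_neq0.
  have B0 : t ^+ (j + i) != 0 by rewrite expf_neq0.
  have Q0 : q ^+ m != 0 by rewrite expf_neq0.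
  move: A0 B0 Q0; move: (t ^+ _) (t ^+ _) (q ^+ m) => x1 x2 x3 h1 h2 h3; field.
  by rewrite ?r0 ?q0 ?h1 ?h2 ?h3.
rewrite zE; case ei: (e i) nui ei_def => nui ei_def; case ej: (e j) nuj ej_def => nuj ej_def.
- have [a aE] : exists a, mu i = a.+1 by exists (mu i).-1; case: (mu i) ei_def.
  have [c cE] : exists c, mu j = c.+1 by exists (mu j).-1; case: (mu j) ej_def.
  have nuia : nu i = a by rewrite nui aE subn1.
  have nujc : nu j = c by rewrite nuj cE subn1.
  rewrite yi yj ei ej -invfM prodE divff // mulr1.
  rewrite aE cE nuia nujc in mi mj *.
  have kE : ((a + c).+2 + (m - c.+1 + (m - a.+1)) = m + m)%N.
    by rewrite -(sum_complement mi mj) addSn addnS.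
  rewrite (subn_gapS mi) (subn_gapS mj) subSS !addSn !addnS.
  have -> : (q * (q ^+ (a + c).+2 * u)^-1)^-1 = q ^+ (a + c).+1 * u.
    by rewrite [q ^+ _.+2]exprS -mulrA invfM invrK mulKf.
  by apply: pair_balance11 => //; rewrite kE.
- have [a aE] : exists a, mu i = a.+1 by exists (mu i).-1; case: (mu i) ei_def.
  have nuia : nu i = a by rewrite nui aE subn1.
  have nujE : nu j = mu j by rewrite nuj subn0.
  have yE : y i * y j = (q ^+ (mu i - mu j) * t ^+ (j - i.+1).+1)^-1.
    by rewrite -quotE yi yj ei ej invf_div mulrC.
  rewrite yE nuia nujE aE in mi le_nu *.
  rewrite subSn // (subn_gapS mi) !addSn !addnS divr1.
  have -> : (q * (q ^+ (a - mu j).+1 * t ^+ (j - i.+1).+1)^-1)^-1 =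
      q ^+ (a - mu j) * t ^+ (j - i.+1).+1.
    by rewrite [q ^+ _.+1]exprS -mulrA invfM invrK mulKf.
  exact: pair_balance10.
- have [c cE] : exists c, mu j = c.+1 by exists (mu j).-1; case: (mu j) ej_def.
  have nujc : nu j = c by rewrite nuj cE subn1.
  have nuiE : nu i = mu i by rewrite nui subn0.
  have yE : y i * y j = q ^+ (mu i - mu j) * t ^+ (j - i.+1).+1.
    by rewrite -quotE yi yj ei ej.
  rewrite yE nujc nuiE cE in mj le_mu *.
  rewrite (subn_gapS le_mu) (subn_gapS mj) !addSn !addnS div1r.
  exact: pair_balance01.
have nuiE : nu i = mu i by rewrite nui subn0.
have nujE : nu j = mu j by rewrite nuj subn0.
rewrite nuiE nujE yi yj ei ej prodE divr1 mulr1.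
by apply: pair_balance00 => //; rewrite sum_complement.
Qed.

Definition balance_const : K :=
  \prod_(i < n) (- (p ^+ m * sconst (t ^+ (n - i.+1)) (t ^+ i) r rho * b * r) * t ^+ (n - i.+1)) *
  pair_prod (fun i j : 'I_n =>
    pconst t (t ^+ (n - i.+1 + (n - j.+1)) * r ^+ 2) (t ^+ (j + i) * rho ^+ 2)).

(** The powers of [t] left over by the boxes and by the pairs compensate. *)
Lemma box_pair_powers : \prod_(i < n) (if e i then t ^+ i else t ^+ (n - i.+1)) *
  pair_prod (fun i j => (if e i then t else 1) / (if e j then t else 1)) =
  \prod_(i < n) t ^+ (n - i.+1).
Proof.
rewrite pair_prodM (pair_prod_left (fun i => if e i then t else 1)).
rewrite (pair_prod_right (fun j => (if e j then t else 1)^-1)) -!big_split.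
apply: eq_bigr => i _ /=; case: (e i); last by rewrite invr1 !expr1n !mulr1.
by rewrite exprVn mulrCA divff ?mulr1 ?expf_neq0.
Qed.

(** Up to a constant that does not depend on the strip, removing a strip from [mu]
    has the same weight as removing it from the complement of [nu]. *)
Lemma strip_balance :
  norm2 q t mu * kernel t r b y *
    (diag_value q t (p * r) nu * diag_value q t rho (complement m nu)) =
  balance_const * (norm2 q t nu *
    kernel t rho (p / b) (fun i => (p * y (rev_ord i))^-1) *
    (diag_value q t r mu * diag_value q t (p * rho) (complement m mu))).
Proof.
have complE s (la : part n) : diag_value q t s (complement m la) =
    \prod_(i < n) diag_single q t s (complement m la) (rev_ord i) *
    pair_prod (fun i j => diag_pair q t s (complement m la) (rev_ord j) (rev_ord i)).
  by rewrite {1}/diag_value prod_rev pair_prod_rev.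
rewrite !(norm2E _ indr) !complE /diag_value !kernelE.
rewrite [\prod_i skernel rho _ _]prod_rev [pair_prod (fun i j => pkernel t (_^-1 * _))]pair_prod_rev.
have split3 (N A B C D E F : K) : N * (A * B) * (C * D * (E * F)) = A * (C * E) * (N * B * (D * F)).
  by ring.
rewrite [LHS]split3 [X in _ = _ * X]split3.
have -> : \prod_(i < n) skernel r b (y i) *
      (\prod_(i < n) diag_single q t (p * r) nu i *
       \prod_(i < n) diag_single q t rho (complement m nu) (rev_ord i)) =
    \prod_(i < n) (- (p ^+ m * sconst (t ^+ (n - i.+1)) (t ^+ i) r rho * b * r)) *
    \prod_(i < n) (if e i then t ^+ i else t ^+ (n - i.+1)) *
    (\prod_(i < n) skernel rho (p / b) (p * y (rev_ord (rev_ord i)))^-1 *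
      (\prod_(i < n) diag_single q t r mu i *
       \prod_(i < n) diag_single q t (p * rho) (complement m mu) (rev_ord i))).
  by rewrite -!big_split; apply: eq_bigr => i _ /=; rewrite strip_box_balance rev_ordK.
have -> : pair_prod (norm_pair q t mu) * pair_prod (fun i j => pkernel t (y i * y j)) *
      (pair_prod (diag_pair q t (p * r) nu) *
       pair_prod (fun i j => diag_pair q t rho (complement m nu) (rev_ord j) (rev_ord i))) =
    pair_prod (fun i j : 'I_n =>
      pconst t (t ^+ (n - i.+1 + (n - j.+1)) * r ^+ 2) (t ^+ (j + i) * rho ^+ 2)) *
    pair_prod (fun i j => (if e i then t else 1) / (if e j then t else 1)) *
    (pair_prod (norm_pair q t nu) *
     pair_prod (fun i j =>
      pkernel t ((p * y (rev_ord (rev_ord j)))^-1 * (p * y (rev_ord (rev_ord i)))^-1)) *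
     (pair_prod (diag_pair q t r mu) *
      pair_prod (fun i j => diag_pair q t (p * rho) (complement m mu) (rev_ord j) (rev_ord i)))).
  rewrite -!pair_prodM; apply: eq_pair_prod => i j ij.
  by rewrite strip_pair_balance // !rev_ordK [(p * y j)^-1 * _]mulrC.
have -> : balance_const =
    \prod_(i < n) (- (p ^+ m * sconst (t ^+ (n - i.+1)) (t ^+ i) r rho * b * r)) *
    (\prod_(i < n) (if e i then t ^+ i else t ^+ (n - i.+1)) *
     pair_prod (fun i j => (if e i then t else 1) / (if e j then t else 1))) *
    pair_prod (fun i j : 'I_n =>
      pconst t (t ^+ (n - i.+1 + (n - j.+1)) * r ^+ 2) (t ^+ (j + i) * rho ^+ 2)).
  by rewrite /balance_const big_split box_pair_powers.
have regroup (c1 c2 c3 c4 x1 x2 : K) :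
    c1 * c3 * x1 * (c2 * c4 * x2) = c1 * (c3 * c4) * c2 * (x1 * x2) by ring.
exact: regroup.
Qed.

End FixedParameters.

End ExplicitWeights.

(** * Biorthogonality *)

Section Biorthogonality.
Variable K : fieldType.
Implicit Types p q t r s b : K.
Hypothesis char0 : [pchar K] =i pred0.

Lemma pair_prod_neq0 n (g : 'I_n -> 'I_n -> K) :
  (forall i j : 'I_n, (i < j)%N -> g i j != 0) -> pair_prod g != 0.
Proof. by move=> g0; apply/prodf_neq0 => i _; apply/prodf_neq0 => j; apply: g0. Qed.

Lemma diag_value_neq0 q t s n (la : part n) : independent q t s -> diag_value q t s la != 0.
Proof.
move=> ind; have nzs e k : qpoch q (t ^+ e * s ^+ 2) k != 0.
  by have := qpoch_s_neq0 0 e k ind; rewrite mul1r.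
have nzq e k : qpoch q (q * t ^+ e) k != 0 by apply: qpoch_qt_neq0 ind.
rewrite mulf_neq0 //.
  apply/prodf_neq0 => i _; rewrite !mulf_neq0 ?invr_eq0 // expf_neq0 // invr_eq0.
  exact: node_neq0.
by apply: pair_prod_neq0 => i j ij; rewrite !mulf_neq0 ?invr_eq0.
Qed.

Lemma norm2_neq0 q t s n (la : part n) : independent q t s -> norm2 q t la != 0.
Proof.
move=> ind; rewrite (norm2E _ ind); apply: pair_prod_neq0 => i j ij.
have nzq e k : qpoch q (t ^+ e * q) k != 0 by rewrite mulrC; apply: qpoch_qt_neq0 ind.
have nzt e k : qpoch q (t ^+ e * t) k != 0 by rewrite -exprSr; apply: qpoch_t_neq0 ind _.
by rewrite !mulf_neq0 ?invr_eq0 // mulf_neq0 ?invr_eq0.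
Qed.

Lemma interp_at_diag_neq0 q t s n (la : part n) : independent q t s ->
  interp_at q t la la s != 0.
Proof. by move=> ind; rewrite interp_at_diag // diag_value_neq0. Qed.

Lemma complement_included n m (mu : part n) : included (complement m mu) (rect n m).
Proof. by apply/forallP => i; rewrite !ffunE leq_subr. Qed.

Lemma complementE n m (mu : part n) i : complement m mu i = (m - mu (rev_ord i))%N.
Proof. by rewrite ffunE. Qed.

Lemma complementK n m (mu : part n) : included mu (rect n m) ->
  complement m (complement m mu) = mu.
Proof.
move=> /forallP mu_in; apply: val_inj; apply/ffunP => i.
have := mu_in i; rewrite [LHS]complementE complementE rev_ordK ffunE.
exact: subKn.
Qed.

Lemma included_complement n m (mu nu : part n) :
  included mu (rect n m) -> included nu (rect n m) ->
  included (complement m mu) (complement m nu) = included nu mu.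
Proof.
move=> /forallP mu_in /forallP nu_in; apply/forallP/forallP => h i.
  have := h (rev_ord i); rewrite !complementE rev_ordK.
  by have := mu_in i; have := nu_in i; rewrite !ffunE; lia.
by rewrite !complementE leq_sub2l.
Qed.

Lemma strip_complement n m (mu nu : part n) :
  included mu (rect n m) -> included nu (rect n m) ->
  strip (complement m nu) (complement m mu) = strip mu nu.
Proof.
move=> /forallP mu_in /forallP nu_in; apply/forallP/forallP => h i.
  have := h (rev_ord i); rewrite !complementE rev_ordK.
  by have := mu_in i; have := nu_in i; rewrite !ffunE; lia.
have := h (rev_ord i); rewrite !complementE.
by have := mu_in (rev_ord i); have := nu_in (rev_ord i); rewrite !ffunE; lia.
Qed.

Lemma perm_complement n m :
  perm_eq [seq complement m mu | mu <- parts_in_rect n m] (parts_in_rect n m).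
Proof.
have inj : {in parts_in_rect n m &, injective (complement (n := n) m)}.
  move=> mu nu; rewrite !mem_parts_in_rect => mu_in nu_in e.
  by rewrite -(complementK mu_in) e complementK.
apply: uniq_perm; rewrite ?parts_in_rect_uniq ?map_inj_in_uniq ?parts_in_rect_uniq //.
move=> mu; apply/mapP/idP => [[nu _ ->]|mu_in].
  by rewrite mem_parts_in_rect complement_included.
exists (complement m mu); first by rewrite mem_parts_in_rect complement_included.
by rewrite complementK // -mem_parts_in_rect.
Qed.

Lemma strip_signE n (mu nu : part n) i : strip_sign mu nu i = (nu i < mu i)%N.
Proof. by rewrite ffunE. Qed.

Section Fixed.
Variables (p t r : K) (n m : nat).
Hypothesis ind : independent p t r.
Let q := p ^+ 2.
Let rho := dual_param p t r n m.

Lemma node_complement (mu : part n) i : (mu i <= m)%N ->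
  node q t (complement m mu) rho (rev_ord i) = (p * node q t mu r i)^-1.
Proof.
move=> le_m; have [p0 t0 r0 _] := ind.
rewrite /node rev_ord_height complement_rev /rho /dual_param -/q.
have -> : n.-1 = (n - i.+1 + i)%N by have := ltn_ord i; lia.
have {2}<- : (mu i + (m - mu i) = m)%N by rewrite subnKC.
rewrite [q ^+ (_ + _)]exprD [t ^+ (_ + _)]exprD.
have q0 : q != 0 by rewrite /q expf_neq0.
by field; rewrite ?p0 ?r0 ?expf_neq0.
Qed.

Definition weight_at (mu : part n) : K := norm2 q t mu /
  (interp_at q t mu mu r * interp_at q t (complement m mu) (complement m mu) (p * rho)).

Lemma weight_balance b (mu nu : part n) : b != 0 -> strip mu nu -> included mu (rect n m) ->
  weight_at mu * kernel t r b (flip (strip_sign mu nu) (node q t mu r)) =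
  balance_const p t r b n m * (norm2 q t nu /
    (interp_at q t nu nu (p * r) * interp_at q t (complement m nu) (complement m nu) rho)) *
  kernel t rho (p / b)
    (flip (strip_sign (complement m nu) (complement m mu)) (node q t (complement m nu) rho)).
Proof.
move=> b0 st mu_in; have [p0 t0 r0 _] := ind.
have indr : independent q t r by apply: independent_sqr.
have indpr : independent q t (p * r) by apply/independent_sqr/independent_mulq.
have irho : independent p t rho by apply: dual_param_independent.
have indrho : independent q t rho by apply: independent_sqr.
have indprho := independent_sqr (independent_mulq irho).
have nu_in : included nu (rect n m).
  by apply/forallP => l; apply: leq_trans (forallP mu_in l); apply: (forallP (strip_included st)).
have argE : flip (strip_sign (complement m nu) (complement m mu)) (node q t (complement m nu) rho) =
    (fun i => (p * flip (strip_sign mu nu) (node q t mu r) (rev_ord i))^-1).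
  apply: functional_extensionality => i; rewrite -[i]rev_ordK; move: (rev_ord i) => j.
  rewrite rev_ordK /flip !strip_signE !complement_rev node_complement; last first.
    by have := forallP nu_in j; rewrite ffunE.
  have mj : (mu j <= m)%N by have := forallP mu_in j; rewrite ffunE.
  have := strip_part j st; rewrite strip_signE.
  have lt_eq : (m - mu j < m - nu j)%N = (nu j < mu j)%N.
    by have := forallP nu_in j; rewrite ffunE => nj; apply/idP/idP; lia.
  rewrite lt_eq; case: ltnP => lt /= nuE; last by rewrite /node nuE subn0.
  rewrite invrK /node nuE subn1; case: (mu j) lt => // l _ /=.
  have -> : q ^+ l.+1 * t ^+ (n - j.+1) * r = p * (p * (q ^+ l * t ^+ (n - j.+1) * r)).
    by rewrite exprS /q; ring.
  by rewrite invfM invrK mulKf.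
have := strip_balance ind b0 st mu_in; rewrite -/q -/rho argE => bal.
rewrite /weight_at !interp_at_diag //.
have d1 := diag_value_neq0 mu indr; have d2 := diag_value_neq0 nu indpr.
have d3 := diag_value_neq0 (complement m mu) indprho.
have d4 := diag_value_neq0 (complement m nu) indrho.
move: bal d1 d2 d3 d4.
move: (kernel _ _ _ _) (kernel _ _ _ _) (balance_const _ _ _ _ _ _) (norm2 _ _ _) (norm2 _ _ _).
move: (diag_value _ _ _ _) (diag_value _ _ _ _) (diag_value _ _ _ _) (diag_value _ _ _ _).
move=> x1 x2 x3 x4 k1 k2 c n1 n2 bal d2 d4 d1 d3.
have -> : n2 / (x2 * x1) * k2 = n2 * k2 * (x4 * x3) / (x2 * x1 * (x4 * x3)).
  by field; rewrite d1 d2 d3 d4.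
by rewrite bal; field; rewrite d1 d2 d3 d4.
Qed.

(** The operator with parameter [b] relates the values at [mu] for [r] to those at
    [nu] for [p * r]; by the balance of the weights its adjoint is the operator of
    the complementary nodes.  Taking [b] so as to kill the eigenvalue of [la^c]
    there, and not that of [ka] here, separates the two. *)
Lemma biorthogonal (ka la : part n) :
  included ka (rect n m) -> included la (rect n m) -> ka != la ->
  \sum_(mu <- parts_in_rect n m) weight_at mu * interp_at q t ka mu r *
    interp_at q t (complement m la) (complement m mu) (p * rho) = 0.
Proof.
move=> ka_in la_in neq; have [p0 t0 r0 _] := ind.
have indr : independent q t r by apply: independent_sqr.
have irho : independent p t rho by apply: dual_param_independent.
have [i neq_i] : exists i, ka i != la i.
  apply/existsP; apply: contraNT neq => /existsPn same; apply/eqP/val_inj/ffunP => i.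
  by have := same i; rewrite negbK => /eqP.
pose b := (node q t la r i)^-1.
have b0 : b != 0 by rewrite invr_eq0 node_neq0.
have E0 : eigenvalue_at p t r b ka != 0.
  apply/prodf_neq0 => j _.
  have -> : p ^- ka j - r * b * t ^+ (n - j.+1) * p ^+ ka j =
            p ^- ka j * (1 - b * node q t ka r j).
    by rewrite /node /q -exprM mulnC exprM; field; rewrite expf_neq0.
  rewrite mulf_neq0 ?invr_eq0 ?expf_neq0 // subr_eq0 /b.
  apply/eqP => /(congr1 (fun x => node q t la r i * x)).
  rewrite mulr1 mulVKf ?node_neq0 // => /esym/eqP; apply/negP.
  by apply: node_neq => //; case: eqVneq => //= ->.
apply: (mulfI E0); rewrite mulr0 mulr_sumr.
pose w' (nu : part n) := norm2 q t nu /
  (interp_at q t nu nu (p * r) * interp_at q t (complement m nu) (complement m nu) rho).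
pose g mu := interp_at q t (complement m la) (complement m mu) (p * rho).
pose ker (nu mu : part n) := kernel t rho (p / b)
  (flip (strip_sign (complement m nu) (complement m mu)) (node q t (complement m nu) rho)).
transitivity (\sum_(mu <- parts_in_rect n m) \sum_(nu <- parts_in_rect n m | strip mu nu)
   balance_const p t r b n m * (w' nu * interp_at q t ka nu (p * r)) * (ker nu mu * g mu)).
  rewrite big_seq [RHS]big_seq; apply: eq_bigr => mu; rewrite mem_parts_in_rect => mu_in.
  have -> : eigenvalue_at p t r b ka * (weight_at mu * interp_at q t ka mu r * g mu) =
     eigenvalue_at p t r b ka * interp_at q t ka mu r * (weight_at mu * g mu) by ring.
  rewrite -(interp_at_shift char0 b ka ind mu_in) mulr_suml; apply: eq_bigr => nu st.
  have := weight_balance b0 st mu_in; rewrite -/(w' nu) -/(ker nu mu).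
  move=> bal; rewrite mulrACA [kernel _ _ _ _ * weight_at mu]mulrC bal.
  by ring.
(* The sum over [mu] is now the operator of the complementary nodes applied to the
   polynomial of [la^c]. *)
rewrite (exchange_big_dep xpredT) //= big_seq big1 // => nu; rewrite mem_parts_in_rect => nu_in.
rewrite -mulr_sumr; apply/eqP; rewrite mulf_eq0; apply/orP; right; apply/eqP.
have := interp_at_shift char0 (p / b) (complement m la) irho (complement_included m nu).
have bE : p / b = (node q t (complement m la) rho (rev_ord i))^-1.
  rewrite node_complement ?invrK /b ?invrK //.
  by have := forallP la_in i; rewrite ffunE.
rewrite {2}bE eigenvalue_at_eq0 // mul0r => sum0.
apply: etrans sum0; rewrite -[RHS](perm_big _ (perm_complement n m)) big_map /= big_seq_cond [RHS]big_seq_cond.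
apply: eq_big => mu.
  case mu_in: (mu \in _) => //=; rewrite mem_parts_in_rect in mu_in.
  by rewrite strip_complement.
case/andP; rewrite mem_parts_in_rect => mu_in _.
by [].
Qed.

End Fixed.
End Biorthogonality.

(** * The first inversion identity when [q] is a square *)

Section FirstIdentity.
Variable K : fieldType.
Implicit Types p q t r s b : K.
Hypothesis char0 : [pchar K] =i pred0.

Lemma included_anti n (mu nu : part n) : included mu nu -> included nu mu -> mu = nu.
Proof.
move=> /forallP le1 /forallP le2; apply: val_inj; apply/ffunP => i.
by apply/eqP; rewrite eqn_leq le1 le2.
Qed.

Lemma included_trans n (mu nu pi : part n) : included mu nu -> included nu pi -> included mu pi.
Proof.
by move=> /forallP le1 /forallP le2; apply/forallP => i; apply: leq_trans (le1 i) (le2 i).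
Qed.

Lemma independent_base q t s n : independent q t s -> independent q t (t ^ (1 - n%:Z) * s).
Proof. by move/(independent_shift 0 (1 - n%:Z)); rewrite expr0z mul1r. Qed.

Lemma independent_dual q t s m : independent q t s -> independent q t (q ^- m / s).
Proof.
by move/independent_inv/(independent_shift (- m%:Z) 0); rewrite expr0z mulr1 -exprnN.
Qed.

(** For [ka != la], the sum can be extended to the whole rectangle, since one of the
    two interpolation polynomials vanishes at every additional term. *)
Lemma inversion_square p t s n m (ka la : part n) : independent p t s ->
  included la (rect n m) -> included ka la ->
  \sum_(mu <- parts_in_rect n m | included ka mu && included mu la)
     sqbinom (p ^+ 2) t s mu ka * curlybinom (p ^+ 2) t m s la mu = (la == ka)%:R.
Proof.
move=> ind la_in ka_la; have [p0 t0 s0 _] := ind; set q := p ^+ 2.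
have q0 : q != 0 by rewrite /q expf_neq0.
have ka_in := included_trans ka_la la_in.
pose r := t ^ (1 - n%:Z) * s.
have indr : independent p t r by apply: independent_base.
have indqr : independent q t r by apply: independent_sqr.
have indm : independent q t (q ^- m / s) by apply/independent_dual/independent_sqr.
case: eqVneq => [e|neq].
  subst ka.
  rewrite big_mkcond (bigD1_seq la) ?parts_in_rect_uniq ?mem_parts_in_rect //=.
  have refl : included la la by apply/forallP.
  rewrite refl /= big1 ?addr0 => [|mu neq]; last first.
    by case: ifP => // /andP[i1 i2]; case/eqP: neq; apply: included_anti.
  rewrite /sqbinom /curlybinom -/q -/r.
  have N1 := norm2_neq0 la indqr; have F1 := interp_at_diag_neq0 char0 la indqr.
  have F2 := interp_at_diag_neq0 char0 (complement m la) indm.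
  have D0 : norm2 q t la * interp_at q t la la r *
    interp_at q t (complement m la) (complement m la) (q ^- m / s) != 0.
    by rewrite mulf_neq0 // mulf_neq0.
  by rewrite !divff ?mulr1.
have n_gt0 : (0 < n)%N.
  by case: n ka la neq {la_in ka_la r indr indqr ka_in} => // ka la; rewrite (part0_eq la ka) eqxx.
have dualE : p * dual_param p t r n m = q ^- m / s.
  rewrite /dual_param -/q /r; have -> : 1 - n%:Z = - (n.-1)%:Z by lia.
  by rewrite -exprnN; field; rewrite ?p0 ?s0 ?expf_neq0.
transitivity (interp_at q t la la r / (interp_at q t ka ka r * norm2 q t la) *
  \sum_(mu <- parts_in_rect n m) weight_at p t r m mu * interp_at q t ka mu r *
    interp_at q t (complement m la) (complement m mu) (p * dual_param p t r n m)); last first.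
  by rewrite biorthogonal ?mulr0 // eq_sym.
rewrite mulr_sumr big_mkcond big_seq [RHS]big_seq; apply: eq_bigr => mu.
rewrite mem_parts_in_rect => mu_in; case: ifPn => [_|].
  rewrite /sqbinom /curlybinom /weight_at dualE -/r -/q.
  have F1 := interp_at_diag_neq0 char0 ka indqr.
  have F2 := interp_at_diag_neq0 char0 mu indqr.
  have F3 := interp_at_diag_neq0 char0 (complement m mu) indm.
  have N1 := norm2_neq0 la indqr.
  by field; rewrite F1 F2 F3 N1.
rewrite negb_and => /orP[nka|nla].
  by rewrite (interp_at_eq0 char0 indr nka) mulr0 mul0r mulr0.
have -> : interp_at q t (complement m la) (complement m mu) (p * dual_param p t r n m) = 0.
  apply: interp_at_eq0 => //; last by rewrite included_complement.
  exact/independent_mulq/dual_param_independent.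
by rewrite !mulr0.
Qed.

End FirstIdentity.

(** * Both inversion identities *)

Section Inversion.
Variable K : fieldType.

(** A left inverse of a square matrix is a right inverse: the two identities are
    the two ways of multiplying the triangular matrices [a] and [b]. *)
Lemma triangular_inverse n m (a b : part n -> part n -> K) :
  (forall ka la, included la (rect n m) -> included ka la ->
    \sum_(mu <- parts_in_rect n m | included ka mu && included mu la) a mu ka * b la mu
      = (la == ka)%:R) ->
  forall ka la, included la (rect n m) -> included ka la ->
    \sum_(mu <- parts_in_rect n m | included ka mu && included mu la) b mu ka * a la mu
      = (la == ka)%:R.
Proof.
move=> ab ka la la_in ka_la; set S := parts_in_rect n m.
pose P (i : 'I_(size S)) := tnth (in_tuple S) i.
pose A := \matrix_(i, j) if included (P i) (P j) then a (P j) (P i) else 0.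
pose B := \matrix_(i, j) if included (P i) (P j) then b (P j) (P i) else 0.
have memP i : included (P i) (rect n m) by rewrite -mem_parts_in_rect mem_tnth.
have injP i j : (P i == P j) = (i == j).
  by rewrite /P !(tnth_nth (rect n m)) nth_uniq ?parts_in_rect_uniq.
have mulE (f g : part n -> part n -> K) i j :
    \sum_k (if included (P i) (P k) then f (P k) (P i) else 0) *
           (if included (P k) (P j) then g (P j) (P k) else 0) =
    \sum_(mu <- S | included (P i) mu && included mu (P j)) f mu (P i) * g (P j) mu.
  rewrite [RHS]big_tnth [RHS]big_mkcond; apply: eq_bigr => k _; rewrite -/(P k).
  by case: included; case: included; rewrite ?mul0r ?mulr0.
have AB : A *m B = 1%:M.
  apply/matrixP => i j; rewrite !mxE -injP [P i == _]eq_sym.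
  under eq_bigr do rewrite !mxE; rewrite mulE.
  have [ij|nij] := boolP (included (P i) (P j)); first exact: ab.
  rewrite big1 => [|mu /andP[i_mu mu_j]]; last by rewrite (included_trans i_mu mu_j) in nij.
  by case: eqVneq nij => // ->; case/forallP.
have ka_in := included_trans ka_la la_in.
have inP mu : included mu (rect n m) -> exists i, P i = mu.
  rewrite -mem_parts_in_rect => mu_in; have lt : (index mu S < size S)%N by rewrite index_mem.
  by exists (Ordinal lt); rewrite /P (tnth_nth mu) /= nth_index.
have [i <-] := inP _ ka_in; have [j <-] := inP _ la_in.
rewrite injP [j == i]eq_sym -mulE.
have /matrixP/(_ i j) := mulmx1C AB; rewrite !mxE => <-.
by apply: eq_bigr => k _; rewrite !mxE.
Qed.

End Inversion.

Section BinomialTransfer.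
Variables (K L : fieldType) (phi : {rmorphism K -> L}).
Hypothesis char0 : [pchar K] =i pred0.

Lemma C0_rmorph (q t x : K) n (la : part n) :
  phi (C0 q t la x) = C0 (phi q) (phi t) la (phi x).
Proof.
rewrite rmorph_prod; apply: eq_bigr => i _; rewrite rmorph_prod; apply: eq_bigr => j _.
by rewrite rmorphB rmorph1 !rmorphM fmorphV !rmorphXn.
Qed.

Lemma Cminus_rmorph (q t x : K) n (la : part n) :
  phi (Cminus q t la x) = Cminus (phi q) (phi t) la (phi x).
Proof.
rewrite rmorph_prod; apply: eq_bigr => i _; rewrite rmorph_prod; apply: eq_bigr => j _.
by rewrite rmorphB rmorph1 !rmorphM !rmorphXn.
Qed.

Lemma norm2_rmorph (q t : K) n (la : part n) : phi (norm2 q t la) = norm2 (phi q) (phi t) la.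
Proof.
by rewrite /norm2 rmorphM fmorphV !rmorphM !C0_rmorph !Cminus_rmorph rmorphM rmorphXn fmorphXz.
Qed.

Variables (q t s : K) (n : nat).
Hypothesis ind : independent q t s.

Lemma sqbinom_rmorph (la mu : part n) :
  phi (sqbinom q t s la mu) = sqbinom (phi q) (phi t) (phi s) la mu.
Proof.
rewrite /sqbinom rmorphM fmorphV !interp_at_rmorph //; try exact: independent_base.
by rewrite rmorphM fmorphXz.
Qed.

Lemma curlybinom_rmorph m (la mu : part n) :
  phi (curlybinom q t m s la mu) = curlybinom (phi q) (phi t) m (phi s) la mu.
Proof.
have i1 := independent_base n ind; have i2 := independent_dual m ind.
have phiM3 x y z : phi (x * y * z) = phi x * phi y * phi z by rewrite !rmorphM.
rewrite /curlybinom rmorphM fmorphV.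
by congr (_ / _); rewrite phiM3 norm2_rmorph !interp_at_rmorph // !rmorphM !fmorphV rmorphXn fmorphXz.
Qed.

End BinomialTransfer.

Section GenericParameters.
Variable K : fieldType.
Hypothesis char0 : [pchar K] =i pred0.

Lemma sqrt_extension (q : K) :
  exists (L : fieldType) (phi : {rmorphism K -> L}) (p : L), phi q = p ^+ 2.
Proof.
have [[p pE]|nosqrt] := classic (exists p, q = p ^+ 2).
  by exists K, idfun, p.
have irr : irreducible_poly ('X^2 - q%:P).
  apply: cubic_irreducible; first by rewrite size_XnsubC.
  move=> x; rewrite rootE !hornerE subr_eq0; apply/eqP => xE.
  by apply: nosqrt; exists x.
have [L _ [z rz _]] := irredp_FAdjoin irr.
exists L, (in_alg L), z; move: rz.
by rewrite rootE rmorphB /= map_polyXn map_polyC !hornerE subr_eq0 => /eqP.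
Qed.

Lemma independent_sqrt (F : fieldType) (p t s : F) : independent (p ^+ 2) t s -> independent p t s.
Proof.
move=> [p0 t0 s0 ind]; split=> //.
  by apply: contraNneq p0 => ->; rewrite expr0n.
move=> a b c /(congr1 (fun x => x ^+ 2)); rewrite expr1n => e.
have := ind a (b * 2) (c * 2).
have -> : p ^+ 2 ^ a * t ^ (b * 2) * s ^ (c * 2) = (p ^ a * t ^ b * s ^ c) ^+ 2.
  have sqE (x : F) (k : int) : x ^ (k * 2) = (x ^ k) ^+ 2 by rewrite -exprz_exp.
  by rewrite -[p ^+ 2]/(p ^ 2) exprz_exp [2 * a]mulrC !sqE !exprMn.
by move=> /(_ e)[-> /eqP + /eqP]; rewrite !mulf_eq0 /= !orbF => /eqP -> /eqP ->.
Qed.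

(** A square root of [q] is adjoined to the field, where [inversion_square] applies;
    the binomial coefficients do not change. *)
Lemma inversion_sq_curly (q t s : K) n m (ka la : part n) : independent q t s ->
  included la (rect n m) -> included ka la ->
  \sum_(mu <- parts_in_rect n m | included ka mu && included mu la)
     sqbinom q t s mu ka * curlybinom q t m s la mu = (la == ka)%:R.
Proof.
move=> ind la_in ka_la; have [L [phi [p pE]]] := sqrt_extension q.
have charL : [pchar L] =i pred0 by move=> x; rewrite (fmorph_pchar phi) char0.
have indL := independent_rmorph phi ind; rewrite pE in indL.
apply: (fmorph_inj phi); rewrite rmorph_nat rmorph_sum.
rewrite -(inversion_square charL (independent_sqrt indL) la_in ka_la).
apply: eq_bigr => mu _.
by rewrite rmorphM (sqbinom_rmorph phi char0 ind) (curlybinom_rmorph phi char0 ind) pE.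
Qed.

Lemma inversion_curly_sq (q t s : K) n m (ka la : part n) : independent q t s ->
  included la (rect n m) -> included ka la ->
  \sum_(mu <- parts_in_rect n m | included ka mu && included mu la)
     curlybinom q t m s mu ka * sqbinom q t s la mu = (la == ka)%:R.
Proof.
move=> ind; apply: (triangular_inverse (a := sqbinom q t s)) => ka' la'.
exact: inversion_sq_curly.
Qed.

End GenericParameters.

(** * The field of rational functions *)

Lemma monomial_eq (R : idomainType) (u v : R) i j : u != 0 ->
  u%:P * 'X^i = v%:P * 'X^j -> u = v /\ i = j.
Proof.
move=> u0 e; have ij : i = j.
  have := congr1 (fun f : {poly R} => f`_i) e.
  rewrite !coefCM !coefXn eqxx mulr1; case: eqVneq => // _.
  by rewrite mulr0 => uE; rewrite uE eqxx in u0.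
split=> //; have := congr1 (fun f : {poly R} => f`_i) e.
by rewrite !coefCM !coefXn -ij eqxx !mulr1.
Qed.

Lemma expz_quotient (F : fieldType) (a : int) : exists a1 a2 : nat,
  a = a1%:Z - a2%:Z /\ forall x : F, x != 0 -> x ^ a = x ^+ a1 / x ^+ a2.
Proof.
case: a => k; first by exists k, 0; rewrite subr0; split=> // x _; rewrite divr1.
by exists 0, k.+1; rewrite NegzE sub0r; split=> // x _; rewrite -exprnN mul1r.
Qed.

Lemma independent_exprn (F : fieldType) (q t s : F) : q != 0 -> t != 0 -> s != 0 ->
  (forall a b c a' b' c', q ^+ a * t ^+ b * s ^+ c = q ^+ a' * t ^+ b' * s ^+ c' ->
    [/\ a = a', b = b' & c = c']) ->
  independent q t s.
Proof.
move=> q0 t0 s0 inj; split=> // a b c.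
have [a1 [a2 [-> /(_ _ q0) ->]]] := expz_quotient F a.
have [b1 [b2 [-> /(_ _ t0) ->]]] := expz_quotient F b.
have [c1 [c2 [-> /(_ _ s0) ->]]] := expz_quotient F c.
move=> e; have [|-> -> ->] := inj a1 b1 c1 a2 b2 c2; last by rewrite !subrr.
have d0 : q ^+ a2 * t ^+ b2 * s ^+ c2 != 0 by rewrite !mulf_neq0 ?expf_neq0.
rewrite -[RHS]mul1r -e; field.
by rewrite !expf_neq0.
Qed.

(** Different monomials in [q], [t] and [s] are different polynomials: the degrees in
    [s], in [t] and in [q] are compared in this order. *)
Lemma parameters_independent : independent qF tF sF.
Proof.
apply: independent_exprn.
- by rewrite tofrac_eq0 polyC_eq0 tofrac_eq0 polyC_eq0 polyX_eq0.
- by rewrite tofrac_eq0 polyC_eq0 tofrac_eq0 polyX_eq0.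
- by rewrite tofrac_eq0 polyX_eq0.
move=> a b c a' b' c'.
have monE i j k : qF ^+ i * tF ^+ j * sF ^+ k =
    tofrac ((tofrac (('X^i)%:P * 'X^j))%:P * 'X^k : {poly Fqt}).
  by rewrite !rmorphM !rmorphXn.
rewrite !monE => /eqP; rewrite tofrac_eq => /eqP /monomial_eq[].
  by rewrite tofrac_eq0 mulf_neq0 ?polyC_eq0 ?polyXn_eq0 ?expf_neq0 ?polyX_eq0.
move/eqP; rewrite tofrac_eq => /eqP /monomial_eq[|aE -> ->].
  by rewrite expf_neq0 ?polyX_eq0.
have [||_ ->] := @monomial_eq rat 1 1 a a'; by rewrite ?aE ?oner_eq0.
Qed.

Lemma pchar_Fqts : [pchar Fqts] =i pred0.
Proof.
pose phi : {rmorphism rat -> Fqts} :=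
  (@tofrac {poly Fqt} \o polyC) \o (@tofrac {poly {poly rat}} \o (polyC \o polyC)).
by move=> x; rewrite (fmorph_pchar phi) pchar_num.
Qed.

Theorem theorem4p5 (m n : nat) (kappa la : part n)
  (la_in_rect : included la (rect n m)) (kappa_in_la : included kappa la) :
  \sum_(mu <- parts_in_rect n m | included kappa mu && included mu la)
     sqbinom qF tF sF mu kappa * curlybinom qF tF m sF la mu
    = (la == kappa)%:R
  /\
  \sum_(mu <- parts_in_rect n m | included kappa mu && included mu la)
     curlybinom qF tF m sF mu kappa * sqbinom qF tF sF la mu
    = (la == kappa)%:R.
Proof.
split.
  exact: (inversion_sq_curly pchar_Fqts parameters_independent).
exact: (inversion_curly_sq pchar_Fqts parameters_independent).
Qed.
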